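(* The operators $E_i,L_i^{\pm1},K_i^{\pm1},F_i$ ($1\le i\le n-1$) on $M$ satisfy the following relations, for all $1\le i,j\le n-1$ (with $L_0=L_n=1$): (1) $L_iL_j=L_jL_i$ and $K_i=L_{i-1}^{-1}L_i^2L_{i+1}^{-1}$; (2) $L_iE_jL_i^{-1}=v^{\delta_{i,j}}E_j$ and $L_iF_jL_i^{-1}=v^{-\delta_{i,j}}F_j$; (3) $E_iF_j-F_jE_i=\delta_{i,j}\frac{K_i-K_i^{-1}}{v-v^{-1}}$; (4) if $|i-j|>1$, then $E_iE_j-E_jE_i=0=F_iF_j-F_jF_i$; (5) if $|i-j|=1$, then $E_i^2E_j-(v+v^{-1})E_iE_jE_i+E_jE_i^2=0=F_i^2F_j-(v+v^{-1})F_iF_jF_i+F_jF_i^2$. Equivalently, the operators $e_i,L_i^{\pm1},K_i^{\pm1},f_i$ ($1\le i\le n-1$) on $M$ satisfy (1) together with (2') $L_ie_jL_i^{-1}=v^{\delta_{i,j}}e_j$ and $L_if_jL_i^{-1}=v^{-\delta_{i,j}}f_j$; (3') $e_if_j-v^{c_{ij}}f_je_i=\delta_{i,j}\frac{K_i-K_i^{-1}}{v-v^{-1}}$; (4') if $|i-j|>1$, then $e_ie_j-e_je_i=0=f_if_j-f_jf_i$; (5') if $|i-j|=1$, then $e_i^2e_j-v^{c_{ji}}(v+v^{-1})e_ie_je_i+v^{2c_{ji}}e_je_i^2=0=f_i^2f_j-v^{c_{ji}}(v+v^{-1})f_if_jf_i+v^{2c_{ji}}f_jf_i^2$, where $c_{i,i+1}=-1$,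 $c_{i+1,i}=1$ for $1\le i<n-1$, and $c_{ij}=0$ otherwise.
   Context: Work over $\mathbb C$; $n\ge2$. Geometry: $\mathbf C=\mathbb P^1$ with coordinate $z$ and points $0,\infty$; $\mathbb C^*$ acts by $v(z)=v^{-2}z$. $W$ is a vector space with basis $w_1,\dots,w_n$; the torus $\widetilde T=\{(t_1,\dots,t_n): t_1\cdots t_n=1\}$ acts on $W$ by $\underline t(w_i)=t_i^2w_i$. For $\underline d=(d_1,\dots,d_{n-1})\in\mathbb Z_{\ge0}^{n-1}$ (with $d_0=d_n=0$), $\mathfrak Q_{\underline d}$ is the moduli space of flags of locally free subsheaves $0\subset\mathcal W_1\subset\dots\subset\mathcal W_{n-1}\subset W\otimes\mathcal O_{\mathbf C}$ with $\operatorname{rank}\mathcal W_k=k$, $\deg\mathcal W_k=-d_k$, such that near $\infty$ each $\mathcal W_i$ is a vector subbundle with fibre $\langle w_1,\dots,w_i\rangle$ at $\infty$. It is a smooth quasiprojective variety of dimension $2\sum d_i$ with an action of $\widetilde T\times\mathbb C^*$ (it is empty if some $d_i<0$). Write $\underline d\pm i$ for $\underline d$ with $d_i$ replaced by $d_i\pm1$. $\mathfrak E_{\underline d,i}\subset\mathfrak Q_{\underline d}\times\mathfrak Q_{\underline d+i}$ is the (smooth) correspondence of pairs $(\mathcal W_\bullet,\mathcal W'_\bullet)$ with $\mathcal W_j=\mathcal W'_j$ for $j\ne i$ and $\mathcal W'_i\subset\mathcal W_i$; $\mathbf p,\mathbf q$ are its projections to $\mathfrak Q_{\underline d}$ and $\mathfrak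 Q_{\underline d+i}$; $\mathfrak L_i$ is the line bundle on it with fibre $\Gamma(\mathbf C,\mathcal W_i/\mathcal W'_i)$. $K$-theory: $\mathbb F=\operatorname{Frac}(\mathbb C[\widetilde T\times\mathbb C^*])$, with $\mathbb C[\widetilde T\times\mathbb C^*]=\mathbb C[t_1^{\pm1},\dots,t_n^{\pm1},v^{\pm1}]/(t_1\cdots t_n-1)$ (a square root $v^{1/2}$ is adjoined when half-integral powers of $v$ occur). $M_{\underline d}=K^{\widetilde T\times\mathbb C^*}(\mathfrak Q_{\underline d})\otimes\mathbb F$ (complexified equivariant $K$-theory, localized) and $M=\bigoplus_{\underline d}M_{\underline d}$. The $\widetilde T\times\mathbb C^*$-fixed points of $\mathfrak Q_{\underline d}$ are indexed by collections $\widetilde{\underline d}=(d_{ij})_{1\le j\le i\le n-1}$ of nonnegative integers with $d_i=\sum_{j\le i}d_{ij}$ and $d_{kj}\ge d_{ij}$ for $i\ge k\ge j$; the corresponding flag is $\mathcal W_i=\bigoplus_{j\le i}\mathcal O_{\mathbf C}(-d_{ij}\cdot0)w_j$. The classes $[\widetilde{\underline d}]$ of the structure sheaves of the fixed points form an $\mathbb F$-basis of $M$. Convention for characters and direct images: the function $z$ has character $v^{-2}$ and $w_i$ has character $t_i^2$, so e.g. $\operatorname{Hom}(\mathcal O_{\mathbf C}(-a\cdot 0),\mathcal O_{\mathbf C})$ has character $\sum_{c=0}^av^{2c}$. At a fixed point $x$ of a smooth variety $X$ put $S\chi_x=\prod_\chi(1-\chi)^{-1}$, the product over the weights $\chi$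 of $T_xX$ (the character of $\operatorname{Sym}^\bullet T_xX$). The operators below are defined by localization: $\mathbf p_*\mathbf q^*[\widetilde{\underline d}{}']=\sum_{\widetilde{\underline d}}\frac{S\chi_{(\widetilde{\underline d},\widetilde{\underline d}{}')}}{S\chi_{\widetilde{\underline d}{}'}}[\widetilde{\underline d}]$ and $\mathbf q_*(\mathfrak L_i\otimes\mathbf p^* )[\widetilde{\underline d}]=\sum_{\widetilde{\underline d}{}'}\lambda\,\frac{S\chi_{(\widetilde{\underline d},\widetilde{\underline d}{}')}}{S\chi_{\widetilde{\underline d}}}[\widetilde{\underline d}{}']$, the sums running over fixed points $(\widetilde{\underline d},\widetilde{\underline d}{}')$ of $\mathfrak E_{\underline d,i}$, with $\lambda$ the character of the fibre of $\mathfrak L_i$ at that point. Operators, for $1\le i\le n-1$, given by their restriction to $M_{\underline d}$: $K_i=t_{i+1}t_i^{-1}v^{2d_i-d_{i-1}-d_{i+1}+1}:M_{\underline d}\to M_{\underline d}$; $L_i=t_1^{-1}\cdots t_i^{-1}v^{d_i+\frac12i(n-i)}:M_{\underline d}\to M_{\underline d}$; $f_i=\mathbf p_*\mathbf q^*:M_{\underline d}\to M_{\underline d-i}$; $F_i=t_{i+1}^it_i^{-i}v^{2id_i-id_{i-1}-id_{i+1}-i}\,\mathbf p_*\mathbf q^*:M_{\underline d}\to M_{\underline d-i}$; $e_i=-t_{i+1}^{-1}t_i^{-1}v^{d_{i+1}-d_{i-1}}\,\mathbf q_*(\mathfrak L_i\otimes\mathbf p^* ):M_{\underline d}\to M_{\underline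 d+i}$; $E_i=-t_{i+1}^{-i-1}t_i^{i-1}v^{(i-1)d_{i-1}+(i+1)d_{i+1}-2id_i-i}\,\mathbf q_*(\mathfrak L_i\otimes\mathbf p^* ):M_{\underline d}\to M_{\underline d+i}$. *)

(* Defs.v *)
From HB Require Import structures.
From mathcomp Require Import all_boot all_order all_algebra.
From mathcomp Require Import boolp classical_sets functions fsbigop reals.
From mathcomp Require Import complex.
From mathcomp Require Import freeg mpoly.

Set Implicit Arguments.
Unset Strict Implicit.
Unset Printing Implicit Defensive.
Import Order.TTheory GRing.Theory Num.Theory.
Local Open Scope classical_set_scope.
Local Open Scope ring_scope.

(* Conventions.  Sheaves and vertices are labelled by naturals 1, ..., n-1 as
   in the mathematics; the basis vector w_{l+1} of W corresponds to l : 'I_n.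
   A subsheaf of W (x) O on P^1 that is a subbundle near infinity is given by
   its C[z]-module of sections over P^1 minus infinity, a subset of
   W (x) C[z] = 'I_n -> {poly C}. *)

(* ------------------------------------------------------------------------ *)
(* Coefficients                                                             *)

(* Since t_1 ... t_n = 1 allows one to eliminate t_n, the field
   Frac (C[t_1^+-1, ..., t_n^+-1, v^+-1] / (t_1 ... t_n - 1)) (v^(1/2)) is the
   field of rational functions in v^(1/2) (variable number 0) and
   t_1, ..., t_{n-1} (variables number 1, ..., n-1). *)
Definition scalars (R : realType) (n : nat) : fieldType :=
  {fraction {mpoly R[i][n.-1.+1]}}.

Section Scalars.
Variables (R : realType) (n : nat).
Local Notation F := (scalars R n).

Definition var (i : nat) : F :=
  FracField.tofrac ('X_(inord i) : {mpoly R[i][n.-1.+1]}).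

Definition vhalf : F := var 0.

Definition vF : F := vhalf ^+ 2.

Definition tF (i : nat) : F :=
  if (i < n)%N then var i else (\prod_(1 <= j < n) var j)^-1.

End Scalars.

(* ------------------------------------------------------------------------ *)
(* The torus and characters of its representations                          *)

(* C-points of T~ x C^*. *)
Record torus (R : realType) (n : nat) := Torus {
  tpt : 'I_n -> R[i];
  vpt : R[i];
  tpt_prod : \prod_l tpt l = 1;
  vpt_neq0 : vpt != 0 }.

Section Characters.
Variables (R : realType) (n : nat).
Local Notation C := R[i].
Local Notation F := (scalars R n).
Local Notation torus := (torus R n).

Lemma torus_inv_prod (g : torus) : \prod_l (tpt g l)^-1 = 1.
Proof. by rewrite prodfV tpt_prod invr1. Qed.

Lemma torus_inv_neq0 (g : torus) : (vpt g)^-1 != 0.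
Proof. by rewrite invr_eq0 vpt_neq0. Qed.

Definition torus_inv (g : torus) : torus :=
  Torus (torus_inv_prod g) (torus_inv_neq0 g).

(* (mu, c) stands for the character t_1^mu_1 ... t_n^mu_n v^c. *)
Definition weight := ({ffun 'I_n -> int} * int)%type.

Definition weight_at (g : torus) (chi : weight) : C :=
  \prod_l tpt g l ^ chi.1 l * vpt g ^ chi.2.

Definition weightF (chi : weight) : F :=
  \prod_(l < n) tF R n l.+1 ^ chi.1 l * vF R n ^ chi.2.

(* For subspaces B and A (B contained in A) of a vector space U, both stable
   under an action rho of the torus, s is the list with multiplicities of the
   weights of A / B: some family of vectors of A with these weights modulo B
   is a basis modulo B. *)
Definition has_weights (U : lmodType C) (rho : torus -> U -> U)
    (A B : set U) (s : seq weight) : Prop :=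
  exists e : 'I_(size s) -> U,
    [/\ forall k, A (e k),
        forall g k, B (rho g (e k) - weight_at g (tnth (in_tuple s) k) *: e k)
      & forall u, A u ->
          exists! c : {ffun 'I_(size s) -> C}, B (u - \sum_k c k *: e k)].

(* Unique up to order and up to the relation t_1 ... t_n = 1. *)
Definition weights (U : lmodType C) (rho : torus -> U -> U) (A B : set U) :
  seq weight := xget [::] (has_weights rho A B).

Definition character (U : lmodType C) (rho : torus -> U -> U) (A B : set U) : F :=
  \sum_(chi <- weights rho A B) weightF chi.

Definition Sym_character (U : lmodType C) (rho : torus -> U -> U)
    (A B : set U) : F :=
  \prod_(chi <- weights rho A B) (1 - weightF chi)^-1.

End Characters.

(* ------------------------------------------------------------------------ *)
(* Tangent spaces of the moduli of flags and of the correspondence          *)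

Section Tangent.
Variables (R : realType) (n : nat).
Local Notation C := R[i].
Local Notation torus := (torus R n).

Definition sect : Type := 'I_n -> {poly C}.
HB.instance Definition _ := GRing.Lmodule.on sect.

Definition scale_sect (p : {poly C}) (s : sect) : sect := fun l => p * s l.

(* z^m w_l has weight v^(-2m) t_l^2. *)
Definition act_sect (g : torus) (s : sect) : sect :=
  fun l => (tpt g l ^+ 2) *: (s l \Po ((vpt g ^- 2) *: 'X)).

(* phi represents an O-linear map from the subsheaf of rank k with sections N
   to the quotient (W (x) O) / N, as a C[z]-linear map N -> W (x) C[z] / N:
   phi s is a lift of the image of s.  The second condition expresses that
   the map extends to infinity and that its fibre there,
   <w_1, ..., w_k> -> W / <w_1, ..., w_k>, is zero: if z^(-a) s is regular at
   infinity, then z^(-a) phi(s) is, modulo the sections of N with arbitrary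
   pole at 0, regular at infinity with value there in <w_1, ..., w_k>. *)
Definition hom_to_quotient (k : nat) (N : set sect) (phi : sect -> sect) : Prop :=
  (forall (p : {poly C}) (s s' : sect), N s -> N s' ->
     N (phi (scale_sect p s + s') - (scale_sect p (phi s) + phi s'))) /\
  (forall (a : nat) (s : sect), N s -> (forall l, (size (s l) <= a.+1)%N) ->
     exists (b : nat) (s' : sect), N s' /\
       forall l, let r := scale_sect 'X^b (phi s) l - s' l in
         (size r <= (a + b).+1)%N /\ ((k <= l)%N -> r`_(a + b) = 0)).

(* Families phi_1, ..., phi_{n-1} (values at other indices are irrelevant). *)
Definition homs : Type := nat -> sect -> sect.
HB.instance Definition _ := GRing.Lmodule.on homs.

Definition act_homs (g : torus) (phi : homs) : homs :=
  fun k s => act_sect g (phi k (act_sect (torus_inv g) s)).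

(* The Zariski tangent space at a flag W_1 < ... < W_{n-1} to the moduli space
   of flags of subsheaves is the space of compatible families
   phi_k : W_k -> (W (x) O) / W_k vanishing at infinity, i.e. the quotient of
   tangent_Q by the families that are zero modulo the W_k. *)
Definition tangent_Q (N : nat -> set sect) : set homs :=
  [set phi |
    (forall k, (0 < k < n)%N -> hom_to_quotient k (N k) (phi k)) /\
    (forall k, (0 < k)%N -> (k.+1 < n)%N ->
       forall s, N k s -> N k.+1 (phi k.+1 s - phi k s))].

Definition null_Q (N : nat -> set sect) : set homs :=
  [set phi | forall k, (0 < k < n)%N -> forall s, N k s -> N k (phi k s)].

(* The tangent space to the correspondence E_{d,i} of pairs (W, W') inside the sum of the tangent
   spaces at the two flags: linearization of the conditions W_k = W'_k for
   k <> i and W'_i < W_i. *)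
Definition act_homs2 (g : torus) (phi : homs * homs) : homs * homs :=
  (act_homs g phi.1, act_homs g phi.2).

Definition tangent_E (i : nat) (N N' : nat -> set sect) : set (homs * homs) :=
  [set phi |
    [/\ tangent_Q N phi.1, tangent_Q N' phi.2,
        forall k, (0 < k < n)%N -> k != i ->
          forall s, N k s -> N k (phi.1 k s - phi.2 k s)
      & forall s, N' i s -> N i (phi.1 i s - phi.2 i s)]].

Definition null_E (N N' : nat -> set sect) : set (homs * homs) :=
  [set phi | null_Q N phi.1 /\ null_Q N' phi.2].

End Tangent.

(* ------------------------------------------------------------------------ *)
(* Fixed points                                                             *)

(* The collections (d_ij) with 1 <= j <= i <= n-1; all other entries are 0. *)
Definition fixpt_wf (n : nat) (d : {ffun 'I_n * 'I_n -> nat}) : bool :=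
  [forall i : 'I_n, forall j : 'I_n, ~~ (0 < j <= i)%N ==> (d (i, j) == 0%N)] &&
  [forall i : 'I_n, forall k : 'I_n, forall j : 'I_n,
     (0 < j <= k)%N && (k <= i)%N ==> (d (i, j) <= d (k, j))%N].

Definition fixpt (n : nat) : Type :=
  {d : {ffun 'I_n * 'I_n -> nat} | fixpt_wf d}.
HB.instance Definition _ n := Choice.on (fixpt n).

Definition entry (n : nat) (x : fixpt n) (i j : nat) : nat :=
  match insub i, insub j with
  | Some i', Some j' => val x (i', j')
  | _, _ => 0%N
  end.

(* d_i, with d_0 = d_n = 0. *)
Definition degree (n : nat) (x : fixpt n) (i : nat) : nat :=
  \sum_(1 <= j < i.+1) entry x i j.

(* Sections of W_k = (+)_{j <= k} O(- d_kj . 0) w_j over P^1 minus infinity. *)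
Definition flag (R : realType) (n : nat) (x : fixpt n) (k : nat) :
    set (sect R n) :=
  [set s : sect R n | forall l : 'I_n,
     ((l < k)%N -> 'X^(entry x k l.+1) %| s l) /\ ((k <= l)%N -> s l = 0)].

Arguments flag R {n} x k.

(* (x, y) is a fixed point of the correspondence E_{d,i} (d the degree of x) of
   pairs of flags (W, W') with W_k = W'_k for k <> i and W'_i < W_i of
   colength 1. *)
Definition corr (R : realType) (n i : nat) (x y : fixpt n) : Prop :=
  [/\ forall k, (0 < k < n)%N -> k != i -> flag R x k = flag R y k,
      flag R y i `<=` flag R x i
    & degree y i = (degree x i).+1].

Arguments corr R {n} i x y.

(* ------------------------------------------------------------------------ *)
(* The module M and the operators                                           *)

(* M is the vector space with basis the classes << x >> of the fixed points;
   M_d is spanned by the << x >> with degree x = d. *)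
Definition Kmod (R : realType) (n : nat) : lmodType (scalars R n) :=
  {freeg (fixpt n) / (scalars R n)}.

Section Operators.
Variables (R : realType) (n : nat).
Local Notation F := (scalars R n).
Local Notation M := (Kmod R n).
Local Notation t := (tF R n).
Local Notation v := (vF R n).
Implicit Types (x y : fixpt n) (d : nat -> nat) (i : nat).

Definition cls x : M := (<< x >> : {freeg (fixpt n) / F}).

(* Linear extension of a map defined on the basis. *)
Definition linext (f : fixpt n -> M) : M -> M := fglift f.

(* The operator acting on each M_d by the scalar c d. *)
Definition diagop (c : (nat -> nat) -> F) : M -> M :=
  linext (fun x => c (degree x) *: cls x).

Definition S_Q x : F :=
  Sym_character (@act_homs R n) (tangent_Q (flag R x)) (null_Q (flag R x)).

Definition S_E i x y : F :=
  Sym_character (@act_homs2 R n) (tangent_E i (flag R x) (flag R y))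
    (null_E (flag R x) (flag R y)).

(* Character of the fibre Gamma(W_i / W'_i) of the line bundle L_i; the sheaf
   W_i / W'_i is supported at 0. *)
Definition line_char i x y : F :=
  character (@act_sect R n) (flag R x i) (flag R y i).

Definition pq i : M -> M :=
  linext (fun y => \sum_(x \in [set x | corr R i x y])
                      (S_E i x y / S_Q y) *: cls x).

Definition qLp i : M -> M :=
  linext (fun x => \sum_(y \in [set y | corr R i x y])
                      (line_char i x y * (S_E i x y / S_Q x)) *: cls y).

Definition K_scalar i d : F :=
  t i.+1 / t i * v ^ (2 * (d i)%:Z - (d i.-1)%:Z - (d i.+1)%:Z + 1).

(* v^(d_i + i(n-i)/2) is (v^(1/2))^(2 d_i + i(n-i)); L_0 = L_n = 1. *)
Definition L_scalar i d : F :=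
  if (0 < i < n)%N then
    (\prod_(1 <= j < i.+1) t j)^-1 * vhalf R n ^+ (2 * d i + i * (n - i))
  else 1.

Definition K_op i : M -> M := diagop (K_scalar i).
Definition Kinv_op i : M -> M := diagop (fun d => (K_scalar i d)^-1).
Definition L_op i : M -> M := diagop (L_scalar i).
Definition Linv_op i : M -> M := diagop (fun d => (L_scalar i d)^-1).

Definition f_op i : M -> M := pq i.

Definition F_op i (m : M) : M :=
  pq i (diagop (fun d =>
    t i.+1 ^+ i * t i ^- i *
    v ^ (2 * i%:Z * (d i)%:Z - i%:Z * (d i.-1)%:Z - i%:Z * (d i.+1)%:Z - i%:Z))
  m).

Definition e_op i (m : M) : M :=
  qLp i (diagop (fun d =>
    - ((t i.+1)^-1 * (t i)^-1 * v ^ ((d i.+1)%:Z - (d i.-1)%:Z))) m).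

Definition E_op i (m : M) : M :=
  qLp i (diagop (fun d =>
    - (t i.+1 ^- i.+1 * t i ^+ i.-1 *
       v ^ ((i%:Z - 1) * (d i.-1)%:Z + (i%:Z + 1) * (d i.+1)%:Z
            - 2 * i%:Z * (d i)%:Z - i%:Z))) m).

End Operators.

Definition cmat (i j : nat) : int :=
  if j == i.+1 then -1 else if i == j.+1 then 1 else 0.

(* Main.v *)
Require Import Defs.
From HB Require Import structures.
From mathcomp Require Import all_boot all_order all_fingroup all_algebra.
From mathcomp Require Import boolp classical_sets functions fsbigop reals.
From mathcomp Require Import complex freeg mpoly zify ring.

Set Implicit Arguments.
Unset Strict Implicit.
Unset Printing Implicit Defensive.
Import Order.TTheory GRing.Theory Num.Theory.
Local Open Scope ring_scope.

(* Put s_{kl} = t_l^2 v^(-2 d_{kl}).  Tangent spaces at fixed points split into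
   weight vectors z^(d_{kj}) w_j |-> z^(d_{kj} + a) w_l supported on runs of
   consecutive k.  All factors but those in rows i-1, i, i+1 cancel in the ratios
   of S-characters, and adding 1 to d_{ij} has coefficient
     s_{ij} prod_{l < i} (1 - s_{ij} / s_{i-1,l})
       / ((1 - v^2) prod_{l <> j} (1 - s_{ij} / s_{il}))
   in qLp i, while subtracting 1 from d_{ij} has coefficient
     prod_{l <= i+1} (1 - s_{i+1,l} / s_{ij})
       / ((1 - v^2) prod_{l <> j} (1 - s_{il} / s_{ij}))
   in pq i.  Substituting s -> 1/s and exchanging rows i-1 and i+1 gives both
   the same shape, so that the quadratic and Serre relations are treated once for
   both; the Serre relations reduce to rational identities in the columns b, b' of
   row i, symmetrized in b and b'.  In the commutator for i = j the
   off-diagonal terms cancel, and the diagonal ones are the Lagrange interpolation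
   formula for a leading coefficient, whose nodes are 0, the s_{il} and the
   v^(-2) s_{il}. *)

(** * Scalars *)

(** A tangent space is cut out of the sum of the Hom(W_k, (W (x) O) / W_k) by conditions with values
    in the Hom(W_k, (W (x) O) / W_(k+1)). In each weight such a condition only identifies
    coefficients at consecutive k or kills one, so weights are counted combinatorially, and an
    S-character is a product over rows divided by a product over pairs of consecutive rows. A pair
    of flags is one longer chain with W'_i inserted, which is why ratios of S-characters keep so few
    factors. The list [weights] is a choice; a count is usable only because such lists are unique up
    to the relation t_1 ... t_n = 1. Products of operators are expanded over all columns, including
    those that leave the set of fixed points; there the coefficient contains a factor 1 - 1.
    Denominators do not vanish, because parameters of different columns never differ by just a power
    of v. The prefactors enter the relations only through the change of a linear form in the
    degrees, so that one treatment covers both the pair E, F and the pair e, f. *)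

Section Scalars.
Variables (R : realType) (n : nat).
Hypothesis hn : (2 <= n)%N.
Local Notation F := (scalars R n).
Local Notation t := (tF R n).
Local Notation v := (vF R n).
Local Notation X i := (FracField.tofrac ('X_i : {mpoly R[i][n.-1.+1]}) : F).

Lemma tofracX_neq0 i : X i != 0.
Proof.
rewrite tofrac_eq0; apply/eqP => /(congr1 (meval (fun=> 1))).
by rewrite mevalXU meval0; apply/eqP; rewrite oner_eq0.
Qed.

Lemma monomial_eq1 (e : 'I_n.-1.+1 -> int) :
  \prod_i X i ^ e i = 1 -> forall i, e i = 0.
Proof.
pose p i := if e i is Posz k then k else 0%N.
pose q i := if e i is Negz k then k.+1 else 0%N.
have eE i : e i = (p i)%:Z - (q i)%:Z by rewrite /p /q; case: (e i) => k; lia.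
have XE i : X i ^ e i = FracField.tofrac ('X_i ^+ p i) / FracField.tofrac ('X_i ^+ q i).
  by rewrite eE expfzDr ?tofracX_neq0// -exprnN !rmorphXn.
rewrite (eq_bigr _ (fun i _ => XE i)) big_split/= prodfV -!rmorph_prod => prod1 i.
have pq : \prod_i 'X_i ^+ p i = \prod_i 'X_i ^+ q i :> {mpoly R[i][n.-1.+1]}.
  apply/eqP; rewrite -tofrac_eq; apply/eqP.
  apply/divr1_eq; rewrite -prod1 // !rmorph_prod.
(* At this point the two monomials become powers of 2 with exponents [p i] and [q i]. *)
pose w k : R[i] := if k == i then 2%:R else 1.
have mevalE r : (\prod_k 'X_k ^+ r k : {mpoly R[i][n.-1.+1]}).@[w] = 2%:R ^+ r i.
  rewrite rmorph_prod/= (bigD1 i)//= rmorphXn/= mevalXU /w eqxx big1 ?mulr1//.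
  by move=> k /negPf ki; rewrite rmorphXn/= mevalXU ki expr1n.
have /(congr1 (meval w)) := pq; rewrite !mevalE => /eqP.
rewrite -!natrX eqr_nat eqn_exp2l// => /eqP pqi.
by rewrite eE pqi subrr.
Qed.

(** Exponents of t_l in the independent variables: t_n has exponent -1 in each of t_1, ..., t_(n-1),
    and variable 0 is v^(1/2). *)
Definition texp (l : nat) (i : nat) : int :=
  if i == 0%N then 0 else if (l < n)%N then (l == i)%:Z else -1.

Lemma tFE l : (0 < l)%N -> t l = \prod_(i < n.-1.+1) X i ^ texp l i.
Proof.
move=> l0; rewrite /tF; case: ifP => ln.
  rewrite (bigD1 (inord l))//= big1 => [|i il].
    rewrite mulr1 /texp inordK; last by lia.
    by rewrite ln eqxx; case: eqP => //; lia.
  rewrite /texp ln; case: eqP => //; case: eqP => // li _.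
  by case/eqP: il; apply: val_inj; rewrite /= inordK; lia.
rewrite big_ord_recl /= mul1r /texp/= ln -prodfV.
have -> : index_iota 1 n = index_iota 1 n.-1.+1 by rewrite prednK//; lia.
rewrite big_add1 big_mkord/=.
apply: eq_bigr => i _; rewrite /bump/= exprN1 /var; congr (FracField.tofrac _)^-1.
by congr ('X_ _); apply: val_inj; rewrite /= inordK// ltnS.
Qed.

Lemma tF_neq0 l : (0 < l)%N -> t l != 0.
Proof.
move=> l0; rewrite tFE//; apply/prodf_neq0 => i _.
by rewrite expfz_neq0 ?tofracX_neq0.
Qed.

Lemma vhalf_neq0 : vhalf R n != 0.
Proof. exact: tofracX_neq0. Qed.

Lemma vF_neq0 : v != 0.
Proof. by rewrite expf_neq0 ?vhalf_neq0. Qed.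

Lemma prod_tF : \prod_(1 <= l < n.+1) t l = 1.
Proof.
rewrite big_nat_recr/=; last by lia.
have -> : t n = (\prod_(1 <= j < n) var R n j)^-1 by rewrite /tF ltnn.
rewrite (eq_big_nat _ _ (F2 := var R n)) => [|i /andP[_ lin]]; last by rewrite /tF lin.
by rewrite divff// prodf_seq_neq0; apply/allP => i _; rewrite tofracX_neq0.
Qed.

(** If l and b differ, the exponent of the variable t_l (of t_b when l = n) is 2 or 4 up to sign,
    since t_n only contributes with the opposite sign. This underlies the nonvanishing of the
    denominators. *)
Lemma generic_weight l b k : (0 < l <= n)%N -> (0 < b <= n)%N ->
  t l ^+ 2 / t b ^+ 2 * v ^ k = 1 -> l = b /\ k = 0.
Proof.
move=> /andP[l0 ln] /andP[b0 bn] tv.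
pose e (i : 'I_n.-1.+1) : int :=
  2 * texp l i - 2 * texp b i + (if i == ord0 then 2 * k else 0).
have e0 : forall i, e i = 0.
  apply: monomial_eq1; apply: etrans tv; rewrite (tFE l0) (tFE b0).
  under eq_bigr => i _ do rewrite !expfzDr ?tofracX_neq0//.
  rewrite !big_split/=; congr (_ * _ * _).
  - rewrite -prodrXl; apply: eq_bigr => i _.
    by rewrite exprnP exprz_exp mulrC.
  - rewrite -prodrXl -prodfV; apply: eq_bigr => i _.
    by rewrite exprnP exprz_exp invr_expz [2 * _]mulrC.
  rewrite (bigD1 ord0)//= big1 ?mulr1 => [|i /negPf ->//].
  rewrite /vF /vhalf /var exprnP exprz_exp; congr (FracField.tofrac ('X_ _) ^ _).
  by apply: val_inj; rewrite /= inordK.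
split; last first.
  by have := e0 ord0; rewrite /e/= /texp/=; lia.
apply/eqP; apply: contraT => lb.
case: (ltnP l n) => ln'.
  have ll : (l < n.-1.+1)%N by lia.
  have := e0 (Ordinal ll); rewrite /e /texp -val_eqE/= ln' eqxx.
  by do ![case: ifP => /=]; lia.
have bb : (b < n.-1.+1)%N by lia.
have := e0 (Ordinal bb); rewrite /e /texp -val_eqE/= eqxx.
by do ![case: ifP => /=]; lia.
Qed.

Lemma natF_neq0 k : (k.+1%:R : F) != 0.
Proof.
have -> : (k.+1%:R : F) = FracField.tofrac (k.+1%:R : {mpoly R[i][n.-1.+1]}).
  by rewrite rmorph_nat.
rewrite tofrac_eq0; apply/eqP => /(congr1 (meval (fun=> 1))).
by rewrite rmorph_nat meval0; apply/eqP; rewrite pnatr_eq0.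
Qed.

End Scalars.

Lemma det_neq0_perm (K : comPzRingType) n (A : 'M[K]_n) :
  \det A != 0 -> exists s : 'S_n, \prod_i A i (s i) != 0.
Proof.
apply: contra_neqP => nex; rewrite /determinant big1// => s _.
have [->|p0] := eqVneq (\prod_i A i (s i)) 0; first by rewrite mulr0.
by case: nex; exists s.
Qed.

(** * Weights of representations *)

Section WeightUniqueness.
Variables (R : realType) (n : nat) (U : lmodType R[i]).
Variables (rho : torus R n -> U -> U) (A B : set U).
Hypotheses (B0 : B 0) (Blin : forall a x y, B x -> B y -> B (a *: x + y)).
Hypothesis rho_lin :
  forall g a x y, rho g (a *: x + y) = a *: rho g x + rho g y.
Hypothesis rhoB : forall g x, B x -> B (rho g x).

Local Lemma BZ a x : B x -> B (a *: x).
Proof. by move=> Bx; rewrite -[_ *: _]addr0; apply: Blin. Qed.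

Local Lemma BD x y : B x -> B y -> B (x + y).
Proof. by move=> Bx By; rewrite -[x]scale1r; apply: Blin. Qed.

Local Lemma BN x : B x -> B (- x).
Proof. by move=> Bx; rewrite -scaleN1r; apply: BZ. Qed.

Local Lemma BB x y : B x -> B y -> B (x - y).
Proof. by move=> Bx By; apply: BD => //; apply: BN. Qed.

Local Lemma Btrans y x z : B (x - y) -> B (y - z) -> B (x - z).
Proof. by move=> xy yz; have := BD xy yz; rewrite addrA subrK. Qed.

Local Lemma Bsum I (r : seq I) (f : I -> U) :
  (forall i, B (f i)) -> B (\sum_(i <- r) f i).
Proof. by move=> Bf; elim/big_rec: _ => // i x _; apply: BD. Qed.

Local Lemma rho0 g : rho g 0 = 0.
Proof. by have := rho_lin g (-1) 0 0; rewrite scaler0 addr0 scaleN1r addNr. Qed.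

Local Lemma rhoZ g a x : rho g (a *: x) = a *: rho g x.
Proof. by rewrite -[_ *: x]addr0 rho_lin rho0 addr0. Qed.

Local Lemma rhoD g x y : rho g (x + y) = rho g x + rho g y.
Proof. by rewrite -[x]scale1r rho_lin !scale1r. Qed.

Local Lemma rho_sum g I (r : seq I) (f : I -> U) :
  rho g (\sum_(i <- r) f i) = \sum_(i <- r) rho g (f i).
Proof. by apply: big_morph; [exact: rhoD | exact: rho0]. Qed.

Let basis m (w : 'I_m -> weight n) (e : 'I_m -> U) :=
  [/\ forall k, A (e k),
      forall g k, B (rho g (e k) - weight_at g (w k) *: e k)
    & forall u, A u -> exists! c : {ffun 'I_m -> R[i]}, B (u - \sum_k c k *: e k)].

Local Lemma basis_free m w e : @basis m w e ->
  forall c : 'I_m -> R[i], B (\sum_k c k *: e k) -> forall k, c k = 0.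
Proof.
move=> [Ae _ ex] c Bc k; have [d [Bd uniqd]] := ex _ (Ae k).
have := uniqd [ffun k => d k + c k].
have -> : \sum_k0 [ffun k => d k + c k] k0 *: e k0 =
    \sum_k0 d k0 *: e k0 + \sum_k0 c k0 *: e k0.
  by rewrite -big_split/=; apply: eq_bigr => l _; rewrite ffunE scalerDl.
rewrite opprD addrA => /(_ (BB Bd Bc)) /ffunP/(_ k).
by rewrite ffunE -[LHS]addr0 => /addrI.
Qed.

Local Lemma basis_coord m w e m' w' e' : @basis m w e -> @basis m' w' e' ->
  exists c : 'M[R[i]]_(m', m), forall k', B (e' k' - \sum_k c k' k *: e k).
Proof.
move=> [_ _ ex] [Ae' _ _].
have /choice[c Bc] : forall k', exists c : {ffun 'I_m -> R[i]},
    B (e' k' - \sum_k c k *: e k).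
  by move=> k'; have [c [Bc _]] := ex _ (Ae' k'); exists c.
exists (\matrix_(k', k) c k' k) => k'.
by under eq_bigr => k _ do rewrite mxE.
Qed.

Local Lemma basis_coordK m w e m' w' e' (c : 'M_(m', m)) (d : 'M_(m, m')) :
  @basis m w e -> @basis m' w' e' ->
  (forall k', B (e' k' - \sum_k c k' k *: e k)) ->
  (forall k, B (e k - \sum_k' d k k' *: e' k')) -> c *m d = 1%:M.
Proof.
move=> be be' Bc Bd; apply/matrixP => k' l'.
suff : (1%:M - c *m d) k' l' = 0 by rewrite !mxE => /eqP; rewrite subr_eq0 => /eqP.
apply: (basis_free be' (c := (1%:M - c *m d) k')) l'.
have -> : \sum_l (1%:M - c *m d) k' l *: e' l =
    (e' k' - \sum_k c k' k *: e k) +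
    \sum_k c k' k *: (e k - \sum_l d k l *: e' l).
  rewrite [X in _ = _ + X](eq_bigr _ (fun k _ => scalerBr _ _ _)).
  rewrite sumrB addrA subrK.
  rewrite (eq_bigr (fun l => (k' == l)%:R *: e' l -
    (\sum_k c k' k * d k l) *: e' l)) => [|l _]; last by rewrite !mxE scalerBl.
  rewrite sumrB; congr (_ - _).
    rewrite (bigD1 k')//= eqxx scale1r big1 ?addr0// => l /negPf.
    by rewrite eq_sym => ->; rewrite scale0r.
  under eq_bigr => l _ do rewrite scaler_suml.
  rewrite exchange_big/=; apply: eq_bigr => k _; rewrite scaler_sumr.
  by apply: eq_bigr => l _; rewrite scalerA.
by apply: BD => //; apply: Bsum => k; apply: BZ.
Qed.

(* The transition matrix between two weight bases is invertible, so some
   permutation picks a nonzero entry in each row; a nonzero entry forces the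
   two characters involved to coincide. *)
Lemma has_weights_big (T : Type) (idx : T) (op : Monoid.com_law idx)
    (f : weight n -> T) s s' :
  (forall chi chi', (forall g : torus R n, weight_at g chi = weight_at g chi') ->
     f chi = f chi') ->
  has_weights rho A B s -> has_weights rho A B s' ->
  \big[op/idx]_(chi <- s) f chi = \big[op/idx]_(chi <- s') f chi.
Proof.
move=> ff [e be] [e' be'].
rewrite -[s in LHS](in_tupleE s) -[s' in RHS](in_tupleE s') !big_tuple.
move: (tnth (in_tuple s)) (tnth (in_tuple s')) be be' => w w'.
move: (size s) (size s') e e' w w' => m m' e e' w w' be be'.
have [c Bc] := basis_coord be be'; have [d Bd] := basis_coord be' be.
have cd := basis_coordK be be' Bc Bd; have dc := basis_coordK be' be Bd Bc.
have mm : m' = m.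
  by apply/eqP; rewrite eqn_leq (mulmx1_min cd) (mulmx1_min dc).
subst m'.
have /det_neq0_perm[sg sg0] : \det c != 0.
  apply: contra_eq_neq (congr1 determinant cd) => c0.
  by rewrite det_mulmx c0 mul0r det1 eq_sym oner_eq0.
rewrite [LHS](reindex_perm sg)/=; apply: eq_bigr => k _; apply: ff => g.
have c0 : c k (sg k) != 0.
  by move: sg0; apply: contra_neq => ck; rewrite (bigD1 k)//= ck mul0r.
have /(_ (sg k))/eqP : forall l, c k l * (weight_at g (w' k) - weight_at g (w l)) = 0.
  apply: (basis_free be).
  have -> : \sum_l (c k l * (weight_at g (w' k) - weight_at g (w l))) *: e l =
      weight_at g (w' k) *: (\sum_l c k l *: e l) -
      \sum_l c k l *: (weight_at g (w l) *: e l).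
    rewrite scaler_sumr -sumrB; apply: eq_bigr => l _.
    by rewrite !scalerA -scalerBl mulrBr [c k l * weight_at g (w' k)]mulrC.
  have [_ we _] := be; have [_ we' _] := be'.
  apply: (@Btrans (weight_at g (w' k) *: e' k)).
    by rewrite -scalerBr; apply: BZ; rewrite -opprB; apply: BN.
  apply: (@Btrans (rho g (e' k))); first by rewrite -opprB; apply: BN; exact: we'.
  apply: (@Btrans (\sum_l c k l *: rho g (e l))).
    have := rhoB g (Bc k); rewrite addrC -scaleN1r rho_lin scaleN1r rho_sum addrC.
    by under eq_bigr => l _ do rewrite rhoZ.
  by rewrite -sumrB; apply: Bsum => l; rewrite -scalerBr; apply: BZ.
by rewrite mulf_eq0 (negPf c0)/= subr_eq0 => /eqP.
Qed.

End WeightUniqueness.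

Section Characters.
Variables (R : realType) (n : nat).
Hypothesis hn : (2 <= n)%N.

(** A character trivial at all points of the torus is a power of t_1 ... t_n, and this product is 1
    in the field too. Points with coordinates 1, 2 and 1/2 detect it, the powers of 2 being
    distinct. *)
Lemma weight_at_weightF (chi chi' : weight n) :
  (forall g : torus R n, weight_at g chi = weight_at g chi') ->
  weightF R chi = weightF R chi'.
Proof.
move=> chiE.
have two_inj : injective (fun z : int => (2 : R[i]) ^ z).
  have twoE z : (2 : R[i]) ^ z = real_complex R (2 ^ z).
    by rewrite fmorphXz rmorph_nat.
  move=> x y /=; rewrite !twoE => /fmorph_inj; apply: ieexprIz => //.
  by rewrite -subr_eq0 -[2]/(1 + 1) addrK oner_eq0.
have two0 : (2 : R[i]) != 0 by rewrite pnatr_eq0.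
have vE : chi.2 = chi'.2.
  have one_prod : \prod_(l < n) (1 : R[i]) = 1 by rewrite big1.
  have := chiE (Torus one_prod two0); rewrite /weight_at/=.
  rewrite !big1 ?mul1r; first exact: two_inj.
    by move=> l _; rewrite exp1rz.
  by move=> l _; rewrite exp1rz.
pose l0 : 'I_n := Ordinal (leq_trans (isT : 0 < 2)%N hn).
have tE l : chi.1 l - chi'.1 l = chi.1 l0 - chi'.1 l0.
  have [->//|ll0] := eqVneq l l0.
  pose tt (k : 'I_n) : R[i] := if k == l then 2 else if k == l0 then 2^-1 else 1.
  have ttl : tt l = 2 by rewrite /tt eqxx.
  have ttl0 : tt l0 = 2^-1 by rewrite /tt eq_sym (negPf ll0) eqxx.
  have tt_prod h : \prod_k tt k ^ h k = 2 ^ (h l - h l0).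
    rewrite (bigD1 l)//= (bigD1 l0) 1?eq_sym//= big1 => [|k /andP[/negPf kl /negPf kl0]].
      rewrite ttl ttl0 [X in _ * X]mulr1.
      by rewrite exprz_inv -expfzDr.
    by rewrite /tt kl kl0 exp1rz.
  have tt1 : \prod_k tt k = 1.
    have e1 := tt_prod (fun=> 1); rewrite subrr expr0z in e1.
    by apply: etrans e1; apply: eq_bigr.
  have := chiE (Torus tt1 (oner_neq0 _)); rewrite /weight_at/= !tt_prod !exp1rz !mulr1.
  by move/two_inj => h; lia.
rewrite /weightF vE; congr (_ * _).
have -> : \prod_(l < n) tF R n l.+1 ^ chi.1 l =
  \prod_(l < n) (tF R n l.+1 ^ chi'.1 l * tF R n l.+1 ^ (chi.1 l0 - chi'.1 l0)).
  apply: eq_bigr => l _; rewrite -expfzDr ?tF_neq0// -(tE l).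
  by congr (_ ^ _); lia.
rewrite big_split/=; have := prod_tF R hn; rewrite big_add1 big_mkord/= => prod1.
suff -> : \prod_(l < n) tF R n l.+1 ^ (chi.1 l0 - chi'.1 l0) =
    (\prod_(l < n) tF R n l.+1) ^ (chi.1 l0 - chi'.1 l0).
  by rewrite prod1 exp1rz mulr1.
by apply/esym; elim/big_rec2: _ => [|l x y _ <-]; rewrite ?exp1rz ?expfzMl.
Qed.

Variables (U : lmodType R[i]) (rho : torus R n -> U -> U) (A B : set U).
Hypotheses (B0 : B 0) (Blin : forall a x y, B x -> B y -> B (a *: x + y)).
Hypothesis rho_lin :
  forall g a x y, rho g (a *: x + y) = a *: rho g x + rho g y.
Hypothesis rhoB : forall g x, B x -> B (rho g x).

Lemma has_weights_weights s : has_weights rho A B s ->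
  has_weights rho A B (weights rho A B).
Proof. by move=> As; apply: xgetPex; exists s. Qed.

Lemma Sym_characterE s : has_weights rho A B s ->
  Sym_character rho A B = \prod_(chi <- s) (1 - weightF R chi)^-1.
Proof.
move=> As; rewrite /Sym_character.
rewrite (has_weights_big B0 Blin rho_lin rhoB _ _ _ As)//.
  by move=> chi chi' /weight_at_weightF ->.
exact: has_weights_weights As.
Qed.

Lemma character1E chi : has_weights rho A B [:: chi] ->
  character rho A B = weightF R chi.
Proof.
move=> As; rewrite /character.
rewrite (has_weights_big B0 Blin rho_lin rhoB _ _ _ As) ?big_seq1//.
  by move=> psi psi' /weight_at_weightF ->.
exact: has_weights_weights As.
Qed.

End Characters.

(** * Homomorphisms from a sheaf to a quotient *)

Section Shift.
Variable K : fieldType.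
Implicit Types (p q : {poly K}) (a : int).

(** Multiplication by z^a; for a < 0 the terms that would get a negative exponent are dropped, so
    nothing is lost on multiples of z^(-a). *)
Definition shiftp a p : {poly K} :=
  match a with Posz m => p * 'X^m | Negz m => drop_poly m.+1 p end.

Lemma coef_shiftp a p m :
  (shiftp a p)`_m = if 0 <= m%:Z - a then p`_(absz (m%:Z - a)%R) else 0.
Proof.
case: a => a /=.
  by rewrite coefMXn; case: (ltnP m a) => am; case: ifP => // ma;
    [lia | congr (p`_ _); lia | lia].
by rewrite coef_drop_poly.
Qed.

Lemma dvdXnP d p : reflect (forall m, (m < d)%N -> p`_m = 0) ('X^d %| p).
Proof.
apply: (iffP idP) => [/dvdpP[q ->] m md|p0]; first by rewrite coefMXn md.
rewrite -[p](poly_take_drop d) (_ : take_poly d p = 0) ?add0r ?dvdp_mulIr//.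
by apply/polyP => m; rewrite coef_take_poly coef0; case: ifP => // /p0.
Qed.

End Shift.

Section Sheaf.
Variables (R : realType) (n : nat).
Local Notation C := R[i].
Local Notation sect := (sect R n).
Implicit Types (r : nat) (D : nat -> nat) (s : sect) (j l : 'I_n).

Definition sheaf r D : set sect :=
  [set s | forall l, ((l < r)%N -> 'X^(D l) %| s l) /\ ((r <= l)%N -> s l = 0)]%classic.

Lemma sheafP r D s : sheaf r D s <->
  forall l m, ((l < r)%N ==> (m < D l)%N) -> (s l)`_m = 0.
Proof.
split=> [Ss l m|Ss l]; last split=> lr.
- case: (ltnP l r) => lr /=.
    by apply: dvdXnP; have [/(_ lr)] := Ss l.
  by move=> _; have [_ /(_ lr) ->] := Ss l; rewrite coef0.
- by apply/dvdXnP => m md; apply: Ss; rewrite md implybT.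
- by apply/polyP => m; rewrite coef0; apply: Ss; rewrite ltnNge lr.
Qed.

Lemma sheaf_lin r D (p : {poly C}) s s' :
  sheaf r D s -> sheaf r D s' -> sheaf r D (scale_sect p s + s').
Proof.
move=> Ss Ss' l; have [s1 s2] := Ss l; have [s1' s2'] := Ss' l; split=> lr.
  by apply: dvdp_add; [apply: dvdp_mull; apply: s1 | apply: s1'].
by change (p * s l + s' l = 0); rewrite s2// s2'// mulr0 addr0.
Qed.

Lemma scale_sectC (a : C) s : a *: s = scale_sect a%:P s.
Proof. by apply/funext => l; rewrite /scale_sect mul_polyC. Qed.

Lemma sheafZD r D (a : C) s s' :
  sheaf r D s -> sheaf r D s' -> sheaf r D (a *: s + s').
Proof. by rewrite scale_sectC; apply: sheaf_lin. Qed.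

Lemma sheaf0 r D : sheaf r D 0.
Proof. by move=> l; split=> // _; apply: dvdp0. Qed.

Lemma sheafD r D s s' : sheaf r D s -> sheaf r D s' -> sheaf r D (s + s').
Proof. by move=> Ss Ss'; rewrite -[s]scale1r; apply: sheafZD. Qed.

Lemma sheafN r D s : sheaf r D s -> sheaf r D (- s).
Proof. by move=> Ss; rewrite -scaleN1r -[_ *: _]addr0; apply: sheafZD => //; apply: sheaf0. Qed.

Lemma sheafB r D s s' : sheaf r D s -> sheaf r D s' -> sheaf r D (s - s').
Proof. by move=> Ss /sheafN; apply: sheafD. Qed.

(* The condition at infinity only concerns the components l >= r, where the
   quotient is torsion free: the degree drops by at least one. *)
Lemma hom_to_quotientP r D (phi : sect -> sect) :
  hom_to_quotient r (sheaf r D) phi <->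
  (forall p s s', sheaf r D s -> sheaf r D s' ->
     sheaf r D (phi (scale_sect p s + s') - (scale_sect p (phi s) + phi s'))) /\
  (forall a s, sheaf r D s -> (forall l, (size (s l) <= a.+1)%N) ->
     forall l, (r <= l)%N -> (size (phi s l) <= a)%N).
Proof.
split=> -[h1 h2]; split=> // a s Ss sa.
  move=> l rl; have [b [s' [Ss' /(_ l)[]]]] := h2 a s Ss sa.
  have [_ /(_ rl) ->] := Ss' l; rewrite subr0 /scale_sect => sz /(_ rl) c0.
  apply/leq_sizeP => m am; have := leq_trans am (leqnSn m).
  move: am; rewrite leq_eqVlt => /predU1P[<- _|am _].
    by move: c0; rewrite coefXnM ifN ?addnK// -leqNgt leq_addl.
  move/leq_sizeP: sz => /(_ (m + b)%N); rewrite coefXnM ifN ?addnK; first by apply; lia.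
  by rewrite -leqNgt leq_addl.
(* z^b lies in every ideal generated by z^(D l), so the components l < r of z^b phi(s) form a
   section of the sheaf and can be subtracted entirely. *)
pose b := (\sum_(l < n) D l)%N.
exists b, (fun l : 'I_n => if (l < r)%N then 'X^b * phi s l else 0); split.
  move=> l /=; split=> lr; last by rewrite ltnNge lr.
  rewrite lr; apply: dvdp_mulr; apply: dvdp_exp2l.
  by rewrite /b (bigD1 l)//= leq_addr.
move=> l; rewrite /= /scale_sect; case: (ltnP l r) => lr.
  by rewrite subrr size_poly0 coef0.
have sz := h2 a s Ss sa l lr; rewrite subr0; split.
  apply: leq_trans (size_polyMleq _ _) _; rewrite size_polyXn.
  by apply: leq_trans (leq_pred _) _; rewrite addSn ltnS addnC leq_add2r.
move=> _; rewrite coefXnM ifN ?addnK; last by rewrite -leqNgt leq_addl.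
exact: (leq_sizeP _ _ sz).
Qed.

Lemma hom_to_quotient0 r D : hom_to_quotient r (sheaf r D) (fun=> 0).
Proof.
apply/hom_to_quotientP; split=> [p s s' _ _|a s _ _ l _]; last by rewrite size_poly0.
have -> : scale_sect p (0 : sect) = 0 by apply/funext => l; apply: mulr0.
by rewrite addr0 subrr; apply: sheaf0.
Qed.

Lemma hom_to_quotientZD r D (a : C) phi phi' :
  hom_to_quotient r (sheaf r D) phi -> hom_to_quotient r (sheaf r D) phi' ->
  hom_to_quotient r (sheaf r D) (fun s => a *: phi s + phi' s).
Proof.
move=> /hom_to_quotientP[h1 h2] /hom_to_quotientP[h1' h2'].
apply/hom_to_quotientP; split=> [p s s' Ss Ss'|b s Ss sb l rl].
  have := sheafZD a (h1 p s s' Ss Ss') (h1' p s s' Ss Ss').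
  congr sheaf; apply/funext => l; change (
    a *: (phi (scale_sect p s + s') l - (p * phi s l + phi s' l)) +
    (phi' (scale_sect p s + s') l - (p * phi' s l + phi' s' l)) =
    a *: phi (scale_sect p s + s') l + phi' (scale_sect p s + s') l -
    (p * (a *: phi s l + phi' s l) + (a *: phi s' l + phi' s' l))).
  by rewrite -!mul_polyC; ring.
apply: leq_trans (size_polyD _ _) _; rewrite geq_max h2'// andbT.
by apply: leq_trans (size_scale_leq _ _) _; apply: h2.
Qed.

End Sheaf.

Section ShiftHom.
Variables (R : realType) (n : nat).
Local Notation C := R[i].
Local Notation sect := (sect R n).
Implicit Types (r : nat) (D : nat -> nat) (s : sect) (j l : 'I_n) (a : int).

Definition shift_hom a j l : sect -> sect :=
  fun s m => if m == l then shiftp a (s j) else 0.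

Lemma shiftpMD a d (p q q' : {poly C}) : 0 <= a + d%:Z ->
  'X^d %| q -> 'X^d %| q' ->
  shiftp a (p * q + q') = p * shiftp a q + shiftp a q'.
Proof.
case: a => m /= md dq dq'; first by rewrite mulrDl mulrA.
have dm : 'X^(m.+1) %| ('X^d : {poly C}) by apply: dvdp_exp2l; lia.
have /dvdpP[u ->] := dvdp_trans dm dq; have /dvdpP[u' ->] := dvdp_trans dm dq'.
by rewrite mulrA -mulrDl !drop_polyMXn_id.
Qed.

Lemma hom_shift r D a j l :
  ((j < r)%N -> 0 <= a + (D j)%:Z) -> ((r <= l)%N -> a < 0) ->
  hom_to_quotient r (sheaf r D) (shift_hom a j l).
Proof.
move=> ja la; apply/hom_to_quotientP; split=> [p s s' Ss Ss'|A s Ss sA l' rl'].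
  suff -> : shift_hom a j l (scale_sect p s + s') =
      scale_sect p (shift_hom a j l s) + shift_hom a j l s'.
    by rewrite subrr; apply: sheaf0.
  apply/funext => m; rewrite /shift_hom /scale_sect /=.
  change ((if m == l then shiftp a (p * s j + s' j) else 0) =
    p * (if m == l then shiftp a (s j) else 0) + (if m == l then shiftp a (s' j) else 0)).
  case: eqP => _; last by rewrite mulr0 addr0.
  have [s1 s2] := Ss j; have [s1' s2'] := Ss' j; case: (ltnP j r) => jr.
    by apply: (shiftpMD (d := D j)); [exact: ja|exact: s1|exact: s1'].
  rewrite s2// s2'// mulr0 addr0 (_ : shiftp a 0 = 0) ?mulr0 ?addr0//.
  by apply/polyP => e; rewrite coef_shiftp !coef0 if_same.
rewrite /shift_hom; case: eqP => [ll|_]; last by rewrite size_poly0.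
apply/leq_sizeP => m Am; rewrite coef_shiftp; case: ifP => // _.
have := la; rewrite -ll => /(_ rl') a0.
by apply: (leq_sizeP _ _ (sA j)); lia.
Qed.

Lemma coef_act_sect g s l m :
  (act_sect g s l)`_m = tpt g l ^+ 2 * vpt g ^- (2 * m) * (s l)`_m.
Proof.
rewrite /act_sect coefZ -mulrA; congr (_ * _); rewrite comp_polyE coef_sum.
under eq_bigr => i _ do rewrite exprZn scalerA coefZ coefXn.
rewrite exprM; case: (ltnP m (size (s l))) => ms.
  rewrite (bigD1 (Ordinal ms))//= eqxx mulr1 big1 ?addr0 => [|i]; last first.
    by rewrite -val_eqE /= eq_sym => /negPf ->; rewrite mulr0.
  by rewrite mulrC exprVn.
rewrite nth_default// mulr0 big1// => i _.
by case: eqP => [mi|]; rewrite ?mulr0//; have := ltn_ord i; rewrite -mi ltnNge ms.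
Qed.

Lemma act_sect_lin g (a : C) s s' :
  act_sect g (a *: s + s') = a *: act_sect g s + act_sect g s'.
Proof.
apply/funext => l; apply/polyP => m; rewrite coef_act_sect.
change (tpt g l ^+ 2 * vpt g ^- (2 * m) * (a *: s l + s' l)`_m =
  (a *: act_sect g s l + act_sect g s' l)`_m).
rewrite [RHS]coefD [X in _ = X + _]coefZ !coef_act_sect coefD coefZ; ring.
Qed.

Lemma act_sect0 g : act_sect g (0 : sect) = 0.
Proof. by apply/funext => l; apply/polyP => m; rewrite coef_act_sect !coef0 mulr0. Qed.

Lemma act_sect_sheaf g r D s : sheaf r D s -> sheaf r D (act_sect g s).
Proof.
by move=> /sheafP Ss; apply/sheafP => l m ml; rewrite coef_act_sect Ss ?mulr0.
Qed.

Definition hom_weight j l a : weight n :=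
  ([ffun m => 2 * (m == l)%:Z - 2 * (m == j)%:Z], - (2 * a)).

Lemma tpt_neq0 (g : torus R n) l : tpt g l != 0.
Proof.
by have := oner_neq0 C; rewrite -(tpt_prod g) (bigD1 l)//= mulf_eq0 => /norP[].
Qed.

Lemma prod_ffunB (K : fieldType) (t : 'I_n -> K) j l : (forall m, t m != 0) ->
  \prod_m t m ^ (2 * (m == l)%:Z - 2 * (m == j)%:Z) = t l ^+ 2 / t j ^+ 2.
Proof.
move=> t0; under eq_bigr => m _ do rewrite expfzDr// -invr_expz.
rewrite big_split/= prodfV; congr (_ / _).
  by rewrite (bigD1 l)//= eqxx big1 ?mulr1// => m /negPf ->.
by rewrite (bigD1 j)//= eqxx big1 ?mulr1// => m /negPf ->.
Qed.

Lemma weight_at_hom (g : torus R n) j l a :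
  weight_at g (hom_weight j l a) = tpt g l ^+ 2 / tpt g j ^+ 2 * vpt g ^ (- (2 * a)).
Proof.
rewrite /weight_at/=; congr (_ * _); rewrite -(prod_ffunB j l (tpt_neq0 g)).
by apply: eq_bigr => m _; rewrite ffunE.
Qed.

Lemma weightF_hom j l a :
  (2 <= n)%N ->
  weightF R (hom_weight j l a) =
    tF R n l.+1 ^+ 2 / tF R n j.+1 ^+ 2 * vF R n ^ (- (2 * a)).
Proof.
move=> hn; rewrite /weightF/=; congr (_ * _).
rewrite -(prod_ffunB j l (t := fun l => tF R n l.+1)); last first.
  by move=> m; apply: tF_neq0.
by apply: eq_bigr => m _; rewrite ffunE.
Qed.

Lemma act_shift_hom g a j l s :
  act_sect g (shift_hom a j l (act_sect (torus_inv g) s)) =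
  weight_at g (hom_weight j l a) *: shift_hom a j l s.
Proof.
apply/funext => l'; apply/polyP => m; rewrite coef_act_sect /shift_hom.
change (tpt g l' ^+ 2 * vpt g ^- (2 * m) *
  (if l' == l then shiftp a (act_sect (torus_inv g) s j) else 0)`_m =
  (weight_at g (hom_weight j l a) *: (if l' == l then shiftp a (s j) else 0))`_m).
rewrite coefZ; case: eqP => [->|_]; last by rewrite coef0 !mulr0.
rewrite !coef_shiftp; case: ifP => ma; last by rewrite !mulr0.
rewrite coef_act_sect/= weight_at_hom mulrA; congr (_ * _).
have v0 := vpt_neq0 g; have t0 := tpt_neq0 g j.
have -> : - (2 * a) = Posz (2 * absz (m%:Z + - a)%R)%N + - Posz (2 * m)%N by lia.
rewrite expfzDr// -exprnP -exprnN exprVn exprVn invrK.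
by rewrite mulrACA [X in _ = _ * X]mulrC.
Qed.

End ShiftHom.

Section DualBasis.
Variables (R : realType) (n : nat) (U : lmodType R[i]).
Variables (rho : torus R n -> U -> U) (A B : set U).
Hypothesis Alin : forall a x y, A x -> A y -> A (a *: x + y).
Variables (I : finType) (P : pred I) (w : I -> weight n).
Variables (e : I -> U) (c : I -> U -> R[i]).
Hypothesis Ae : forall i, P i -> A (e i).
Hypothesis we : forall g i, P i -> B (rho g (e i) - weight_at g (w i) *: e i).
Hypothesis c_lin : forall i a x y, c i (a *: x + y) = a * c i x + c i y.
Hypothesis c_dual : forall i i', P i -> P i' -> c i (e i') = (i == i')%:R.
Hypothesis cB : forall i u, P i -> B u -> c i u = 0.
Hypothesis c_inj : forall u, A u -> (forall i, P i -> c i u = 0) -> B u.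

(** Functionals dual to the family [e] that vanish on B, and whose common zeros in A lie in B,
    compute the coordinates modulo B; existence and uniqueness both follow by evaluating them. *)
Lemma has_weights_dual : has_weights rho A B [seq w i | i <- enum P].
Proof.
have c0 i : c i 0 = 0.
  by have := c_lin i (-1) 0 0; rewrite scaler0 addr0 mulN1r addNr.
have cD i x y : c i (x + y) = c i x + c i y.
  by have := c_lin i 1 x y; rewrite scale1r mul1r.
have c_sum i J (r : seq J) (f : J -> U) :
    c i (\sum_(j <- r) f j) = \sum_(j <- r) c i (f j).
  by apply: big_morph; [exact: cD | exact: c0].
have cZ i a x : c i (a *: x) = a * c i x.
  by rewrite -[_ *: x]addr0 c_lin c0 addr0.
pose s := [seq w i | i <- enum P].
pose f (k : 'I_(size s)) := tnth (in_tuple (enum P)) (cast_ord (size_map w (enum P)) k).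
have Pf k : P (f k) by have := mem_tnth (cast_ord (size_map w (enum P)) k) (in_tuple (enum P));
  rewrite mem_enum.
have f_inj k k' : (f k == f k') = (k == k').
  apply/eqP/eqP => [|->//]; rewrite /f.
  by move=> /(tuple_uniqP (in_tuple (enum P)) (enum_uniq P)) /cast_ord_inj.
have fP i : P i -> exists k, f k = i.
  move=> Pi; have : i \in in_tuple (enum P) by rewrite mem_enum.
  case/tnthP => k ->; exists (cast_ord (esym (size_map w (enum P))) k).
  by rewrite /f cast_ordKV.
have fw k : tnth (in_tuple s) k = w (f k).
  rewrite /f; have i0 := f k.
  rewrite (tnth_nth (w i0)) (tnth_nth i0) /= (nth_map i0)//.
  by rewrite -(size_map w) ltn_ord.
exists (fun k => e (f k)); split=> [k|g k|u Au]; first exact: Ae.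
  by rewrite fw; apply: we.
have A0 : A 0 by rewrite -(addNr u) -scaleN1r; apply: Alin.
exists [ffun k => c (f k) u]; split.
  apply: c_inj.
    rewrite addrC -scaleN1r; apply: Alin => //.
    elim/big_rec: _ => [|k x _ Ax]; first exact: A0.
    by apply: Alin => //; apply: Ae.
  move=> i /fP[k <-]; rewrite -scaleN1r cD cZ c_sum mulN1r.
  rewrite (bigD1 k)//= cZ ffunE c_dual// eqxx mulr1 big1 ?addr0 ?subrr// => k' /negPf kk'.
  by rewrite cZ c_dual// f_inj eq_sym kk' mulr0.
move=> d Bd; apply/ffunP => k; rewrite ffunE.
have := cB (Pf k) Bd; rewrite -scaleN1r cD cZ c_sum mulN1r.
rewrite (bigD1 k)//= cZ c_dual// eqxx mulr1 big1 ?addr0 => [/eqP|k' /negPf kk'].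
  by rewrite subr_eq0 => /eqP.
by rewrite cZ c_dual// f_inj eq_sym kk' mulr0.
Qed.

End DualBasis.

Section Live.
Variable n : nat.
Implicit Types (j l : 'I_n) (a : int).

Definition hom_row := (nat * (nat -> nat))%type.

(* z^(d_j) w_j |-> z^(d_j + a) w_l is a nonzero weight vector of
   Hom (O_X, (W (x) O) / O_Y), where a row X = (r, d) stands for the sheaf
   O_X = (+)_(j < r) O(- d_j . 0) w_j; the maps to the torsion free part of the
   quotient vanish at infinity, i.e. lower the degree. *)
Definition live (X Y : hom_row) j l a : bool :=
  [&& (j < X.1)%N, 0 <= a + (X.2 j)%:Z &
    if (l < Y.1)%N then a + (X.2 j)%:Z < (Y.2 l)%:Z else a < 0].

End Live.

(** * Tangent spaces of chains of sheaves *)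

Section Chain.
Variables (R : realType) (n N : nat) (r : nat -> nat) (D : nat -> nat -> nat).
Local Notation C := R[i].
Local Notation sect := (sect R n).
Local Notation homs := (homs R n).
Implicit Types (s : sect) (j l : 'I_n) (a : int) (phi : homs).

Definition rows k : hom_row := (r k, D k).

Hypotheses (r0 : r 0 = 0%N) (rN : r N = n) (DN : forall l, D N l = 0%N).
Hypothesis rS : forall k, (r k <= r k.+1)%N.
Hypothesis DS : forall k l, (k < N)%N -> (l < r k)%N -> (D k.+1 l <= D k l)%N.

Local Notation V k := (sheaf (r k) (D k)).

Definition chain_tangent : set homs :=
  [set phi | (forall k, (0 < k < N)%N -> hom_to_quotient (r k) (V k) (phi k)) /\
    (forall k, (0 < k)%N -> (k.+1 < N)%N ->
       forall s, V k s -> V k.+1 (phi k.+1 s - phi k s))]%classic.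

Definition chain_null : set homs :=
  [set phi | forall k, (0 < k < N)%N -> forall s, V k s -> V k (phi k s)]%classic.

Local Notation alive k := (live (rows k) (rows k)).
Local Notation edge k := (live (rows k) (rows k.+1)).

(** Positions whose coefficient is not forced by a compatibility condition. An edge at k relates the
    coefficients at k and k+1; it makes k+1 alive if 0 <= a, and k alive if a < 0. Hence values are
    transported to the right in the first case and to the left in the second, and a position is free
    when no edge leads into it. *)
Definition free_pos k j l a : bool :=
  alive k j l a && (if 0 <= a then ~~ edge k.-1 j l a else ~~ edge k j l a).

Definition gen k j : sect := fun l => if l == j then 'X^(D k j) else 0.

Definition gen_coef k j l a phi : C := (phi k (gen k j) l)`_(absz (a + (D k j)%:Z)).

Lemma r_mono k k' : (k <= k')%N -> (r k <= r k')%N.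
Proof.
move=> kk'; rewrite -(subnKC kk'); elim: (k' - k)%N => [|m IH]; first by rewrite addn0.
by rewrite addnS; apply: leq_trans IH (rS _).
Qed.

Lemma D_mono k k' l : (k <= k')%N -> (k' <= N)%N -> (l < r k)%N -> (D k' l <= D k l)%N.
Proof.
move=> kk' k'N lr; elim: k' kk' k'N => [|k' IH]; first by rewrite leqn0 => /eqP ->.
rewrite leq_eqVlt => /predU1P[->//|kk'] k'N.
apply: leq_trans (DS k'N _) (IH _ _) => //; last exact: ltnW.
exact: leq_trans lr (r_mono _).
Qed.

Lemma gen_sheaf k j : (j < r k)%N -> V k (gen k j).
Proof.
move=> jr l; rewrite /gen; case: eqP => [->|_]; last by split=> // _; apply: dvdp0.
by split=> //; rewrite leqNgt jr.
Qed.

Lemma edge0 j l a : edge 0 j l a = false.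
Proof. by rewrite /live /= r0. Qed.

Lemma edgeN k j l a : k.+1 = N -> edge k j l a = false.
Proof.
by move=> kN; rewrite /live /= kN rN DN ltn_ord; apply/negP => /and3P[_]; lia.
Qed.

Lemma alive_lt k j l a : (k <= N)%N -> alive k j l a -> (0 < k < N)%N.
Proof.
case: k => [|k] kN; rewrite /live /=; first by rewrite r0.
move=> /and3P[jr ja la]; rewrite ltn_neqAle kN andbT; apply/eqP => kE.
by move: ja la; rewrite kE rN !DN ltn_ord; lia.
Qed.

Lemma edge_aliveS k j l a : (k < N)%N -> edge k j l a -> 0 <= a + (D k.+1 j)%:Z ->
  alive k.+1 j l a.
Proof.
move=> kN /and3P[/= jr ja la] ja'; rewrite /live /= ja' (leq_trans jr (rS k)) /=.
by have := DS kN jr; move: la; case: ifP; lia.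
Qed.

Lemma edge_alive k j l a : (k < N)%N -> a < 0 -> edge k j l a -> alive k j l a.
Proof.
move=> kN a0 /and3P[/= jr ja la]; rewrite /live /= jr ja/=.
case: (ltnP l (r k)) => // lr; move: la; rewrite (leq_trans lr (rS k)).
by have := DS kN lr; lia.
Qed.

Lemma chain_tangentZD c phi psi :
  chain_tangent phi -> chain_tangent psi -> chain_tangent (c *: phi + psi).
Proof.
move=> [h1 h2] [h1' h2']; split=> k.
  by move=> kN; apply: hom_to_quotientZD; [apply: h1 | apply: h1'].
move=> k0 kN s Vs; have := sheafZD c (h2 k k0 kN s Vs) (h2' k k0 kN s Vs).
rewrite scalerBr addrACA -opprD; exact.
Qed.

Lemma chain_nullZD c phi psi :
  chain_null phi -> chain_null psi -> chain_null (c *: phi + psi).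
Proof.
by move=> h h' k kN s Vs; apply: sheafZD; [apply: h | apply: h'].
Qed.

Lemma gen_coef_lin k j l a c phi psi :
  gen_coef k j l a (c *: phi + psi) = c * gen_coef k j l a phi + gen_coef k j l a psi.
Proof.
rewrite /gen_coef.
change ((c *: phi k (gen k j) l + psi k (gen k j) l)`_(absz (a + D k j)) =
  c * (phi k (gen k j) l)`_(absz (a + D k j)) + (psi k (gen k j) l)`_(absz (a + D k j))).
by rewrite coefD coefZ.
Qed.

Lemma gen_coef_null k j l a phi : (k <= N)%N -> chain_null phi -> alive k j l a ->
  gen_coef k j l a phi = 0.
Proof.
move=> kN phi0 ka; have /and3P[/= jr ja la] := ka.
have /sheafP := phi0 k (alive_lt kN ka) _ (gen_sheaf jr); apply.
by apply/implyP => lr; move: la; rewrite lr; lia.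
Qed.

(** The generator of W_k is a power of z times that of W_(k+1), so the compatibility condition
    compares one and the same coefficient; the value is 0 when it would come from a negative power
    of z. *)
Lemma gen_coef_step k j l a phi : chain_tangent phi -> (0 < k)%N -> (k.+1 < N)%N ->
  edge k j l a -> gen_coef k j l a phi =
    if 0 <= a + (D k.+1 j)%:Z then gen_coef k.+1 j l a phi else 0.
Proof.
move=> [h1 h2] k0 kN /and3P[/= jr ja la].
have jr' := leq_trans jr (rS k).
have /sheafP := h2 k k0 kN _ (gen_sheaf jr).
have /hom_to_quotientP[h _] : hom_to_quotient (r k.+1) (V k.+1) (phi k.+1).
  by apply: h1; rewrite kN.
have Dk : (D k.+1 j <= D k j)%N by apply: DS => //; apply: ltnW.
(* Linearity only holds modulo the sheaf, so the image of 0 is merely known to lie in it. *)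
have h0 : V k.+1 (phi k.+1 0).
  have := h 1 0 0 (@sheaf0 R n _ _) (@sheaf0 R n _ _).
  have -> : scale_sect 1 (0 : sect) + 0 = 0.
    by apply/funext => x; change (1 * (0 : {poly C}) + 0 = 0); rewrite mulr0 addr0.
  have -> : scale_sect 1 (phi k.+1 0) = phi k.+1 0.
    by apply/funext => x; apply: mul1r.
  by rewrite opprD addrA subrr sub0r => /sheafN; rewrite opprK.
have := sheafD (h 'X^(D k j - D k.+1 j) _ 0 (gen_sheaf jr') (@sheaf0 R n _ _)) h0.
have -> : scale_sect 'X^(D k j - D k.+1 j) (gen k.+1 j) + 0 = gen k j.
  apply/funext => x; rewrite addr0 /scale_sect /gen; case: eqP => _; last by rewrite mulr0.
  by rewrite -exprD subnK.
rewrite opprD addrA subrK => /sheafP e1 e2.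
pose m := absz (a + (D k j)%:Z).
have lm : (l < r k.+1)%N ==> (m < D k.+1 l)%N.
  by apply/implyP => lr; move: la; rewrite lr /m; lia.
have /eqP := e1 l _ lm; have /eqP := e2 l _ lm.
rewrite !coefB !subr_eq0 => /eqP e3; rewrite e3 => /eqP {}e3.
rewrite /gen_coef -/m e3 /scale_sect coefXnM.
have mE : m%:Z = a + (D k j)%:Z by rewrite /m; lia.
case: (ltnP m (D k j - D k.+1 j)) => md; case: ifP => ma //.
- by exfalso; move: ma md mE Dk; clear; lia.
- by congr (_`_ _); lia.
- by exfalso; move: ma md mE Dk; clear; lia.
Qed.

(** Vanishing propagates from the free positions along edges, by induction on k if 0 <= a and on N -
    k if a < 0. *)
Lemma gen_coef_alive phi : chain_tangent phi ->
  (forall k j l a, (k < N)%N -> free_pos k j l a -> gen_coef k j l a phi = 0) ->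
  forall k j l a, (k <= N)%N -> alive k j l a -> gen_coef k j l a phi = 0.
Proof.
move=> phiT free0 k j l a; case: (lerP 0 a) => a0.
  elim: k => [|k IH] kN ka; first by move: (alive_lt kN ka).
  have /andP[_ kN'] := alive_lt kN ka.
  case ke : (edge k j l a); last by apply: free0 => //; rewrite /free_pos ka a0 /= ke.
  case: (posnP k) => [k0|k0]; first by rewrite k0 edge0 in ke.
  have := gen_coef_step phiT k0 kN' ke; rewrite addr_ge0// => <-.
  have /and3P[/= jr ja la] := ke.
  case: (ltnP l (r k)) => lr.
    apply: IH; first exact: ltnW.
    rewrite /live /= jr ja lr /=; move: la; rewrite (leq_trans lr (rS k)).
    by have := DS kN lr; lia.
  (* Here position k is not alive although there is an edge: the component l is torsion free, and a
     coefficient of degree at least [D k j] is excluded by the vanishing at infinity. *)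
  have [h1 _] := phiT; have /hom_to_quotientP[_ h] := h1 k (introT andP (conj k0 (ltnW kN'))).
  have gs x : (size (gen k j x) <= (D k j).+1)%N.
    by rewrite /gen; case: eqP => _; rewrite ?size_polyXn ?size_poly0.
  have := h (D k j) _ (gen_sheaf jr) gs l lr.
  by move/leq_sizeP; apply; lia.
move Em : (N - k)%N => m; elim: m k Em => [|m IH] k Em kN ka.
  by have /andP[_] := alive_lt kN ka; lia.
have /andP[k0 kN'] := alive_lt kN ka.
case ke : (edge k j l a); last by apply: free0 => //; rewrite /free_pos ka leNgt a0 /= ke.
case: (ltnP k.+1 N) => kN2; last by rewrite edgeN in ke; lia.
rewrite (gen_coef_step phiT k0 kN2 ke); case: ifP => // ja'.
by apply: IH; [lia|lia|apply: edge_aliveS].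
Qed.

(** It suffices to look at generators. A coefficient of their image that is not alive either lies in
    the sheaf already or is excluded by the vanishing at infinity. *)
Lemma chain_null_alive phi : chain_tangent phi ->
  (forall k j l a, (k <= N)%N -> alive k j l a -> gen_coef k j l a phi = 0) ->
  chain_null phi.
Proof.
move=> [h1 _] al0 k k0N s Vs.
have kN : (k <= N)%N by lia.
have /hom_to_quotientP[hl hs] := h1 k k0N.
have gen0 j : (j < r k)%N -> V k (phi k (gen k j)).
  move=> jr; apply/sheafP => l m lm.
  pose a := m%:Z - (D k j)%:Z.
  have mE : m = absz (a + (D k j)%:Z) by rewrite /a; lia.
  case al : (alive k j l a); first by have := al0 _ _ _ _ kN al; rewrite /gen_coef -mE.
  case: (ltnP l (r k)) => lr; first by move: al lm; rewrite /live /= jr lr /a /=; lia.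
  have gs x : (size (gen k j x) <= (D k j).+1)%N.
    by rewrite /gen; case: eqP => _; rewrite ?size_polyXn ?size_poly0.
  have := hs (D k j) _ (gen_sheaf jr) gs l lr => /leq_sizeP; apply.
  by move: al; rewrite /live /= jr ltnNge lr /a /=; lia.
have phi0 : V k (phi k 0).
  have := hl 1 0 0 (@sheaf0 R n _ _) (@sheaf0 R n _ _).
  have -> : scale_sect 1 (0 : sect) + 0 = 0.
    by apply/funext => x; change (1 * (0 : {poly C}) + 0 = 0); rewrite mulr0 addr0.
  have -> : scale_sect 1 (phi k 0) = phi k 0 by apply/funext => x; apply: mul1r.
  by rewrite opprD addrA subrr sub0r => /sheafN; rewrite opprK.
pose q (j : 'I_n) : {poly C} := if (j < r k)%N then s j %/ 'X^(D k j) else 0.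
have -> : s = \sum_j scale_sect (q j) (if (j < r k)%N then gen k j else 0).
  apply/funext => x; rewrite fct_sumE (bigD1 x)//= big1 => [|j jx].
    rewrite addr0 /scale_sect /q /gen; have [sx1 sx2] := Vs x.
    case: (ltnP x (r k)) => xr; last by rewrite sx2// mul0r.
    by rewrite eqxx divpK// sx1.
  rewrite /scale_sect /gen; case: ifP => _; last by rewrite mulr0.
  by rewrite eq_sym (negPf jx) mulr0.
suff [] : V k (\sum_j scale_sect (q j) (if (j < r k)%N then gen k j else 0)) /\
   V k (phi k (\sum_j scale_sect (q j) (if (j < r k)%N then gen k j else 0))) by [].
elim/big_rec: _ => [|j x _ [Vx Vpx]]; first by split=> //; apply: sheaf0.
set g := (if _ then _ else _).
have Vg : V k g by rewrite /g; case: ifP => [|_]; [apply: gen_sheaf|apply: sheaf0].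
have Vpg : V k (phi k g) by rewrite /g; case: ifP => [|_ //]; apply: gen0.
split; first exact: sheaf_lin.
have := sheafD (hl (q j) _ _ Vg Vx) (sheaf_lin (q j) Vpg Vpx).
by rewrite subrK.
Qed.

(** A free position is the left end of its run of edges if 0 <= a and the right end if a < 0, so
    runs are followed in one direction only. *)
Definition conn k0 k j l a : bool :=
  if 0 <= a then (k0 <= k)%N && all (fun m => edge m j l a) (index_iota k0 k)
  else (k <= k0)%N && all (fun m => edge m j l a) (index_iota k k0).

(* The weight vector supported on the maximal run of edges through position
   k0; restriction along an edge identifies the two coefficients. *)
Definition run_vec k0 j l a : homs :=
  fun k s => if conn k0 k j l a then shift_hom a j l s else 0.

Lemma conn_pos k0 k j l a : (k0 <= N)%N -> alive k0 j l a -> conn k0 k j l a ->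
  (j < r k)%N -> 0 <= a + (D k j)%:Z.
Proof.
move=> k0N /and3P[/= jr ja la]; rewrite /conn; case: lerP => [a0 _ _|a0 /andP[kk0 _] jrk].
  by apply: addr_ge0.
by have := D_mono kk0 k0N jrk; lia.
Qed.

Lemma conn_neg k0 k j l a : alive k0 j l a -> conn k0 k j l a ->
  (r k <= l)%N -> a < 0.
Proof.
move=> /and3P[/= jr ja la]; rewrite /conn; case: lerP => [a0 /andP[kk0 _] rl|//].
by move: la; rewrite ltnNge (leq_trans (r_mono kk0) rl)/=; lia.
Qed.

Lemma conn_edge k0 k j l a : (0 < k)%N -> free_pos k0 j l a -> edge k j l a ->
  conn k0 k.+1 j l a = conn k0 k j l a.
Proof.
move=> kp /andP[al0]; rewrite /conn; case: lerP => a0 fr ke.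
  case: (ltngtP k0 k.+1) => kk0.
  - by rewrite -ltnS kk0/= /index_iota subSn// -addn1 iotaD all_cat/= subnKC// ke !andbT.
  - by rewrite leqNgt ltnW.
  - by move: fr; rewrite kk0/= ke.
case: (ltngtP k k0) => kk0 //=.
  by rewrite /index_iota -[(k0 - k)%N]prednK ?subn_gt0//= ke -subnS.
by move: fr; rewrite -kk0 ke.
Qed.

Lemma run_vec_tangent k0 j l a : (k0 <= N)%N -> free_pos k0 j l a ->
  chain_tangent (run_vec k0 j l a).
Proof.
move=> k0N fr; have /andP[al0 _] := fr.
have cp k := conn_pos (k := k) k0N al0; have cn k := conn_neg (k := k) al0.
split=> [k kN|k kp kN s Vs].
  rewrite /run_vec; case ck : (conn k0 k j l a); last exact: hom_to_quotient0.
  by apply: hom_shift; [apply: cp ck|apply: cn ck].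
rewrite /run_vec; case ke : (edge k j l a).
  by rewrite conn_edge// subrr; apply: sheaf0.
(* Where there is no edge, multiplication by z^a already maps W_k into W_(k+1), and the condition is
   empty whether or not the run contains k or k+1. *)
suff Vsh : conn k0 k j l a || conn k0 k.+1 j l a -> V k.+1 (shift_hom a j l s).
  apply: sheafB; case: ifP => [cc|_]; try exact: sheaf0; apply: Vsh; by rewrite cc ?orbT.
move=> cc; apply/sheafP => l' m lm; rewrite /shift_hom.
case: eqP => [ll|_]; last by rewrite coef0.
rewrite {l'}ll in lm; rewrite coef_shiftp; case: ifP => // ma.
move/sheafP: Vs; apply; apply/implyP => jr.
have Dk : (D k.+1 j <= D k j)%N by apply: DS => //; apply: ltnW.
have ja : 0 <= a + (D k j)%:Z.
  case/orP: cc => [ck|ck]; first exact: cp ck jr.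
  by have := cp _ ck (leq_trans jr (rS k)); lia.
have la : (r k.+1 <= l)%N -> a < 0.
  by move=> rl; case/orP: cc => [ck|ck]; apply: cn ck _; rewrite // (leq_trans (rS k)).
move: ke lm; rewrite /live /= jr ja/=; case: (ltnP l (r k.+1)) => /= lr; first by lia.
by rewrite la.
Qed.

Lemma conn_free k0 k j l a :
  free_pos k0 j l a -> free_pos k j l a -> conn k0 k j l a -> k = k0.
Proof.
move=> /andP[_ f0] /andP[_ f]; move: f0 f; rewrite /conn.
case: lerP => a0 f0 f /andP[kk /allP h]; apply/eqP; apply: contraT => neq.
  have := h k.-1; rewrite mem_index_iota (negPf f).
  have -> : (k0 <= k.-1 < k)%N by lia.
  by move/(_ isT).
have := h k; rewrite mem_index_iota (negPf f).
have -> : (k <= k < k0)%N by lia.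
by move/(_ isT).
Qed.

Lemma gen_coef_run k0 j l a k j' l' a' :
  free_pos k0 j l a -> free_pos k j' l' a' ->
  gen_coef k j' l' a' (run_vec k0 j l a) = ((k, j', l', a') == (k0, j, l, a))%:R.
Proof.
move=> f0 f; have /andP[/and3P[/= _ ja' _] _] := f.
rewrite /gen_coef /run_vec; case: eqP => [[-> -> -> ->]|neq].
  have /andP[/and3P[/= _ ja _] _] := f0.
  have -> : conn k0 k0 j l a by rewrite /conn leqnn /index_iota subnn if_same.
  rewrite /shift_hom /gen !eqxx coef_shiftp coefXn.
  by case: ifP => [_|]; [case: eqP => //|]; lia.
case: ifP => [ck|_]; last by rewrite coef0.
rewrite /shift_hom /gen; case: eqP => [ll|_]; last by rewrite coef0.
case: eqP => [jj|_]; last by rewrite coef_shiftp !coef0 if_same.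
rewrite coef_shiftp coefXn; case: ifP => // ma; case: eqP => // e.
have aa : a' = a by lia.
by move: f neq; rewrite aa ll -jj => f; case; rewrite (conn_free f0 f ck).
Qed.

Variable B : nat.
Hypothesis DB : forall k l, (D k l <= B)%N.

(** With all degrees at most B, the exponents a of nonzero weight vectors satisfy -B <= a < B; this
    makes the set of positions finite. *)
Definition level (q : 'I_(B + B)) : int := (q : nat)%:Z - B%:Z.

Lemma level_inj : injective level.
Proof. by move=> q q'; rewrite /level => e; apply: ord_inj; lia. Qed.

Lemma live_level X Y j l a : live X Y j l a -> (X.2 j <= B)%N -> (Y.2 l <= B)%N ->
  exists q, level q = a.
Proof.
move=> /and3P[_ ja la] XB YB.
have aB : (absz (a + B%:Z)%R < B + B)%N by move: la; case: ifP; lia.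
by exists (Ordinal aB); rewrite /level/=; lia.
Qed.

Definition position := ('I_N.+1 * 'I_n * 'I_n * 'I_(B + B))%type.

Definition free_index : pred position :=
  fun i => let: (k, j, l, q) := i in free_pos k j l (level q).

Definition chain_weights : seq (weight n) :=
  [seq hom_weight i.1.1.2 i.1.2 (level i.2) | i <- enum free_index].

Lemma act_homs_lin g c phi psi :
  act_homs g (c *: phi + psi) = c *: act_homs g phi + act_homs g psi.
Proof. by apply/funext => k; apply/funext => s; apply: act_sect_lin. Qed.

Lemma act_homs_null g phi : chain_null phi -> chain_null (act_homs g phi).
Proof.
by move=> h k kN s Vs; apply: act_sect_sheaf; apply: h => //; apply: act_sect_sheaf.
Qed.

(** The run vectors starting at free positions are dual to the coefficients at these positions. *)
Lemma chain_has_weights :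
  has_weights (@act_homs R n) chain_tangent chain_null chain_weights.
Proof.
pose e (i : position) := run_vec i.1.1.1 i.1.1.2 i.1.2 (level i.2).
pose c (i : position) := gen_coef i.1.1.1 i.1.1.2 i.1.2 (level i.2).
have ltN (k : 'I_N.+1) : (k <= N)%N by rewrite -ltnS.
apply: (@has_weights_dual _ _ _ _ _ _ _ _ free_index _ e c).
- exact: chain_tangentZD.
- by move=> [[[k j] l] q] fi; apply: run_vec_tangent.
- move=> g [[[k j] l] q] fi; set phi := (X in chain_null X).
  suff -> : phi = 0 by move=> m _ s _; apply: sheaf0.
  apply/funext => m; apply/funext => s; apply/eqP; rewrite subr_eq0; apply/eqP.
  change (act_sect g (if conn k m j l (level q) then
      shift_hom (level q) j l (act_sect (torus_inv g) s) else 0) =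
    weight_at g (hom_weight j l (level q)) *:
      (if conn k m j l (level q) then shift_hom (level q) j l s else 0)).
  by case: ifP => _; rewrite ?act_shift_hom// scaler0 act_sect0.
- by move=> [[[k j] l] q] a x y; apply: gen_coef_lin.
- move=> [[[k j] l] q] [[[k' j'] l'] q'] fi fi'; rewrite /c /e gen_coef_run//=;
  congr (nat_of_bool _)%:R.
  apply/eqP/eqP => [[kk -> -> /level_inj ->]|[-> -> -> ->]//].
  by congr (_, _, _, _); apply: val_inj.
- by move=> [[[k j] l] q] u /andP[al _] Bu; apply: gen_coef_null.
- move=> u Au cu; apply: chain_null_alive => //; apply: gen_coef_alive => //.
  move=> k j l a kN fr; have /andP[al _] := fr.
  have [q qa] := live_level al (DB _ _) (DB _ _).
  have kN' : (k < N.+1)%N by apply: leq_trans kN _.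
  have := cu (Ordinal kN', j, l, q); rewrite /c /= qa; exact.
Qed.

Section Product.
Variables (K : comPzRingType) (g : 'I_n -> 'I_n -> int -> K).

Definition hom_prod (X Y : hom_row) : K :=
  \prod_(j < n) \prod_(l < n) \prod_(q < B + B | live X Y j l (level q)) g j l (level q).

(** For a fixed weight, each alive position is either free or the end of exactly one edge: the right
    end if 0 <= a, the left end if a < 0. *)
Lemma free_edge_alive j l a (x : K) :
  \prod_(k < N.+1) (if free_pos k j l a then x else 1) *
  \prod_(k < N) (if edge k j l a then x else 1) =
  \prod_(k < N.+1) (if alive k j l a then x else 1).
Proof.
case: (lerP 0 a) => a0.
  rewrite !big_ord_recl /free_pos /= a0 edge0 andbT -mulrA -big_split/=.
  congr (_ * _); apply: eq_bigr => k _; rewrite /bump/= !add1n.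
  case ke : (edge k j l a); last by rewrite andbT mulr1.
  by rewrite andbF mul1r (edge_aliveS _ ke)// addr_ge0.
rewrite !big_ord_recr /free_pos /= leNgt a0/=.
case al : (alive N j l a); first by have := alive_lt (leqnn N) al; rewrite ltnn andbF.
rewrite /= !mulr1 -big_split/=; apply: eq_bigr => k _.
case ke : (edge k j l a); last by rewrite andbT mulr1.
by rewrite andbF mul1r (edge_alive _ a0 ke).
Qed.

(** Multiplicative form of the Euler characteristic count for T -> (+)_k Hom(V_k, (W (x) O) / V_k)
    -> (+)_k Hom(V_k, (W (x) O) / V_(k+1)), checked one weight at a time. The last term is kept on
    the left to avoid division. *)
Lemma chain_prod :
  \prod_(i | free_index i) g i.1.1.2 i.1.2 (level i.2) *
  \prod_(k < N) hom_prod (rows k) (rows k.+1) =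
  \prod_(k < N.+1) hom_prod (rows k) (rows k).
Proof.
have prodE m (p : nat -> 'I_n -> 'I_n -> int -> bool) :
  \prod_(k < m) \prod_(j < n) \prod_(l < n) \prod_(q < B + B | p k j l (level q)) g j l (level q)
  = \prod_(j < n) \prod_(l < n) \prod_(q < B + B)
      \prod_(k < m) (if p k j l (level q) then g j l (level q) else 1).
  rewrite exchange_big; apply: eq_bigr => j _; rewrite exchange_big/=.
  apply: eq_bigr => l _; rewrite [RHS]exchange_big/=; apply: eq_bigr => k _.
  by rewrite big_mkcond.
rewrite [X in _ * X](prodE N (fun k => live (rows k) (rows k.+1))).
rewrite [RHS](prodE N.+1 (fun k => live (rows k) (rows k))).
have -> : \prod_(i | free_index i) g i.1.1.2 i.1.2 (level i.2) =
  \prod_(k < N.+1) \prod_(j < n) \prod_(l < n)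
     \prod_(q < B + B | free_pos k j l (level q)) g j l (level q).
  rewrite pair_bigA pair_bigA big_mkcond/=.
  rewrite (eq_bigr (fun i : 'I_N.+1 * 'I_n * 'I_n => \prod_(q < B + B)
    if free_pos i.1.1 i.1.2 i.2 (level q) then g i.1.2 i.2 (level q) else 1)); last first.
    by move=> i _; rewrite big_mkcond.
  by rewrite pair_bigA; apply: eq_bigr => -[[[k j] l] q].
rewrite (prodE N.+1 free_pos) -big_split; apply: eq_bigr => j _.
rewrite -big_split; apply: eq_bigr => l _; rewrite -big_split; apply: eq_bigr => q _.
exact: free_edge_alive.
Qed.

End Product.
End Chain.

Section Transfer.
Variables (R : realType) (n : nat) (U U' : lmodType R[i]).
Variables (rho : torus R n -> U -> U) (A B : set U).
Variables (rho' : torus R n -> U' -> U') (A' B' : set U').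
Variables (P : U -> U') (Q : U' -> U).
Hypothesis Alin : forall a x y, A' x -> A' y -> A' (a *: x + y).
Hypothesis PZD : forall a x y, P (a *: x + y) = a *: P x + P y.
Hypothesis QZD : forall a x y, Q (a *: x + y) = a *: Q x + Q y.
Hypothesis PK : cancel P Q.
Hypothesis PA : forall u, A u -> A' (P u).
Hypothesis QA : forall u, A' u -> A (Q u).
Hypothesis PB : forall u, B u -> B' (P u).
Hypothesis BQ : forall u, A' u -> B' u <-> B (Q u).
Hypothesis Prho : forall g u, P (rho g u) = rho' g (P u).

(** [P] need not be surjective: [Q] is only a one-sided inverse, but it detects B' on A'. This is
    the situation of [split_homs] and [merge], which are mutually inverse only modulo null
    families. *)
Lemma has_weights_transfer s : has_weights rho A B s -> has_weights rho' A' B' s.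
Proof.
move=> [e [Ae we ex]]; exists (P \o e); split=> [k|g k|u A'u].
- exact/PA/Ae.
- rewrite /= -Prho addrC -scaleNr -PZD scaleNr addrC; exact/PB/we.
have Q0 : Q 0 = 0 by have := QZD (-1) 0 0; rewrite scaler0 addr0 scaleN1r addNr.
have A0 : A' 0 by rewrite -(addNr u) -scaleN1r; apply: Alin.
have A'S (c : {ffun 'I_(size s) -> R[i]}) : A' (\sum_k c k *: (P \o e) k).
  by elim/big_rec: _ => [|k x _ Ax]; [exact: A0|apply: Alin => //; apply/PA/Ae].
have QS (c : {ffun 'I_(size s) -> R[i]}) :
    Q (u - \sum_k c k *: (P \o e) k) = Q u - \sum_k c k *: e k.
  rewrite addrC -scaleN1r QZD scaleN1r addrC; congr (_ - _).
  elim/big_rec2: _ => [//|k x y _ <-].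
  by rewrite QZD /= PK.
have A'B (c : {ffun 'I_(size s) -> R[i]}) : A' (u - \sum_k c k *: (P \o e) k).
  by rewrite addrC -scaleN1r; apply: Alin.
have [c [Bc uc]] := ex _ (QA A'u); exists c; split.
  by apply/BQ => //; rewrite QS.
by move=> d /BQ; rewrite QS => h; apply: uc; apply: h.
Qed.

End Transfer.

(** * Fixed points of the correspondences *)

Section Entries.
Variables (R : realType) (n : nat).
Implicit Types (x y : fixpt n) (k l : nat).

Lemma entry_ge_n x k l : (n <= k)%N -> entry x k l = 0%N.
Proof. by move=> nk; rewrite /entry insubF // ltnNge nk. Qed.

Lemma entryE x (k l : 'I_n) : entry x k l = val x (k, l).
Proof. by rewrite /entry !valK. Qed.

Lemma entry_out x k l : ~~ (0 < l <= k)%N -> entry x k l = 0%N.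
Proof.
move=> kl; rewrite /entry; case: insubP => // k' _ k'E; case: insubP => // l' _ l'E.
have /andP[/forallP/(_ k')/forallP/(_ l')] := valP x.
by move: k'E l'E => /= -> ->; rewrite kl => /eqP.
Qed.

Lemma entry_mono x k l : (0 < l <= k)%N -> (entry x k.+1 l <= entry x k l)%N.
Proof.
move=> /andP[l0 lk]; case: (ltnP k.+1 n) => kn; last by rewrite entry_ge_n.
have kn' := ltnW kn; have ln : (l < n)%N := leq_ltn_trans lk kn'.
have /andP[_ /forallP/(_ (Ordinal kn))/forallP/(_ (Ordinal kn'))/forallP/(_ (Ordinal ln))] :=
  valP x.
rewrite /= l0 lk leqnSn /=.
by have := entryE x (Ordinal kn) (Ordinal ln);
  have := entryE x (Ordinal kn') (Ordinal ln) => /= -> ->.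
Qed.

Definition entry_bound x : nat := \sum_p val x p.

Lemma entry_le_bound x k l : (entry x k l <= entry_bound x)%N.
Proof.
rewrite /entry; case: insubP => // k' _ _; case: insubP => // l' _ _.
by rewrite /entry_bound (bigD1 (k', l'))//= leq_addr.
Qed.

Lemma entry_inj x y : (forall k l, entry x k l = entry y k l) -> x = y.
Proof.
by move=> xy; apply/val_inj/ffunP => -[k l]; rewrite -!entryE xy.
Qed.

Definition raises i j x y : Prop := [/\ (0 < i < n)%N, (0 < j <= i)%N &
  forall k l, entry y k l = (entry x k l + ((k == i) && (l == j)))%N].

Lemma degree_raises i j x y k : raises i j x y -> degree y k = (degree x k + (k == i))%N.
Proof.
move=> [_ /andP[j0 ji] yx]; rewrite /degree (eq_bigr _ (fun l _ => yx k l)) big_split/=.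
congr (_ + _)%N; case: eqP => [->|_]; last by rewrite big1.
rewrite (bigD1_seq j) ?iota_uniq ?mem_index_iota ?j0//= eqxx big1 ?addn0//.
by move=> l /negPf ->.
Qed.

Lemma flag_sheaf x k : flag R x k = sheaf k (fun l => entry x k l.+1) :> set (sect R n).
Proof. by []. Qed.

Lemma flag_monomial x k l (ln : (l < n)%N) m : (l < k)%N ->
  flag R x k (fun l' : 'I_n => if l' == Ordinal ln then 'X^m else 0) <->
  (entry x k l.+1 <= m)%N.
Proof.
move=> lk; split=> [/(_ (Ordinal ln))[/(_ lk)]|em l'] /=.
  by rewrite eqxx dvdp_Pexp2l// size_polyX.
case: eqP => [->|_]; last by split=> // _; apply: dvdp0.
by split=> [_|]; [apply: dvdp_exp2l | rewrite leqNgt lk].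
Qed.

Lemma flag0 x k : flag R x k 0.
Proof. exact: (@sheaf0 R n k (fun l => entry x k l.+1)). Qed.

Lemma flagZD x k (a : R[i]) s s' :
  flag R x k s -> flag R x k s' -> flag R x k (a *: s + s').
Proof. exact: (@sheafZD R n k (fun l => entry x k l.+1)). Qed.

Lemma flagD x k s s' : flag R x k s -> flag R x k s' -> flag R x k (s + s').
Proof. exact: (@sheafD R n k (fun l => entry x k l.+1)). Qed.

Lemma flagB x k s s' : flag R x k s -> flag R x k s' -> flag R x k (s - s').
Proof. exact: (@sheafB R n k (fun l => entry x k l.+1)). Qed.

Lemma flagS x k s : flag R x k s -> flag R x k.+1 s.
Proof.
move=> xs l; have [s1 s2] := xs l; split=> lk; last by apply: s2; apply: ltnW.
case: (ltnP l k) => lk'; last by rewrite s2// dvdp0.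
by apply: dvdp_trans (s1 lk'); apply: dvdp_exp2l; apply: entry_mono.
Qed.

Lemma flag_sub x y k : (k < n)%N ->
  (flag R x k `<=` flag R y k)%classic <->
  (forall l, (0 < l <= k)%N -> (entry y k l <= entry x k l)%N).
Proof.
move=> kn; split=> [sub [//|l] lk|le s sx l].
  have ln : (l < n)%N := ltn_trans lk kn.
  by apply/(@flag_monomial y k l ln _ lk)/sub/(@flag_monomial x k l ln _ lk).
have [s1 s2] := sx l; split=> // lk.
by apply: dvdp_trans (s1 lk); apply: dvdp_exp2l; apply: le.
Qed.

(** Monomial sections turn inclusions of flags into inequalities between entries; nonnegative
    differences with sum 1 have a single nonzero term, whose column is j. *)
Lemma corrP i x y : (0 < i < n)%N -> corr R i x y <-> exists j, raises i j x y.
Proof.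
move=> iN; have /andP[i0 iln] := iN; split.
  move=> [feq fsub deg].
  have eq_ne k l : k != i -> entry y k l = entry x k l.
    move=> ki; case: (boolP (0 < l <= k)%N) => lk; last by rewrite !entry_out.
    case: (ltnP k n) => kn; last by rewrite !entry_ge_n.
    have k0 : (0 < k < n)%N by lia.
    have fk := feq k k0 ki; apply/eqP; rewrite eqn_leq; apply/andP; split.
      by apply: (@flag_sub x y k kn).1 => //; rewrite fk.
    by apply: (@flag_sub y x k kn).1 => //; rewrite fk.
  have le_i l : (entry x i l <= entry y i l)%N.
    case: (boolP (0 < l <= i)%N) => lk; last by rewrite !entry_out.
    exact: (@flag_sub y x i iln).1.
  have sum1 : (\sum_(1 <= l < i.+1) (entry y i l - entry x i l))%N = 1%N.
    by rewrite sumnB// -/(degree y i) -/(degree x i) deg subSnn.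
  have [j ji jlt] : exists2 j, (0 < j <= i)%N & (entry x i j < entry y i j)%N.
    apply: contrapT => nex; move: sum1; rewrite big_nat_cond big1// => l /andP[li _].
    by apply/eqP; rewrite subn_eq0 leqNgt; apply/negP => lt; apply: nex; exists l.
  move: sum1; rewrite (bigD1_seq j) ?iota_uniq ?mem_index_iota//= => sum1.
  have j1 : entry y i j = (entry x i j).+1 by lia.
  have rest : (\sum_(1 <= l < i.+1 | l != j) (entry y i l - entry x i l))%N = 0%N by lia.
  exists j; split=> // k l; case: (eqVneq k i) => [->|ki]; last by rewrite eq_ne// addn0.
  case: eqVneq => [->|lj]; first by rewrite addn1.
  rewrite addn0; case: (boolP (0 < l <= i)%N) => li; last by rewrite !entry_out.
  move/eqP: rest; rewrite sum_nat_seq_eq0 => /allP/(_ l).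
  by rewrite mem_index_iota li lj => /(_ isT)/=; have := le_i l; lia.
move=> [j yx]; have [_ /andP[j0 ji] yxE] := yx; split.
- move=> k kN ki; apply/funext => s; rewrite /flag; apply/propext.
  by split=> h l; have := h l; rewrite yxE (negPf ki) addn0.
- by apply/flag_sub => // l _; rewrite yxE leq_addr.
- by rewrite (degree_raises _ yx) eqxx addn1.
Qed.

End Entries.

(** * Products over the weights of Hom when one degree changes *)

Section HomProd.
Variables (n B : nat) (K : fieldType) (g : 'I_n -> 'I_n -> int -> K).
Local Notation H := (hom_prod B g).
Local Notation level := (@level B).

(** Identities between products over intervals of exponents are checked at each exponent separately:
    the factor has to occur equally often on both sides, a question of linear arithmetic. *)
Lemma if_mul_if (c1 c2 c1' c2' : bool) (u : K) : (c1 + c2 = c1' + c2')%N ->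
  (if c1 then u else 1) * (if c2 then u else 1) =
  (if c1' then u else 1) * (if c2' then u else 1).
Proof. by case: c1 c2 c1' c2' => [] [] [] []; rewrite ?mulr1 ?mul1r. Qed.

Lemma prod_level (a : int) (x : K) : - B%:Z <= a < B%:Z ->
  \prod_(q < B + B) (if level q == a then x else 1) = x.
Proof.
move=> aB; have aB' : (absz (a + B%:Z)%R < B + B)%N by lia.
rewrite (bigD1 (Ordinal aB'))//= big1 ?mulr1 => [|q].
  by case: eqP => //; rewrite /level/=; lia.
by rewrite -val_eqE /= /level => qa; case: eqP => // e; exfalso; move: qa e; lia.
Qed.

Lemma hom_prod_source (A A' X : hom_row) (j0 : 'I_n) (d := A.2 j0) :
  A'.1 = A.1 -> (j0 < A.1)%N -> (forall l, A'.2 l = A.2 l + (l == j0))%N ->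
  (d < B)%N -> (forall l, X.2 l <= B)%N ->
  H A X * \prod_(l < n) g j0 l (- d.+1%:Z) =
  H A' X * \prod_(l < n | (l < X.1)%N) g j0 l ((X.2 l)%:Z - d.+1%:Z).
Proof.
move=> A1 jA A2 dB XB; rewrite /hom_prod (bigD1 j0)//= [in RHS](bigD1 j0)//=.
rewrite ![_ * \prod_(i | i != j0) _]mulrC -!mulrA; congr (_ * _).
  apply: eq_bigr => j /negPf jj; apply: eq_bigr => l _; apply: eq_bigl => q.
  by rewrite /live A1 A2 (val_eqE j j0) jj addn0.
rewrite [X in _ = _ * X]big_mkcond -!big_split; apply: eq_bigr => l _.
have gE (a : int) : - B%:Z <= a < B%:Z ->
    g j0 l a = \prod_(q < B + B) (if level q == a then g j0 l (level q) else 1).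
  move=> aB; rewrite -[LHS](@prod_level a)//; apply: eq_bigr => q _.
  by case: eqP => // ->.
have Xl := XB l.
rewrite /live A1 A2 jA eqxx -/d /=.
case: ifP => lX.
  rewrite (gE (- d.+1%:Z)); last by lia.
  rewrite (gE ((X.2 l)%:Z - d.+1%:Z)); last by lia.
  rewrite [X in X * _ = _]big_mkcond [X in _ = X * _]big_mkcond -!big_split.
  apply: eq_bigr => q _ /=; move: (level q) => a.
  by apply: if_mul_if; lia.
rewrite mulr1 (gE (- d.+1%:Z)); last by lia.
rewrite [X in X * _ = _]big_mkcond [X in _ = X]big_mkcond -!big_split.
apply: eq_bigr => q _ /=; move: (level q) => a.
rewrite -[RHS]mulr1.
by apply: (@if_mul_if _ _ _ false); lia.
Qed.

Lemma hom_prod_target (A X X' : hom_row) (j0 : 'I_n) (d := X.2 j0) :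
  X'.1 = X.1 -> (j0 < X.1)%N -> (forall l, X'.2 l = X.2 l + (l == j0))%N ->
  (d < B)%N -> (forall l, A.2 l <= B)%N ->
  H A X' =
  H A X * \prod_(j < n | (j < A.1)%N) g j j0 (d%:Z - (A.2 j)%:Z).
Proof.
move=> X1 jX X2 dB AB; rewrite /hom_prod [X in _ = _ * X]big_mkcond -big_split.
apply: eq_bigr => j _; rewrite (bigD1 j0)//= [in RHS](bigD1 j0)//=.
rewrite -mulrA [X in _ = _ * X]mulrC mulrA.
congr (_ * _); last first.
  apply: eq_bigr => l /negPf ll; apply: eq_bigl => q.
  by rewrite /live X1 X2 (val_eqE l j0) ll addn0.
have Aj := AB j; rewrite /live X1 X2 jX eqxx -/d /=.
case: ifP => jA; last by rewrite mulr1 !big_pred0.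
have gE (a : int) : - B%:Z <= a < B%:Z ->
    g j j0 a = \prod_(q < B + B) (if level q == a then g j j0 (level q) else 1).
  move=> aB; rewrite -[LHS](@prod_level a)//; apply: eq_bigr => q _.
  by case: eqP => // ->.
rewrite (gE (d%:Z - (A.2 j)%:Z)); last by lia.
rewrite [LHS]big_mkcond [X in _ = X * _]big_mkcond -!big_split.
apply: eq_bigr => q _ /=; move: (level q) => a.
rewrite -[LHS]mulr1.
by apply: (@if_mul_if _ false); lia.
Qed.

(** A factor can vanish only at the trivial weight, where it is the inverse of 1 - 1. This weight is
    not live when O_X is contained in O_Y, which is what the second hypothesis says. *)
Lemma hom_prod_neq0 (X Y : hom_row) :
  (forall j l a, g j l a = 0 -> j = l /\ a = 0) ->
  (forall j : 'I_n, (j < X.1)%N -> (j < Y.1)%N && (Y.2 j <= X.2 j)%N) ->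
  H X Y != 0.
Proof.
move=> g0 XY; apply/prodf_neq0 => j _; apply/prodf_neq0 => l _.
apply/prodf_neq0 => q /and3P[jX jq lY]; apply/eqP => /g0[jl q0].
have /andP[jY YX] := XY j jX.
by move: lY jq; rewrite q0 -jl jY; lia.
Qed.

End HomProd.

(** * S-characters of the tangent spaces as products over rows *)

Section TangentWeights.
Variables (R : realType) (n : nat).
Hypothesis hn : (2 <= n)%N.
Implicit Types (x y : fixpt n).
Local Notation F := (scalars R n).
Local Notation sect := (sect R n).
Local Notation homs := (homs R n).

Definition flag_row x k : hom_row := (k, fun l => entry x k l.+1).

Definition sym_factor (j l : 'I_n) (a : int) : F := (1 - weightF R (hom_weight j l a))^-1.

Lemma sym_factor_eq0 j l a : sym_factor j l a = 0 -> j = l /\ a = 0.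
Proof.
move=> /eqP; rewrite invr_eq0 subr_eq0 eq_sym => /eqP; rewrite weightF_hom//.
move=> /(generic_weight hn); rewrite !ltn_ord => /(_ isT isT)[[jl] a0].
by split; [apply: ord_inj | lia].
Qed.

Lemma tangent_QZD x (a : R[i]) (u v : homs) : tangent_Q (flag R x) u ->
  tangent_Q (flag R x) v -> tangent_Q (flag R x) (a *: u + v).
Proof. exact: (@chain_tangentZD R n n id (fun k l => entry x k l.+1) a u v). Qed.

Lemma null_QZD x (a : R[i]) (u v : homs) : null_Q (flag R x) u ->
  null_Q (flag R x) v -> null_Q (flag R x) (a *: u + v).
Proof. exact: (@chain_nullZD R n n id (fun k l => entry x k l.+1) a u v). Qed.

Lemma act_null_Q x g (u : homs) : null_Q (flag R x) u -> null_Q (flag R x) (act_homs g u).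
Proof. exact: (@act_homs_null R n n id (fun k l => entry x k l.+1) g u). Qed.

Variable B : nat.
Local Notation H := (hom_prod B sym_factor).

Lemma S_Q_prod x : (forall k l, (entry x k l <= B)%N) ->
  S_Q R x * \prod_(k < n) H (flag_row x k) (flag_row x k.+1) =
  \prod_(k < n.+1) H (flag_row x k) (flag_row x k).
Proof.
move=> xB; pose D k l := entry x k l.+1.
have D0 l : D n l = 0%N by rewrite /D entry_ge_n.
have DS k l : (k < n)%N -> (l < k)%N -> (D k.+1 l <= D k l)%N by move=> _ lk; apply: entry_mono.
have hw := @chain_has_weights R n n id D erefl erefl D0 leqnSn DS B (fun k l => xB k l.+1).
have SQ : S_Q R x = \prod_(i | @free_index n n id D B i) sym_factor i.1.1.2 i.1.2 (level i.2).
  rewrite /S_Q (Sym_characterE hn _ _ _ _ hw).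
  - by rewrite /chain_weights big_map big_enum.
  - by move=> k _ s _; apply: flag0.
  - by move=> c phi psi; apply: chain_nullZD.
  - exact: act_homs_lin.
  - by move=> g phi; apply: act_homs_null.
rewrite SQ; exact: (chain_prod erefl erefl D0 leqnSn DS B sym_factor).
Qed.

Section Correspondence.
Variables (i j : nat) (x y : fixpt n).
Hypothesis xy : raises i j x y.

(* The pair of flags (W, W') is the chain
   W_1, ..., W_(i-1), W'_i, W_i, W_(i+1), ..., W_(n-1) of length n, and tangent_E
   is the tangent space of this chain. *)
Let rE k := if (k <= i)%N then k else k.-1.
Let DE k l := if (k <= i)%N then entry y k l.+1 else entry x k.-1 l.+1.

Lemma raises_iN : (0 < i < n)%N. Proof. by case: xy. Qed.

Local Lemma DEn l : DE n.+1 l = 0%N.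
Proof. by rewrite /DE ifN ?entry_ge_n//; have := raises_iN; lia. Qed.

Local Lemma rES k : (rE k <= rE k.+1)%N.
Proof. by rewrite /rE; do 2!case: ifP; lia. Qed.

Local Lemma DES k l : (k < n.+1)%N -> (l < rE k)%N -> (DE k.+1 l <= DE k l)%N.
Proof.
move=> _; rewrite /DE /rE; case: (ltngtP k i) => ki lk.
- exact: entry_mono.
- by case: k ki lk => // k ki lk; apply: entry_mono.
- by case: xy => _ _ ->; rewrite leq_addr.
Qed.

Lemma raises_entry_ne k l : k != i -> entry y k l = entry x k l.
Proof. by move=> /negPf ki; case: xy => _ _ ->; rewrite ki addn0. Qed.

Local Lemma flag_ne k : k != i -> flag R y k = flag R x k.
Proof.
by move=> ki; rewrite !flag_sheaf; congr sheaf; apply/funext => l; apply: raises_entry_ne.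
Qed.

Local Lemma flag_le s : flag R y i s -> flag R x i s.
Proof.
have /andP[_ iln] := raises_iN; apply: (@flag_sub R n y x i iln).2 => l _.
by case: xy => _ _ ->; rewrite leq_addr.
Qed.

(** The discarded components, [phi.1 k] for k < i and [phi.2 k] for k > i, agree with the retained
    ones modulo W_k = W'_k; [split_homs] restores them by duplication. *)
Let merge (phi : homs * homs) : homs :=
  fun k => if (k <= i)%N then phi.2 k else phi.1 k.-1.

Let split_homs (psi : homs) : homs * homs :=
  ((fun k => if (k < i)%N then psi k else psi k.+1) : homs,
   (fun k => if (k <= i)%N then psi k else psi k.+1) : homs).

Local Notation TE := (tangent_E i (flag R x) (flag R y)).
Local Notation TC := (@chain_tangent R n n.+1 rE DE).

Local Lemma sheafE k : sheaf (rE k) (DE k) =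
  (if (k <= i)%N then flag R y k else flag R x k.-1) :> set sect.
Proof. by rewrite /rE /DE; case: ifP. Qed.

Local Lemma merge_tangent phi : TE phi -> TC (merge phi).
Proof.
move=> [[h1 c1] [h2 c2] ne le]; have raises_iN' := raises_iN; split=> [k kN|k k0 kN s].
  rewrite sheafE /rE /merge; case: ifP => ki; first by apply: h2; lia.
  by apply: h1; lia.
rewrite !sheafE /merge; case: (ltngtP k i) => ki.
- by apply: c2; lia.
- by case: k k0 kN ki => // k k0 kN ki; apply: c1; lia.
- by rewrite /= ki; apply: le.
Qed.

Local Lemma split_tangent psi : TC psi -> TE (split_homs psi).
Proof.
move=> [h c]; have raises_iN' := raises_iN.
have c' k s : (0 < k)%N -> (k.+1 < n.+1)%N ->
    (if (k <= i)%N then flag R y k else flag R x k.-1) s ->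
    (if (k < i)%N then flag R y k.+1 else flag R x k) (psi k.+1 s - psi k s).
  by move=> k0 kN; have := c k k0 kN s; rewrite !sheafE.
have h' k : (0 < k < n.+1)%N ->
    hom_to_quotient (rE k) (if (k <= i)%N then flag R y k else flag R x k.-1) (psi k).
  by move=> kN; have := h k kN; rewrite sheafE.
have c2 s : flag R y i s -> flag R x i (psi i.+1 s - psi i s).
  by move=> ys; have := c' i s; rewrite leqnn ltnn; apply=> //; lia.
have kle k : (k.+1 = i) -> (k < i)%N && (k <= i)%N by lia.
split.
- split=> [k kN|k k0 kN s xs] /=.
    have := h' k; have := h' k.+1; rewrite /rE.
    case: (ltngtP k i) => ki.
    + by move=> _ hk; rewrite -flag_ne; [apply: hk; lia | lia].
    + by move=> hk _; apply: hk; lia.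
    + by rewrite ki => hk _; apply: hk; lia.
  case: (ltngtP k.+1 i) => ki.
  + have ki' : (k < i)%N by lia.
    rewrite -flag_ne; last by lia.
    have := c' k s k0; rewrite ki' (ltnW ki').
    by apply; [lia | rewrite flag_ne//; lia].
  + have ki' : (k < i)%N = false by lia.
    have := c' k.+1 s; rewrite ki' (_ : (k.+1 < i)%N = false); last by lia.
    by apply; [lia|lia|].
  (* The step from W_(i-1) to W_i passes over W'_i in the chain, so two consecutive conditions are
     added, using W_(i-1) < W'_i < W_i. *)
  + have /andP[ki' ki''] := kle k ki.
    have ys : flag R y k s by rewrite flag_ne//; lia.
    have := c' k s k0; rewrite ki' ki'' => /(_ _ ys) d1.
    have d2 : flag R x i (psi i s - psi k s).
      by apply: flag_le; rewrite -ki; apply: d1; lia.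
    have := flagD (c2 s _) d2.
    by rewrite ki addrA subrK; apply; rewrite -ki; apply: flagS.
- split=> [k kN|k k0 kN s ys] /=.
    have := h' k; have := h' k.+1; rewrite /rE.
    case: (ltngtP k i) => ki.
    + by move=> _ hk; apply: hk; lia.
    + by move=> hk _; rewrite flag_ne; [apply: hk; lia | lia].
    + by rewrite ki => _ hk; apply: hk; lia.
  case: (ltngtP k i) => ki.
  + have := c' k s k0; rewrite ki (ltnW ki).
    by apply; [lia|].
  + rewrite flag_ne; last by lia.
    have ki1 : (k < i)%N = false by lia.
    have ki2 : (k.+1 < i)%N = false by lia.
    have := c' k.+1 s; rewrite ki1 ki2.
    by apply; [lia|lia|rewrite -flag_ne//; lia].
  (* Likewise the step from W'_i to W_(i+1) passes over W_i. *)
  + rewrite ki flag_ne; last by lia.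
    have ys' : flag R y i s by rewrite -ki.
    have := c' i.+1 s; rewrite ltnn (_ : (i.+1 < i)%N = false); last by lia.
    move=> /(_ _ _ (flag_le ys')) d1.
    have d2 : flag R x i.+1 (psi i.+1 s - psi i s) by apply: flagS; apply: c2.
    have := flagD (d1 _ _) d2.
    by rewrite addrA subrK; apply; lia.
- move=> k kN ki s xs /=; rewrite (_ : (k <= i)%N = (k < i)%N) ?subrr; [exact: flag0|lia].
- by move=> s ys; rewrite /= ltnn leqnn; apply: c2.
Qed.

Local Notation NE := (null_E (flag R x) (flag R y)).
Local Notation NC := (@chain_null R n n.+1 rE DE).

Local Lemma merge_null phi : NE phi -> NC (merge phi).
Proof.
move=> [n1 n2] k kN s; rewrite sheafE /merge; have raises_iN' := raises_iN.
by case: ifP => ki; [apply: n2; lia | apply: n1; lia].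
Qed.

Local Lemma null_merge phi : TE phi -> NC (merge phi) -> NE phi.
Proof.
move=> [_ _ ne le] nm; have raises_iN' := raises_iN.
have nm' k s : (0 < k < n.+1)%N -> (if (k <= i)%N then flag R y k else flag R x k.-1) s ->
    (if (k <= i)%N then flag R y k else flag R x k.-1)
      (if (k <= i)%N then phi.2 k s else phi.1 k.-1 s).
  by move=> kN; have := nm k kN s; rewrite sheafE /merge; case: ifP.
have n2 k s : (0 < k <= i)%N -> flag R y k s -> flag R y k (phi.2 k s).
  by move=> /andP[k0 ki]; have := nm' k s; rewrite ki; apply; lia.
have n1 k s : (i <= k < n)%N -> flag R x k s -> flag R x k (phi.1 k s).
  move=> /andP[ki kn]; have ki1 : (k < i)%N = false by lia.
  by have := nm' k.+1 s; rewrite ki1; apply; lia.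
split=> k kN s ks.
  case: (leqP i k) => ki; first by apply: n1 => //; lia.
  have ki' : k != i by lia.
  have d := ne k kN ki' s ks; rewrite -flag_ne// in d ks *.
  have := flagD d (n2 k s _ ks); rewrite subrK; apply; lia.
case: (leqP k i) => ki; first by apply: n2 => //; lia.
have ki' : k != i by lia.
rewrite flag_ne// in ks *.
have := flagB (n1 k s _ ks) (ne k kN ki' s ks).
by rewrite opprB addrC subrK; apply; lia.
Qed.

Local Lemma split_null psi : NC psi -> NE (split_homs psi).
Proof.
move=> np; have raises_iN' := raises_iN.
have np' k s : (0 < k < n.+1)%N -> (if (k <= i)%N then flag R y k else flag R x k.-1) s ->
    (if (k <= i)%N then flag R y k else flag R x k.-1) (psi k s).
  by move=> kN; have := np k kN s; rewrite sheafE.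
split=> k kN s ks /=.
  case: (ltnP k i) => ki.
    have := np' k s; rewrite (ltnW ki) flag_ne; last by lia.
    by apply; [lia|].
  have ki1 : (k < i)%N = false by lia.
  by have := np' k.+1 s; rewrite ki1; apply; [lia|].
case: (leqP k i) => ki; first by have := np' k s; rewrite ki; apply; [lia|].
have ki1 : (k < i)%N = false by lia.
rewrite flag_ne in ks *; last by lia.
by have := np' k.+1 s; rewrite ki1; apply; [lia|].
Qed.

Lemma S_E_prod :
  (forall k l, (entry x k l <= B)%N) -> (forall k l, (entry y k l <= B)%N) ->
  S_E R i x y * \prod_(k < n.+1) H (rE k, DE k) (rE k.+1, DE k.+1) =
  \prod_(k < n.+2) H (rE k, DE k) (rE k, DE k).
Proof.
move=> xB yB.
have rE0 : rE 0 = 0%N by [].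
have rEn : rE n.+1 = n by rewrite /rE; case: ifP => //; have := raises_iN; lia.
have DB k l : (DE k l <= B)%N by rewrite /DE; case: ifP.
have hw := @chain_has_weights R n n.+1 rE DE rE0 rEn DEn rES DES B DB.
have TE_lin a phi psi : TE phi -> TE psi -> TE (a *: phi + psi).
  move=> [t1 t2 t3 t4] [t1' t2' t3' t4']; split.
  - exact: (@tangent_QZD x a phi.1 psi.1 t1 t1').
  - exact: (@tangent_QZD y a phi.2 psi.2 t2 t2').
  - move=> k kN ki s xs; have := flagZD a (t3 k kN ki s xs) (t3' k kN ki s xs).
    rewrite scalerBr addrACA -opprD; exact.
  - move=> s ys; have := flagZD a (t4 s ys) (t4' s ys).
    rewrite scalerBr addrACA -opprD; exact.
have hw' : has_weights (@act_homs2 R n) TE NE (chain_weights n n.+1 rE DE B).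
  apply: (has_weights_transfer (P := split_homs) (Q := merge) TE_lin _ _ _ _ _ _ _ _ hw).
  - move=> a u v; congr (_, _); apply/funext => k; rewrite /=.
      by change ((if (k < i)%N then a *: u k + v k else a *: u k.+1 + v k.+1) =
        a *: (if (k < i)%N then u k else u k.+1) + (if (k < i)%N then v k else v k.+1)); case: ifP.
    by change ((if (k <= i)%N then a *: u k + v k else a *: u k.+1 + v k.+1) =
        a *: (if (k <= i)%N then u k else u k.+1) + (if (k <= i)%N then v k else v k.+1));
          case: ifP.
  - move=> a [u1 u2] [v1 v2];
    have -> : a *: (u1, u2) + (v1, v2) = (a *: u1 + v1, a *: u2 + v2) by [].
    apply/funext => k; rewrite /merge /=.
    by change ((if (k <= i)%N then a *: u2 k + v2 k else a *: u1 k.-1 + v1 k.-1) =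
      a *: (if (k <= i)%N then u2 k else u1 k.-1) + (if (k <= i)%N then v2 k else v1 k.-1));
        case: ifP.
  - move=> u; apply/funext => k; rewrite /merge /split_homs /=.
    case: (leqP k i) => //; case: k => // k ki.
    by rewrite /= ltnNge -ltnS ki.
  - exact: split_tangent.
  - exact: merge_tangent.
  - exact: split_null.
  - by move=> u Tu; split; [apply: merge_null | apply: null_merge].
  - move=> g u; congr (_, _); apply/funext => k; apply/funext => s; rewrite /= /act_homs.
      by case: ifP.
    by case: ifP.
have SE : S_E R i x y =
    \prod_(i | @free_index n n.+1 rE DE B i) sym_factor i.1.1.2 i.1.2 (level i.2).
  rewrite /S_E (Sym_characterE hn _ _ _ _ hw').
  - by rewrite /chain_weights big_map big_enum.
  - by split=> k _ s _; apply: flag0.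
  - move=> a [u1 u2] [v1 v2] [nu1 nu2] [nv1 nv2].
    have -> : a *: (u1, u2) + (v1, v2) = (a *: u1 + v1, a *: u2 + v2) by [].
    by split; apply: null_QZD.
  - move=> g a [u1 u2] [v1 v2].
    have -> : a *: (u1, u2) + (v1, v2) = (a *: u1 + v1, a *: u2 + v2) by [].
    by rewrite /act_homs2 /= !act_homs_lin.
  - move=> g u [u1 u2]; split.
      exact: act_null_Q.
    exact: act_null_Q.
rewrite SE; exact: (chain_prod rE0 rEn DEn rES DES B sym_factor).
Qed.

End Correspondence.
End TangentWeights.

Section ProdInsert.
Variables (K : comPzRingType) (i : nat).

Lemma prod_nat_succ (f : nat -> K) a m :
  \prod_(a.+1 <= k < m.+1) f k.-1 = \prod_(a <= k < m) f k.
Proof. by rewrite big_add1. Qed.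

Lemma prod_diag_insert (f h : nat -> K) m : (i < m)%N ->
  (forall k, k != i -> f k = h k) ->
  \prod_(k < m.+1) (if (k <= i)%N then h k else f k.-1) = f i * \prod_(k < m) h k.
Proof.
move=> im fh.
rewrite -(big_mkord xpredT (fun k => if (k <= i)%N then h k else f k.-1)).
rewrite -(big_mkord xpredT h) (@big_cat_nat _ _ _ i.+1)//=; last by lia.
rewrite [in RHS](@big_cat_nat _ _ _ i.+1)//=.
rewrite (eq_big_nat _ _ (F2 := h)) => [|k ki]; last by rewrite ifT//; lia.
rewrite [X in _ * X = _](eq_big_nat _ _ (F2 := fun k => f k.-1)) => [|k ki]; last first.
  by rewrite ifF//; lia.
rewrite prod_nat_succ [X in _ * X = _]big_ltn// mulrCA; congr (_ * (_ * _)).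
by apply: eq_big_nat => k ki; apply: fh; lia.
Qed.

(** Here p and q stand for the consecutive pairs of rows of W and of W', and c for the inserted pair
    W'_i < W_i. Compared with the chain of W', only q i has been replaced, by c and p i. *)
Lemma prod_edge_insert_r (p q : nat -> K) c m : (i < m)%N ->
  (forall k, (i < k)%N -> p k = q k) ->
  \prod_(k < m.+1) (if (k < i)%N then q k else if k == i :> nat then c else p k.-1) * q i =
  \prod_(k < m) q k * c * p i.
Proof.
move=> im pq.
rewrite -(big_mkord xpredT (fun k => if (k < i)%N then q k else if k == i then c else p k.-1)).
rewrite -(big_mkord xpredT q) (@big_cat_nat _ _ _ i)//=; last by lia.
rewrite [in RHS](@big_cat_nat _ _ _ i)//=; last by lia.
rewrite (eq_big_nat _ _ (F2 := q)) => [|k ki]; last by rewrite ifT//; lia.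
rewrite [X in _ * X * _ = _]big_ltn; last by lia.
rewrite ltnn eqxx [X in _ * (_ * X) * _ = _](eq_big_nat _ _ (F2 := fun k => p k.-1)) => [|k ki];
  last first.
  by rewrite !ifF//; lia.
rewrite prod_nat_succ !(big_ltn im).
rewrite (eq_big_nat _ _ (F2 := q)) => [|k ki]; last by apply: pq; lia.
by ring.
Qed.

(** Compared with the chain of W, only p (i-1) has been replaced, by q (i-1) and c. *)
Lemma prod_edge_insert_l (p q : nat -> K) c m : (0 < i)%N -> (i < m)%N ->
  (forall k, (k.+1 < i)%N -> p k = q k) ->
  \prod_(k < m.+1) (if (k < i)%N then q k else if k == i :> nat then c else p k.-1) * p i.-1 =
  \prod_(k < m) p k * c * q i.-1.
Proof.
move=> i0 im pq.
rewrite -(big_mkord xpredT (fun k => if (k < i)%N then q k else if k == i then c else p k.-1)).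
rewrite -(big_mkord xpredT p) (@big_cat_nat _ _ _ i)//=; last by lia.
rewrite [in RHS](@big_cat_nat _ _ _ i)//=; last by lia.
rewrite (eq_big_nat _ _ (F2 := q)) => [|k ki]; last by rewrite ifT//; lia.
rewrite [X in _ * X * _ = _]big_ltn; last by lia.
rewrite ltnn eqxx [X in _ * (_ * X) * _ = _](eq_big_nat _ _ (F2 := fun k => p k.-1)) => [|k ki];
  last first.
  by rewrite !ifF//; lia.
rewrite prod_nat_succ; case: i i0 im pq => // i' _ im pq /=.
rewrite !big_nat_recr//= (eq_big_nat _ _ (F2 := p)) => [|k ki]; last first.
  by apply/esym/pq; lia.
by ring.
Qed.

End ProdInsert.

Lemma insert_ratio (K : fieldType) (S S' C C' f q c p : K) :
  C' != 0 -> c != 0 -> p != 0 -> S' != 0 ->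
  S * C = f * (S' * C') -> C * q = C' * c * p -> S / S' = (f * q) / (c * p).
Proof.
move=> C0 c0 p0 S0 e1 e2.
have CC0 : C != 0.
  by apply: contra_neq (mulf_neq0 (mulf_neq0 C0 c0) p0) => CC; rewrite -e2 CC mul0r.
apply/eqP; rewrite eqr_div ?mulf_neq0//; apply/eqP; apply: (mulfI CC0).
transitivity (S * C * (c * p)); first by ring.
rewrite e1; transitivity (f * S' * (C' * c * p)); first by ring.
by rewrite -e2; ring.
Qed.

(** G is the product over all l in [hom_prod_source]; it depends on the source only, hence is common
    to both applications and drops out. *)
Lemma source_ratio (K : fieldType) (f q c p G a b : K) :
  f != 0 -> c != 0 -> p != 0 -> G != 0 ->
  f * G = c * a^-1 -> p * G = q * b^-1 -> (f * q) / (c * p) = b / a.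
Proof.
move=> f0 c0 p0 G0 e1 e2.
have a0 : a != 0.
  by rewrite -invr_eq0; apply: contra_neq (mulf_neq0 f0 G0) => a0; rewrite e1 a0 mulr0.
have b0 : b != 0.
  by rewrite -invr_eq0; apply: contra_neq (mulf_neq0 p0 G0) => b0; rewrite e2 b0 mulr0.
have -> : f = c / a / G by rewrite -e1 mulfK.
have -> : q = p * G * b by rewrite e2 mulfVK.
by field; rewrite a0 p0 c0 G0.
Qed.

Lemma target_ratio (K : fieldType) (f q c p a b : K) :
  f != 0 -> c != 0 -> p != 0 -> q != 0 ->
  f = c * a^-1 -> q = p * b^-1 -> (f * p) / (c * q) = b / a.
Proof.
move=> f0 c0 p0 q0 e1 e2.
have a0 : a != 0 by rewrite -invr_eq0; apply: contra_neq f0 => a0; rewrite e1 a0 mulr0.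
have b0 : b != 0 by rewrite -invr_eq0; apply: contra_neq q0 => b0; rewrite e2 b0 mulr0.
by rewrite e1 e2; field; rewrite a0 p0 c0 b0.
Qed.

(** * Ratios of S-characters in terms of the parameters s_{kl} *)

Section Ratios.
Variables (R : realType) (n : nat).
Hypothesis hn : (2 <= n)%N.
Implicit Types (x y z : fixpt n).
Local Notation F := (scalars R n).
Local Notation t := (tF R n).
Local Notation v := (vF R n).
Local Notation g := (@sym_factor R n).

Definition spectral x k l : F := t l ^+ 2 * v ^ (- (2 * (entry x k l)%:Z)).

Lemma sym_factor_spectral x y k m (j l : 'I_n) :
  g j l ((entry x k l.+1)%:Z - (entry y m j.+1)%:Z) =
  (1 - spectral x k l.+1 / spectral y m j.+1)^-1.
Proof.
rewrite /sym_factor weightF_hom// /spectral; congr (1 - _)^-1.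
rewrite [in RHS]invfM [RHS]mulrACA; congr (_ * _).
by rewrite invr_expz -expfzDr ?vF_neq0//; congr (_ ^ _); lia.
Qed.

Lemma prod_ord_nat (f : nat -> F) m : (m <= n)%N ->
  \prod_(l < n | (l < m)%N) f l.+1 = \prod_(1 <= l < m.+1) f l.
Proof.
move=> mn; rewrite big_add1 big_mkord/=.
by rewrite (big_ord_widen n (fun l => f l.+1) mn).
Qed.

Section Raise.
Variables (i j : nat) (x y : fixpt n).
Hypothesis xy : raises i j x y.

Let B := (entry_bound x + entry_bound y).+2.
Local Notation H := (hom_prod B g).
Local Notation X := (flag_row x).
Local Notation Y := (flag_row y).
Let E k := if (k <= i)%N then Y k else X k.-1.

Local Lemma xB k l : (entry x k l <= B)%N.
Proof. by have := entry_le_bound x k l; rewrite /B; lia. Qed.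

Local Lemma yB k l : (entry y k l <= B)%N.
Proof. by have := entry_le_bound y k l; rewrite /B; lia. Qed.

Local Lemma row_ne k : k != i -> Y k = X k.
Proof.
by move=> ki; rewrite /flag_row; congr (_, _); apply/funext => l; exact: (raises_entry_ne xy).
Qed.

Local Lemma H_neq0 z k : (k <= n)%N -> H (flag_row z k) (flag_row z k) != 0.
Proof.
move=> kn; apply: hom_prod_neq0; first exact: sym_factor_eq0.
by move=> l lk; rewrite /= lk leqnn.
Qed.

Local Lemma H_neq0S z k : H (flag_row z k) (flag_row z k.+1) != 0.
Proof.
apply: hom_prod_neq0; first exact: sym_factor_eq0.
by move=> l lk; rewrite /= (leq_trans lk (leqnSn k)) entry_mono.
Qed.

Local Lemma c_neq0 : H (Y i) (X i) != 0.
Proof.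
apply: hom_prod_neq0; first exact: sym_factor_eq0.
by move=> l li; rewrite /= li; case: xy => _ _ ->; rewrite leq_addr.
Qed.

Local Lemma S_EE : S_E R i x y * \prod_(k < n.+1) H (E k) (E k.+1) =
  \prod_(k < n.+2) H (E k) (E k).
Proof.
have := S_E_prod R hn xy xB yB.
have EE k : (if (k <= i)%N then k else k.-1,
   fun l => if (k <= i)%N then entry y k l.+1 else entry x k.-1 l.+1) = E k.
  by rewrite /E /flag_row; case: ifP.
by under eq_bigr => k _ do rewrite !EE; under [RHS]eq_bigr => k _ do rewrite !EE.
Qed.

Local Lemma prod_E : \prod_(k < n.+2) H (E k) (E k) =
  H (X i) (X i) * \prod_(k < n.+1) H (Y k) (Y k).
Proof.
have /andP[_ iln] := raises_iN xy.
rewrite -(@prod_diag_insert _ i (fun k => H (X k) (X k)) (fun k => H (Y k) (Y k))).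
- by apply: eq_bigr => k _; rewrite /E; case: ifP.
- exact: ltnW.
- by move=> k ki; rewrite row_ne.
Qed.

Local Lemma prod_XY : H (X i) (X i) * \prod_(k < n.+1) H (Y k) (Y k) =
  H (Y i) (Y i) * \prod_(k < n.+1) H (X k) (X k).
Proof.
have /andP[_ iln] := raises_iN xy; have iln' : (i < n.+1)%N by lia.
rewrite (bigD1 (Ordinal iln'))//= [in RHS](bigD1 (Ordinal iln'))//= mulrCA.
congr (_ * (_ * _)); apply: eq_bigr => k; rewrite -val_eqE /= => ki.
by rewrite row_ne.
Qed.

Local Lemma prod_EE (c := H (Y i) (X i)) (p := fun k => H (X k) (X k.+1))
    (q := fun k => H (Y k) (Y k.+1)) :
  \prod_(k < n.+1) H (E k) (E k.+1) =
  \prod_(k < n.+1) (if (k < i)%N then q k else if k == i :> nat then c else p k.-1).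
Proof.
apply: eq_bigr => -[k /= _] _; rewrite /E; case: (ltngtP k i) => ki //.
  by case: k ki.
by rewrite ki.
Qed.

Local Lemma S_Q_neq0 z : (forall k l, (entry z k l <= B)%N) -> S_Q R z != 0.
Proof.
move=> zB; have := S_Q_prod R hn zB => e; apply: contraTneq isT => S0.
have : \prod_(k < n.+1) H (flag_row z k) (flag_row z k) != 0.
  by apply/prodf_neq0 => k _; apply: H_neq0; rewrite -ltnS.
by rewrite -e S0 mul0r eqxx.
Qed.

Local Lemma ratio_y_H :
  S_E R i x y / S_Q R y =
  (H (X i) (X i) * H (Y i) (Y i.+1)) / (H (Y i) (X i) * H (X i) (X i.+1)).
Proof.
have /andP[_ iln] := raises_iN xy.
have e1 := S_EE; rewrite prod_E prod_EE in e1.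
have e2 := S_Q_prod R hn yB.
have e3 := @prod_edge_insert_r _ i (fun k => H (X k) (X k.+1))
  (fun k => H (Y k) (Y k.+1)) (H (Y i) (X i)) n iln.
rewrite -e2 in e1; set CE := (X in _ * X = _) in e1; set CY := (X in _ = _ * (_ * X)) in e1.
have {}e3 : CE * H (Y i) (Y i.+1) = CY * H (Y i) (X i) * H (X i) (X i.+1).
  by apply: e3 => k ik; rewrite !row_ne//; lia.
have CY0 : CY != 0 by apply/prodf_neq0 => k _; apply: H_neq0S.
have c0 := c_neq0; have p0 := H_neq0S x i; have q0 := H_neq0S y i.
have S0 := S_Q_neq0 yB.
exact: insert_ratio CY0 c0 p0 S0 e1 e3.
Qed.

Local Lemma ratio_x_H :
  S_E R i x y / S_Q R x =
  (H (Y i) (Y i) * H (X i.-1) (X i)) / (H (Y i) (X i) * H (Y i.-1) (Y i)).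
Proof.
have /andP[i0 iln] := raises_iN xy.
have e1 := S_EE; rewrite prod_E prod_XY prod_EE in e1.
have e2 := S_Q_prod R hn xB.
have e3 := @prod_edge_insert_l _ i (fun k => H (X k) (X k.+1))
  (fun k => H (Y k) (Y k.+1)) (H (Y i) (X i)) n i0 iln.
rewrite -e2 in e1; set CE := (X in _ * X = _) in e1; set CX := (X in _ = _ * (_ * X)) in e1.
have {}e3 : CE * H (X i.-1) (X i) = CX * H (Y i) (X i) * H (Y i.-1) (Y i).
  by move: e3; rewrite (prednK i0); apply=> k ik; rewrite !row_ne//; lia.
have CX0 : CX != 0 by apply/prodf_neq0 => k _; apply: H_neq0S.
have c0 := c_neq0.
have p0 : H (X i.-1) (X i) != 0 by have := H_neq0S x i.-1; rewrite prednK.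
have q0 : H (Y i.-1) (Y i) != 0 by have := H_neq0S y i.-1; rewrite prednK.
have S0 := S_Q_neq0 xB.
exact: insert_ratio CX0 c0 q0 S0 e1 e3.
Qed.

(** In the four products that survive, only the source row i changes, with targets i and i+1. The
    denominator includes l = j, where the factor is 1 - v^2. *)
Lemma S_E_div_S_Q_y :
  S_E R i x y / S_Q R y =
  \prod_(1 <= l < i.+2) (1 - spectral x i.+1 l / spectral y i j) /
  \prod_(1 <= l < i.+1) (1 - spectral x i l / spectral y i j).
Proof.
have /andP[i0 iln] := raises_iN xy; have [_ /andP[j0 ji] yx] := xy.
have [j' jE] : exists j' : 'I_n, j'.+1 = j.
  by have jn : (j.-1 < n)%N by [lia]; exists (Ordinal jn); rewrite /= prednK.
have ij : (j' < i)%N by rewrite jE.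
have YX l : (Y i).2 l = ((X i).2 l + (l == j'))%N.
  by rewrite /= yx eqxx -jE.
have dB : ((X i).2 j' < B)%N.
  by rewrite /=; have := entry_le_bound x i j'.+1; rewrite /= /B; lia.
have G0 : \prod_(l < n) g j' l (- ((X i).2 j').+1%:Z) != 0.
  by apply/prodf_neq0 => l _; apply/eqP => /(sym_factor_eq0 hn)[_]; lia.
have dE : (((X i).2 j').+1)%:Z = (entry y i j'.+1)%:Z :> int by rewrite yx -jE !eqxx addn1.
have e1 := @hom_prod_source n B _ g (X i) (Y i) (X i) j' erefl ij YX dB (fun l => xB i l.+1).
have e2 := @hom_prod_source n B _ g (X i) (Y i) (X i.+1) j' erefl ij YX dB (fun l => xB i.+1 l.+1).
have fE m : (m <= n)%N -> \prod_(l < n | (l < (X m).1)%N) g j' l (((X m).2 l)%:Z - ((X i).2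
  j').+1%:Z) =
    (\prod_(1 <= l < m.+1) (1 - spectral x m l / spectral y i j))^-1.
  move=> mn; rewrite -prodfV -(@prod_ord_nat (fun l => (1 - spectral x m l / spectral y i j)^-1))//.
  by apply: eq_bigr => l _; rewrite dE (sym_factor_spectral x y m i j' l) -jE.
rewrite fE in e1; last by lia.
rewrite fE in e2; last by lia.
rewrite ratio_y_H (@row_ne i.+1); last by lia.
have c0 := c_neq0; have p0 := H_neq0S x i.
exact: source_ratio (H_neq0 x (ltnW iln)) c0 p0 G0 e1 e2.
Qed.

(** Here only the target row i changes, with sources i and i-1; the factor l = j of the denominator
    is again 1 - v^2. *)
Lemma S_E_div_S_Q_x :
  S_E R i x y / S_Q R x =
  \prod_(1 <= l < i) (1 - spectral x i j / spectral x i.-1 l) /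
  \prod_(1 <= l < i.+1) (1 - spectral x i j / spectral y i l).
Proof.
have /andP[i0 iln] := raises_iN xy; have [_ /andP[j0 ji] yx] := xy.
have [j' jE] : exists j' : 'I_n, j'.+1 = j.
  by have jn : (j.-1 < n)%N by [lia]; exists (Ordinal jn); rewrite /= prednK.
have ij : (j' < i)%N by rewrite jE.
have YX l : (Y i).2 l = ((X i).2 l + (l == j'))%N.
  by rewrite /= yx eqxx -jE.
have dB : ((X i).2 j' < B)%N.
  by rewrite /=; have := entry_le_bound x i j'.+1; rewrite /= /B; lia.
have e1 := @hom_prod_target n B _ g (Y i) (X i) (Y i) j' erefl ij YX dB (fun l => yB i l.+1).
have e2 := @hom_prod_target n B _ g (X i.-1) (X i) (Y i) j' erefl ij YX dB (fun l => xB i.-1 l.+1).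
have fE z m : (m <= n)%N ->
    \prod_(l < n | (l < m)%N) g l j' (((X i).2 j')%:Z - (entry z m l.+1)%:Z) =
    (\prod_(1 <= l < m.+1) (1 - spectral x i j / spectral z m l))^-1.
  move=> mn; rewrite -prodfV -(@prod_ord_nat (fun l => (1 - spectral x i j / spectral z m l)^-1))//.
  by apply: eq_bigr => l _; rewrite (sym_factor_spectral x z i m l j') -jE.
rewrite (fE y i (ltnW iln)) in e1.
rewrite (fE x i.-1 (leq_trans (leq_pred i) (ltnW iln))) in e2.
have c0 := c_neq0.
have p0 : H (X i.-1) (X i) != 0 by have := H_neq0S x i.-1; rewrite prednK.
have q0 : H (X i.-1) (Y i) != 0.
  have := H_neq0S y i.-1; rewrite (prednK i0) (@row_ne i.-1) => [h|]; first exact: h.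
  by lia.
rewrite ratio_x_H (@row_ne i.-1); last by lia.
rewrite prednK// in e2.
exact: target_ratio (H_neq0 y (ltnW iln)) c0 p0 q0 e1 e2.
Qed.

End Raise.

Lemma line_charE i j x y : raises i j x y -> line_char R i x y = spectral x i j.
Proof.
move=> xy; have [/andP[i0 iln] /andP[j0 ji] yx] := xy.
have [j' jE] : exists j' : 'I_n, j'.+1 = j.
  by have jn : (j.-1 < n)%N by [lia]; exists (Ordinal jn); rewrite /= prednK.
pose d := entry x i j.
pose chi : weight n := ([ffun m => 2 * (m == j')%:Z], - (2 * d%:Z)).
have chiE (K : fieldType) (f : 'I_n -> K) : \prod_m f m ^ chi.1 m = f j' ^+ 2.
  rewrite (bigD1 j')//= ffunE eqxx big1 ?mulr1// => m /negPf mj.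
  by rewrite ffunE mj mulr0.
have chiF : weightF R chi = spectral x i j.
  rewrite /weightF (chiE _ (fun l => t l.+1)) /spectral /=.
  by rewrite /d -jE.
pose e (_ : unit) : sect R n := fun l => if l == j' then 'X^d else 0.
pose c (_ : unit) (s : sect R n) := (s j')`_d.
have lij : (j' < i)%N by rewrite jE.
have dE : entry y i j'.+1 = d.+1 by rewrite yx /d -jE !eqxx addn1.
have dxE : entry x i j'.+1 = d by rewrite /d -jE.
have hw : has_weights (@act_sect R n) (flag R x i) (flag R y i)
    [seq (fun _ : unit => chi) u | u <- enum (xpredT : pred unit)].
  apply: (@has_weights_dual _ _ _ _ _ _ _ _ (xpredT : pred unit) _ e c) => //.
  - by move=> a u w; apply: flagZD.
  - move=> [] _ l; rewrite /e; case: eqP => [->|_]; last by split=> // _; apply: dvdp0.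
    by split=> [_|]; [rewrite dxE | rewrite leqNgt lij].
  - move=> g [] _; set w := (X in flag R y i X); suff -> : w = 0 by apply: flag0.
    apply/funext => l; apply/polyP => m.
    change ((act_sect g (e tt) l - weight_at g chi *: e tt l)`_m = (0 : {poly R[i]})`_m).
    rewrite coefB coef_act_sect coefZ coef0 /e; case: eqP => [->|_]; last first.
      by rewrite coef0 !mulr0 subrr.
    rewrite coefXn; case: eqP => [->|_]; last by rewrite !mulr0 subrr.
    rewrite /weight_at (chiE _ (tpt g)) /= -exprnN.
    by rewrite subrr.
  - move=> [] a u w.
    change ((a *: u j' + w j')`_d = a * (u j')`_d + (w j')`_d).
    by rewrite coefD coefZ.
  - by move=> [] [] _ _; rewrite /c /e !eqxx coefXn eqxx.
  - move=> [] u _ /(sheafP i (fun l => entry y i l.+1) u).1; apply.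
    by rewrite lij dE /=.
  - move=> u /(sheafP i (fun l => entry x i l.+1) u).1 xu cu.
    apply/(sheafP i (fun l => entry y i l.+1) u) => l m lm.
    have [lj|lj] := eqVneq l j'; last first.
      by apply: xu; move: lm; rewrite yx -jE eqSS val_eqE (negPf lj) andbF addn0.
    have [md|md] := eqVneq m d; first by rewrite lj md; apply: (cu tt).
    apply: xu; rewrite lj lij dxE /=; move: lm; rewrite lj lij dE /=; lia.
rewrite -chiF; apply: (character1E hn (B := flag R y i)).
- exact: flag0.
- by move=> a u w; apply: flagZD.
- exact: act_sect_lin.
- by move=> h u; apply: (@act_sect_sheaf R n h i (fun l => entry y i l.+1)).
have enum1 : enum (xpredT : pred unit) = [:: tt].
  apply: perm_small_eq => //; apply: uniq_perm => [||[]]; rewrite ?enum_uniq//.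
  by rewrite mem_enum.
by rewrite enum1 in hw.
Qed.

End Ratios.

(** * Rational identities *)

Section Lagrange.
Variable K : fieldType.

Lemma prod_const_seq (T : Type) (A : seq T) (P : pred T) (x : K) :
  \prod_(l <- A | P l) x = x ^+ count P A.
Proof. by rewrite big_const_seq iter_mulr_1. Qed.

Lemma lagrange_lead (pts : seq K) (Q : {poly K}) :
  uniq pts -> (size Q <= size pts)%N ->
  \sum_(x <- pts) Q.[x] / \prod_(y <- pts | y != x) (x - y) = Q`_(size pts).-1.
Proof.
move=> upts sQ; pose N := size pts.
pose B x : {poly K} := \prod_(y <- pts | y != x) ('X - y%:P).
pose P := \sum_(x <- pts) (Q.[x] / \prod_(y <- pts | y != x) (x - y)) *: B x.
have Bmonic x : B x \is monic by apply: monic_prod_XsubC.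
have sB x : x \in pts -> size (B x) = N.
  move=> xp; rewrite /B -big_filter (eq_filter (a2 := predC1 x))// -rem_filter//.
  by rewrite size_prod_XsubC size_rem// prednK// lt0n size_eq0; apply: contraTneq xp => ->.
have BE x z : (B x).[z] = \prod_(y <- pts | y != x) (z - y).
  by rewrite /B horner_prod; apply: eq_bigr => y _; rewrite !hornerE.
have D0 x : \prod_(y <- pts | y != x) (x - y) != 0.
  rewrite prodf_seq_neq0; apply/allP => y _; apply/implyP => yx.
  by rewrite subr_eq0 eq_sym.
have PQ : P = Q.
  apply/eqP; rewrite -subr_eq0; apply/eqP.
  apply: (roots_geq_poly_eq0 (rs := pts)) => //.
    apply/allP => z zp; rewrite rootE hornerD hornerN /P horner_sum.
    rewrite (bigD1_seq z)//= [X in _ + X - _]big1 => [|x xz].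
      by rewrite addr0 hornerZ BE divfK// subrr.
    rewrite hornerZ BE; apply/eqP; rewrite mulf_eq0 prodf_seq_eq0; apply/orP; right.
    by apply/hasP; exists z => //; rewrite eq_sym xz subrr eqxx.
  apply: leq_trans (size_polyD _ _) _; rewrite size_polyN geq_max sQ andbT.
  apply: leq_trans (size_sum _ _ _) _; apply/bigmax_leqP_seq => x xp _.
  by apply: leq_trans (size_scale_leq _ _) _; rewrite sB.
rewrite -[in RHS]PQ /P coef_sum; apply: eq_big_seq => x xp; rewrite coefZ.
by have /monicP := Bmonic x; rewrite lead_coefE sB// => ->; rewrite mulr1.
Qed.

End Lagrange.

Section Residue.
Variables (K : fieldType) (q : K) (I J J' : seq nat) (s u r : nat -> K).
Hypotheses (uI : uniq I) (q0 : q != 0) (q1 : q != 1).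
Hypotheses (sJ : size J = (size I).+1) (sJ' : size I = (size J').+1).
Hypotheses (s0 : forall l, l \in I -> s l != 0) (r0 : forall l, l \in J' -> r l != 0).
Hypothesis s_gen : forall b l, b \in I -> l \in I -> b != l ->
  s b != s l /\ q * s b != s l.

(* The diagonal terms of pq i followed by qLp i, and of the reverse composition,
   s, u, r standing for the rows i, i+1, i-1. *)
Definition lower_raise b : K :=
  \prod_(c <- J) (1 - u c / s b) * \prod_(c <- J') (1 - q * s b / r c) * (q * s b) /
  ((1 - q) ^+ 2 * (\prod_(l <- I | l != b) (1 - s l / s b) *
                   \prod_(l <- I | l != b) (1 - q * s b / s l))).

Definition raise_lower b : K :=
  \prod_(c <- J) (1 - q * u c / s b) * \prod_(c <- J') (1 - s b / r c) * s b /
  ((1 - q) ^+ 2 * (\prod_(l <- I | l != b) (1 - q * s l / s b) *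
                   \prod_(l <- I | l != b) (1 - s b / s l))).

(* lower_raise b and - raise_lower b are, up to a common factor, the terms of the
   interpolation formula for Q at s b and at q^-1 * s b. *)
Let Q : {poly K} := \prod_(c <- J) ('X - (u c)%:P) * \prod_(c <- J') (1 - (q / r c) *: 'X).

Local Lemma QE x : Q.[x] = \prod_(c <- J) (x - u c) * \prod_(c <- J') (1 - q * x / r c).
Proof.
rewrite /Q hornerM !horner_prod; congr (_ * _); apply: eq_bigr => c _; rewrite !hornerE //.
by rewrite mulrAC.
Qed.

Local Lemma Qlead : (size Q <= (size I + size I).+1)%N /\
  Q`_(size I + size I) = (- q) ^+ size J' / \prod_(c <- J') r c.
Proof.
have lin c : c \in J' -> (1 - (q / r c) *: 'X : {poly K}) = (- q / r c) *: ('X - (r c / q)%:P).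
  move=> cJ; rewrite scalerBr -[X in _ = _ - X]mul_polyC -polyCM.
  rewrite (_ : - q / r c * (r c / q) = -1); last by field; rewrite q0 r0.
  by rewrite polyCN opprK mulNr scaleNr addrC.
have QP : Q = ((- q) ^+ size J' / \prod_(c <- J') r c) *:
    (\prod_(c <- J) ('X - (u c)%:P) * \prod_(c <- J') ('X - (r c / q)%:P)).
  rewrite /Q scalerAr; congr (_ * _).
  rewrite (eq_big_seq _ lin) scaler_prod; congr (_ *: _).
  by rewrite prodf_div prod_const_seq count_predT.
pose M := \prod_(c <- J) ('X - (u c)%:P) * \prod_(c <- J') ('X - (r c / q)%:P).
have Mm : M \is monic by apply: rpredM; apply: monic_prod_XsubC.
have sM : size M = (size I + size I).+1.
  rewrite size_monicM ?monic_prod_XsubC ?monic_neq0 ?monic_prod_XsubC//.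
  by rewrite !size_prod_XsubC sJ; rewrite [in RHS]sJ' /=; lia.
rewrite QP -/M; split; first by apply: leq_trans (size_scale_leq _ _) _; rewrite sM.
have /monicP := Mm; rewrite lead_coefE sM /= coefZ => ->; by rewrite mulr1.
Qed.

Lemma residue_sum :
  \sum_(b <- I) (lower_raise b - raise_lower b) =
  (q * (\prod_(c <- J) u c / \prod_(b <- I) s b)
   - \prod_(b <- I) s b / \prod_(c <- J') r c) / (1 - q).
Proof.
(* There are 2|I| + 1 nodes and Q has degree at most |J| + |J'| = 2|I|. The node 0 yields the term
   with the product of the u c, the leading coefficient the one with the product of the r c. *)
pose pts := 0 :: [seq s b | b <- I] ++ [seq q^-1 * s b | b <- I].
have sinj : {in I &, injective s}.
  move=> b l bI lI sbl; apply/eqP; apply: contraT => bl.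
  by have [/eqP] := s_gen bI lI bl.
have sqinj b l : b \in I -> l \in I -> s b != q^-1 * s l.
  move=> bI lI; apply/eqP => e; have {}e : q * s b = s l by rewrite e mulVKf.
  have [bl|bl] := eqVneq b l; last by have [_ /eqP] := s_gen bI lI bl.
  by move: e; rewrite bl -[RHS]mul1r => /(mulIf (s0 lI))/eqP; rewrite (negPf q1).
have upts : uniq pts.
  rewrite /pts /= mem_cat negb_or cat_uniq !map_inj_in_uniq// ?uI/= => [|b l bI lI]; last first.
    by move/(mulfI (invr_neq0 q0)); apply: sinj.
  rewrite andbT; apply/andP; split; first (apply/andP; split).
  - by apply/mapP => -[b bI /esym/eqP]; rewrite (negPf (s0 bI)).
  - by apply/mapP => -[b bI /esym/eqP]; rewrite mulf_eq0 invr_eq0 (negPf q0) (negPf (s0 bI)).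
  apply/hasPn => x /mapP[l lI ->]; apply/mapP => -[b bI] /esym/eqP.
  by rewrite (negPf (sqinj _ _ bI lI)).
have spts : size pts = (size I + size I).+1 by rewrite /= size_cat !size_map.
have [sQ leadQ] := Qlead.
pose m := size J'.
have ctb b : b \in I -> count (fun l => l != b) I = m.
  move=> bI; have := count_predC (pred1 b) I; rewrite count_uniq_mem// bI sJ' add1n.
  by rewrite -/m => -[<-]; apply: eq_count.
pose S := \prod_(b <- I) s b; pose w := (- q) ^+ m.
have w0 : w != 0 by rewrite expf_neq0// oppr_eq0.
have S0 : S != 0 by rewrite prodf_seq_neq0; apply/allP => b bI; apply/implyP => _; apply: s0.
have split_sub x (A : seq nat) (P : pred nat) (f : nat -> K) : x != 0 ->
    \prod_(c <- A | P c) (x - f c) = x ^+ count P A * \prod_(c <- A | P c) (1 - f c / x).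
  move=> x0; rewrite -prod_const_seq -big_split; apply: eq_bigr => c _ /=.
  by rewrite mulrBr mulr1 mulrCA divff// mulr1.
have D1 b : b \in I -> \prod_(l <- I | l != b) (1 - s l / s b) != 0.
  move=> bI; rewrite prodf_seq_neq0; apply/allP => l lI; apply/implyP => lb.
  have [sb _] := s_gen lI bI lb; rewrite subr_eq0; apply: contra_neq sb => e.
  by rewrite -[RHS]mul1r e divfK// s0.
have D1' b : b \in I -> \prod_(l <- I | l != b) (1 - s b / s l) != 0.
  move=> bI; rewrite prodf_seq_neq0; apply/allP => l lI; apply/implyP => lb.
  have [sb _] := s_gen lI bI lb; rewrite subr_eq0; apply: contra_neq sb => e.
  by rewrite -[LHS]mul1r e divfK// s0.
have D2 b : b \in I -> \prod_(l <- I | l != b) (1 - q * s b / s l) != 0.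
  move=> bI; rewrite prodf_seq_neq0; apply/allP => l lI; apply/implyP => lb.
  rewrite eq_sym in lb; have [_ sb] := s_gen bI lI lb; rewrite subr_eq0; apply: contra_neq sb => e.
  by rewrite -[RHS]mul1r e divfK// s0.
have D2' b : b \in I -> \prod_(l <- I | l != b) (1 - q * s l / s b) != 0.
  move=> bI; rewrite prodf_seq_neq0; apply/allP => l lI; apply/implyP => lb.
  have [_ sb] := s_gen lI bI lb; rewrite subr_eq0; apply: contra_neq sb => e.
  by rewrite -[RHS]mul1r e divfK// s0.
have q1' : 1 - q != 0 by rewrite subr_eq0 eq_sym.
have mN : (- q^-1) ^+ m = w^-1 by rewrite /w -exprVn invrN.
have F0 : Q.[0] / \prod_(y <- pts | y != 0) (0 - y) =
    w * q * \prod_(c <- J) u c / S ^+ 2.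
  have -> : Q.[0] = (-1) ^+ m * \prod_(c <- J) u c.
    rewrite QE [X in _ * X]big1 ?mulr1 => [|c _]; last by rewrite mulr0 mul0r subr0.
    rewrite (eq_bigr (fun c => -1 * u c)) => [|c _]; last by rewrite sub0r mulN1r.
    by rewrite big_split /= prod_const_seq count_predT sJ sJ' !exprS !mulN1r opprK.
  have -> : \prod_(y <- pts | y != 0) (0 - y) = (q^-1) ^+ m.+1 * S ^+ 2.
    rewrite /pts big_cons eqxx big_cat !big_map /=.
    rewrite big_seq_cond [X in _ * X]big_seq_cond.
    rewrite (eq_big (fun b => b \in I) (fun b => -1 * s b)); first last.
    - by move=> b _; rewrite sub0r mulN1r.
    - by move=> b; case bI : (b \in I) => //=; rewrite s0.
    rewrite [X in _ * X](eq_big (fun b => b \in I) (fun b => - q^-1 * s b)); first last.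
    - by move=> b _; rewrite sub0r mulNr.
    - by move=> b; case bI : (b \in I) => //=; rewrite mulf_neq0 ?invr_eq0 ?s0.
    rewrite -!big_seq !big_split /= !prod_const_seq !count_predT sJ' -/m -/S.
    rewrite mulrACA -exprMn mulN1r opprK; by congr (_ * _).
  have -> : (q^-1) ^+ m.+1 = (q * q ^+ m)^-1 by rewrite exprVn exprS.
  have -> : w = (-1) ^+ m * q ^+ m by rewrite -exprNn.
  have := expf_neq0 m q0; move: (q ^+ m) => qm qm0; field.
  by rewrite S0 q0 qm0.
have F1 b : b \in I -> Q.[s b] / \prod_(y <- pts | y != s b) (s b - y) =
    - (lower_raise b * (1 - q) * w / S).
  move=> bI; have sb0 := s0 bI.
  rewrite QE (split_sub (s b))// count_predT sJ sJ' -/m /pts big_cons eq_sym sb0 subr0.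
  rewrite big_cat !big_map /=.
  have -> : \prod_(l <- I | s l != s b) (s b - s l) =
      s b ^+ m * \prod_(l <- I | l != b) (1 - s l / s b).
    rewrite -(ctb b bI) -split_sub// big_seq_cond [RHS]big_seq_cond.
    apply: eq_bigl => l; case lI : (l \in I) => //=; congr (~~ _).
    by apply/eqP/eqP => [/(sinj _ _ lI bI)|->].
  have -> : \prod_(l <- I | q^-1 * s l != s b) (s b - q^-1 * s l) =
      - q^-1 * w^-1 * S * ((1 - q) * \prod_(l <- I | l != b) (1 - q * s b / s l)).
    (* The factor l = b comes from the node q^-1 s_b. It is one of the two factors 1 - q in the
       denominator of [lower_raise]; the other belongs to the common factor of all terms. *)
    have -> : (1 - q) * \prod_(l <- I | l != b) (1 - q * s b / s l) =
        \prod_(l <- I) (1 - q * s b / s l) by rewrite [RHS](bigD1_seq b)//= mulfK.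
    rewrite -mN -exprS -sJ' -(count_predT I) -prod_const_seq /S -!big_split /=.
    rewrite big_seq_cond [RHS]big_seq; apply: eq_big => [l|l /andP[lI _]].
      by case lI : (l \in I) => //=; rewrite eq_sym (sqinj _ _ bI lI).
    by have sl0 := s0 lI; field; rewrite sl0 q0.
  rewrite /lower_raise; have := D1 b bI; have := D2 b bI.
  move: (\prod_(l <- I | _) _) (\prod_(l <- I | _) _) (\prod_(l <- J) _) (\prod_(l <- J') _).
  move=> d2 d1 n1 n2 d20 d10; rewrite !exprS; field.
  by rewrite d20 d10 S0 w0 q1' sb0 q0 oppr_eq0 oner_eq0 expf_neq0.
have F2 b : b \in I -> Q.[q^-1 * s b] / \prod_(y <- pts | y != q^-1 * s b) (q^-1 * s b - y) =
    raise_lower b * (1 - q) * w / S.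
  move=> bI; have sb0 := s0 bI.
  have qsb0 : q^-1 * s b != 0 by rewrite mulf_neq0 ?invr_eq0.
  rewrite QE (split_sub (q^-1 * s b))// count_predT sJ sJ' -/m /pts big_cons eq_sym qsb0 subr0.
  rewrite big_cat !big_map /=.
  have -> : \prod_(l <- I | s l != q^-1 * s b) (q^-1 * s b - s l) =
      (q^-1 * s b) ^+ m.+1 * ((1 - q) * \prod_(l <- I | l != b) (1 - q * s l / s b)).
    have -> : (1 - q) * \prod_(l <- I | l != b) (1 - q * s l / s b) =
        \prod_(l <- I) (1 - q * s l / s b) by rewrite [RHS](bigD1_seq b)//= mulfK.
    rewrite -sJ' -(count_predT I) -prod_const_seq -!big_split /=.
    rewrite big_seq_cond [RHS]big_seq; apply: eq_big => [l|l /andP[lI _]].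
      by case lI : (l \in I) => //=; rewrite (sqinj _ _ lI bI).
    by field; rewrite sb0 q0.
  have -> : \prod_(l <- I | q^-1 * s l != q^-1 * s b) (q^-1 * s b - q^-1 * s l) =
      w^-1 * (S / s b) * \prod_(l <- I | l != b) (1 - s b / s l).
    have -> : S / s b = \prod_(l <- I | l != b) s l.
      by rewrite /S (bigD1_seq b)//= mulrC mulKf.
    rewrite -mN -(ctb b bI) -prod_const_seq.
    rewrite -!big_split /= big_seq_cond [RHS]big_seq_cond; apply: eq_big => [l|l /andP[lI _]].
      case lI : (l \in I) => //=; congr (~~ _).
      by apply/eqP/eqP => [/(mulfI (invr_neq0 q0))/(sinj _ _ lI bI)|->].
    by have sl0 := s0 lI; field; rewrite sl0 q0.
  have -> : \prod_(c <- J) (1 - u c / (q^-1 * s b)) = \prod_(c <- J) (1 - q * u c / s b).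
    by apply: eq_bigr => c _; field; rewrite sb0 q0.
  have -> : \prod_(c <- J') (1 - q * (q^-1 * s b) / r c) = \prod_(c <- J') (1 - s b / r c).
    by apply: eq_bigr => c _; rewrite mulrA divff// mul1r.
  rewrite /raise_lower; have := D1' b bI; have := D2' b bI.
  move: (\prod_(l <- I | _) _) (\prod_(l <- I | _) _) (\prod_(l <- J) _) (\prod_(l <- J') _).
  move=> d2 d1 n1 n2 d20 d10; rewrite !exprS !exprMn; field.
  by rewrite d20 d10 S0 w0 q1' sb0 q0 !expf_neq0// invr_eq0.
have := @lagrange_lead _ pts Q upts; rewrite spts => /(_ sQ)/=; rewrite leadQ.
rewrite {1}/pts big_cons big_cat !big_map F0 (eq_big_seq _ F1) (eq_big_seq _ F2) -/m -/w -/S.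
rewrite /= addrC -big_split /= => e.
have e' : - \sum_(b <- I) (lower_raise b - raise_lower b) * ((1 - q) * w / S) +
   w * q * \prod_(c <- J) u c / S ^+ 2 = w / \prod_(c <- J') r c.
  rewrite -e [RHS]addrC; congr (_ + _); rewrite -sumrN; apply: eq_bigr => b _.
  by rewrite mulrBl opprB !mulrA.
rewrite -mulr_suml in e'.
have R0 : \prod_(c <- J') r c != 0.
  by rewrite prodf_seq_neq0; apply/allP => c cJ; apply/implyP => _; apply: r0.
move: e' R0; set T := \sum_(b <- I) _; set U := \prod_(c <- J) u c; set V := \prod_(c <- J') r c.
move=> e' R0.
have -> : T = (w * q * U / S ^+ 2 - w / V) / ((1 - q) * w / S).
  by rewrite -e' opprD opprK addrCA subrr addr0 mulfK// !mulf_neq0// invr_eq0.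
by field; rewrite R0 S0 w0 q1'.
Qed.

End Residue.

Lemma bigD1_seq_cond (K : comPzRingType) (T : eqType) (r : seq T) (P : pred T) x (f : T -> K) :
  uniq r -> x \in r -> P x ->
  \prod_(l <- r | P l) f l = f x * \prod_(l <- r | P l && (l != x)) f l.
Proof.
move=> ur xr Px; rewrite -big_filter (bigD1_seq x) ?mem_filter ?Px ?filter_uniq//=.
by rewrite big_filter_cond.
Qed.

(** * Serre identities for the coefficients *)

Section Core.
Variables (K : fieldType) (q : K).
Hypotheses (q0 : q != 0) (q1 : q != 1).
Implicit Types (s : nat -> nat -> K) (i j k b c l nb : nat).

(* s k l stands for s_{kl} and nb for i+1 in lowering operators, for 1 / s_{kl}
   and i-1 in raising ones; both kinds of operators then multiply s i b by q. *)
Definition core_coef nb i b s : K :=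
  \prod_(1 <= l < nb.+1) (1 - s nb l / s i b) /
  ((1 - q) * \prod_(1 <= l < i.+1 | l != b) (1 - s i l / s i b)).

Definition upd i b s : nat -> nat -> K :=
  fun k l => if (k == i) && (l == b) then q * s k l else s k l.

Lemma updC i b j c s : upd i b (upd j c s) = upd j c (upd i b s).
Proof.
by apply/funext => k; apply/funext => l; rewrite /upd; do 2!case: ifP.
Qed.

Lemma upd_eq i b s : upd i b s i b = q * s i b.
Proof. by rewrite /upd !eqxx. Qed.

Lemma upd_row i b s k l : k != i -> upd i b s k l = s k l.
Proof. by move=> /negPf ki; rewrite /upd ki. Qed.

Lemma upd_col i b s k l : l != b -> upd i b s k l = s k l.
Proof. by move=> /negPf lb; rewrite /upd lb andbF. Qed.

Lemma core_coef_upd nb i b k c s : k != i -> k != nb ->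
  core_coef nb i b (upd k c s) = core_coef nb i b s.
Proof.
rewrite eq_sym => ki; rewrite eq_sym => kn; rewrite /core_coef.
rewrite (eq_bigr (fun l => 1 - s nb l / s i b)) => [|l _]; last by rewrite !upd_row.
by rewrite [X in _ / (_ * X)](eq_bigr (fun l => 1 - s i l / s i b)) => [|l _];
  last by rewrite !upd_row.
Qed.

Definition generic_row i s := forall b, (0 < b <= i)%N -> s i b != 0 /\
  forall l, (0 < l <= i)%N -> l != b -> s i l != s i b /\ q * s i l != s i b.

Section Serre.
Variables (i j nbi nbj : nat) (s : nat -> nat -> K) (c : nat).
Hypotheses (ij : i != j) (nbii : nbi != i) (nbjj : nbj != j).
Hypothesis (gi : generic_row i s) (gj : generic_row j s) (cj : (0 < c <= j)%N).

Definition serre0 b b' : K :=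
  core_coef nbj j c s * core_coef nbi i b (upd j c s) *
  core_coef nbi i b' (upd i b (upd j c s)).

Definition serre1 b b' : K :=
  core_coef nbi i b s * core_coef nbj j c (upd i b s) *
  core_coef nbi i b' (upd j c (upd i b s)).

Definition serre2 b b' : K :=
  core_coef nbi i b s * core_coef nbi i b' (upd i b s) *
  core_coef nbj j c (upd i b' (upd i b s)).

Let rest (P : pred nat) b b' s' : K :=
  \prod_(1 <= l < nbi.+1 | P l) (1 - s' nbi l / s' i b) /
  ((1 - q) * \prod_(1 <= l < i.+1 | (l != b) && (l != b')) (1 - s' i l / s' i b)).

Local Lemma rest_upd_col P b b' s' : b != b' -> rest P b b' (upd i b' s') = rest P b b' s'.
Proof.
move=> bb; rewrite /rest.
rewrite (eq_bigr (fun l => 1 - s' nbi l / s' i b)) => [|l _]; last by rewrite upd_row// upd_col.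
rewrite [X in _ / (_ * X)](eq_bigr (fun l => 1 - s' i l / s' i b)) => [//|l /andP[_ lb]].
by rewrite !upd_col.
Qed.

Local Lemma rest_upd_row b b' s' : nbi = j ->
  rest (fun l => l != c) b b' (upd j c s') = rest (fun l => l != c) b b' s'.
Proof.
move=> nj; rewrite /rest.
rewrite (eq_bigr (fun l => 1 - s' nbi l / s' i b)) => [|l lc]; last by rewrite upd_col// upd_row.
rewrite [X in _ / (_ * X)](eq_bigr (fun l => 1 - s' i l / s' i b)) => [//|l /andP[_ lb]].
by rewrite !upd_row.
Qed.

Local Lemma core_split b b' s' : (0 < b' <= i)%N -> b != b' ->
  core_coef nbi i b s' = rest xpredT b b' s' / (1 - s' i b' / s' i b).
Proof.
move=> b'i bb; rewrite /core_coef /rest -mulrA -invfM -mulrA; congr (_ / (_ * _)).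
rewrite (@bigD1_seq_cond _ _ _ _ b') ?mem_index_iota ?iota_uniq 1?eq_sym//.
by rewrite mulrC.
Qed.

Local Lemma core_split_row b b' s' : nbi = j -> (0 < b' <= i)%N -> b != b' ->
  core_coef nbi i b s' =
  (1 - s' j c / s' i b) * rest (fun l => l != c) b b' s' / (1 - s' i b' / s' i b).
Proof.
move=> nj b'i bb; rewrite (@core_split b b' s')// /rest nj.
by rewrite (bigD1_seq c) ?mem_index_iota ?iota_uniq//= -!mulrA.
Qed.

Let rest1 b s' : K :=
  \prod_(1 <= l < nbi.+1 | l != c) (1 - s' nbi l / s' i b) /
  ((1 - q) * \prod_(1 <= l < i.+1 | l != b) (1 - s' i l / s' i b)).

Local Lemma rest1_upd_row b s' : nbi = j -> rest1 b (upd j c s') = rest1 b s'.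
Proof.
move=> nj; rewrite /rest1.
rewrite (eq_bigr (fun l => 1 - s' nbi l / s' i b)) => [|l lc]; last by rewrite upd_col// upd_row.
rewrite [X in _ / (_ * X)](eq_bigr (fun l => 1 - s' i l / s' i b)) => [//|l lb].
by rewrite !upd_row.
Qed.

Local Lemma core_split_row1 b s' : nbi = j ->
  core_coef nbi i b s' = (1 - s' j c / s' i b) * rest1 b s'.
Proof.
move=> nj; rewrite /core_coef /rest1 nj.
by rewrite (bigD1_seq c) ?mem_index_iota ?iota_uniq//= -!mulrA.
Qed.

(** The coefficients in row j do not see row i, and those in row i see s_{jc} only through the
    factor 1 - s_{jc} / s_{ib}. Put x = s_{ib}, y = s_{ib'}, u = s_{jc}. For b = b' the combination
    vanishes by itself; otherwise, up to a factor symmetric in b and b', it is (1 - q) u / (x - y),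
    which is antisymmetric. *)
Lemma serre_row_right b b' : nbi = j -> nbj != i -> (0 < b <= i)%N -> (0 < b' <= i)%N ->
  (serre0 b b' - (1 + q) * serre1 b b' + q * serre2 b b') +
  (serre0 b' b - (1 + q) * serre1 b' b + q * serre2 b' b) = 0.
Proof.
move=> nj nji bi b'i; rewrite /serre0 /serre1 /serre2.
have ji : j != i by rewrite eq_sym.
have x0 : s i b != 0 by have [] := gi bi.
have y0 : s i b' != 0 by have [] := gi b'i.
have cu c' s' : core_coef nbj j c (upd i c' s') = core_coef nbj j c s'.
  by rewrite core_coef_upd// eq_sym.
rewrite !cu.
rewrite !(updC j c i).
have [<-|bb] := eqVneq b b'.
  rewrite !(updC i b j c) !core_split_row1// !rest1_upd_row//.
  rewrite !(upd_eq, upd_row _ _ _ ji, upd_row _ _ _ ij).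
  move: x0 (rest1 b s) (rest1 b (upd i b s)) (core_coef _ _ _ _).
  move: (s i b) (s j c) => x u x0 M M' C; field.
  by rewrite x0 q0.
have [_ /(_ b' b'i)] := gi bi; rewrite eq_sym => /(_ bb)[yx qyx].
have [_ /(_ b bi bb)[xy qxy]] := gi b'i.
rewrite !(core_split_row (b := b) (b' := b'))// !(core_split_row (b := b') (b' := b))//;
  try by rewrite eq_sym.
rewrite !rest_upd_row// !(rest_upd_col _ (b := b) (b' := b'))// !(rest_upd_col _ (b := b') (b' :=
  b))//; try by rewrite eq_sym.
rewrite !rest_upd_row//.
rewrite !(upd_eq, upd_row _ _ _ ji, upd_row _ _ _ ij) !(upd_col _ _ _ bb).
rewrite eq_sym in bb; rewrite !(upd_col _ _ _ bb) !(upd_row _ _ _ ij).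
move: x0 y0 yx qyx xy qxy.
move: (rest _ b b' s) (rest _ b' b s) (core_coef _ _ _ _) (s i b) (s i b') (s j c).
move=> M M' C x y u x0 y0 yx qyx xy qxy; field.
by rewrite x0 y0 !subr_eq0 yx xy ![_ == q * _]eq_sym qyx qxy.
Qed.

(** M does not depend on the two entries split off, so the same M serves for all arrays obtained by
    changing them. *)
Local Lemma core_target_split b b' s' : nbj = i -> (0 < b <= i)%N -> (0 < b' <= i)%N -> b != b' ->
  exists2 M, core_coef nbj j c s' = (1 - s' i b / s' j c) * (1 - s' i b' / s' j c) * M
  & forall x y, core_coef nbj j c (fun k l => if (k == i) && (l == b) then x else
       if (k == i) && (l == b') then y else s' k l) =
     (1 - x / s' j c) * (1 - y / s' j c) * M.
Proof.
move=> nj bi b'i bb.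
exists (\prod_(1 <= l < i.+1 | (l != b) && (l != b')) (1 - s' i l / s' j c) /
  ((1 - q) * \prod_(1 <= l < j.+1 | l != c) (1 - s' j l / s' j c))).
  rewrite /core_coef nj (bigD1_seq b) ?mem_index_iota ?iota_uniq//=.
  rewrite (@bigD1_seq_cond _ _ _ _ b') ?mem_index_iota ?iota_uniq 1?eq_sym//=.
  by rewrite -!mulrA.
move=> x y; rewrite /core_coef nj (bigD1_seq b) ?mem_index_iota ?iota_uniq//=.
rewrite (@bigD1_seq_cond _ _ _ _ b') ?mem_index_iota ?iota_uniq 1?eq_sym//=.
have /negPf ji : j != i by rewrite eq_sym.
rewrite !eqxx ji /= [b' == b]eq_sym (negPf bb) -!mulrA; congr (_ * (_ * (_ / (_ * _)))).
by apply: eq_bigr => l /andP[/negPf -> /negPf ->].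
Qed.

Local Lemma core_target_split1 b s' : nbj = i -> (0 < b <= i)%N ->
  exists2 M, core_coef nbj j c s' = (1 - s' i b / s' j c) * M
  & forall x, core_coef nbj j c (fun k l => if (k == i) && (l == b) then x else s' k l) =
     (1 - x / s' j c) * M.
Proof.
move=> nj bi.
exists (\prod_(1 <= l < i.+1 | l != b) (1 - s' i l / s' j c) /
  ((1 - q) * \prod_(1 <= l < j.+1 | l != c) (1 - s' j l / s' j c))).
  rewrite /core_coef nj (bigD1_seq b) ?mem_index_iota ?iota_uniq//=.
  by rewrite -!mulrA.
move=> x; rewrite /core_coef nj (bigD1_seq b) ?mem_index_iota ?iota_uniq//=.
have /negPf ji : j != i by rewrite eq_sym.
rewrite !eqxx ji /= -!mulrA; congr (_ * (_ / (_ * _))).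
by apply: eq_bigr => l /negPf ->.
Qed.

(** Now the coefficients in row i do not see row j. With r = s_{jc}, the combination for b <> b' is,
    up to a factor symmetric in b and b', (q^-1 - 1) x y / (r (x - y)), again antisymmetric. *)
Lemma serre_row_left b b' : nbj = i -> nbi != j -> (0 < b <= i)%N -> (0 < b' <= i)%N ->
  (serre0 b b' - (1 + q^-1) * serre1 b b' + q^-1 * serre2 b b') +
  (serre0 b' b - (1 + q^-1) * serre1 b' b + q^-1 * serre2 b' b) = 0.
Proof.
move=> nj nij bi b'i; rewrite /serre0 /serre1 /serre2.
have ji : j != i by rewrite eq_sym.
have x0 : s i b != 0 by have [] := gi bi.
have y0 : s i b' != 0 by have [] := gi b'i.
have r0 : s j c != 0 by have [] := gj cj.
have cu b1 s' : core_coef nbi i b1 (upd j c s') = core_coef nbi i b1 s'.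
  by rewrite core_coef_upd// eq_sym.
rewrite !(updC i _ j c) !cu.
have [<-|bb] := eqVneq b b'.
  have [M M1 M2] := @core_target_split1 b s nj bi.
  have e1 : core_coef nbj j c (upd i b s) = (1 - q * s i b / s j c) * M.
    rewrite -M2; congr core_coef; apply/funext => k; apply/funext => l; rewrite /upd.
    by case: eqP => [->|]//=; case: eqP => [->|].
  have e2 : core_coef nbj j c (upd i b (upd i b s)) = (1 - q * (q * s i b) / s j c) * M.
    rewrite -M2; congr core_coef; apply/funext => k; apply/funext => l; rewrite /upd.
    by case: eqP => [->|]//=; case: eqP => [->|].
  rewrite e1 e2 M1; move: r0 (core_coef nbi i b s) (core_coef nbi i b _).
  move: (s i b) (s j c) => x r r0 N N'; field.
  by rewrite r0 q0.
have [M M1 M2] := @core_target_split b b' s nj bi b'i bb.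
have [_ /(_ b' b'i)] := gi bi; rewrite eq_sym => /(_ bb)[yx qyx].
have [_ /(_ b bi bb)[xy qxy]] := gi b'i.
have e1 : core_coef nbj j c (upd i b s) = (1 - q * s i b / s j c) * (1 - s i b' / s j c) * M.
  rewrite -M2; congr core_coef; apply/funext => k; apply/funext => l; rewrite /upd.
  by case: eqP => [->|]//=; case: eqP => [->|]//=; case: eqP => [->|].
have e2 : core_coef nbj j c (upd i b' s) = (1 - s i b / s j c) * (1 - q * s i b' / s j c) * M.
  rewrite -M2; congr core_coef; apply/funext => k; apply/funext => l; rewrite /upd.
  case: eqP => [->|]//=; case: (eqVneq l b) => [->|lb] /=; first by rewrite (negPf bb).
  by case: eqP => [->|].
have e3 : core_coef nbj j c (upd i b' (upd i b s)) =
    (1 - q * s i b / s j c) * (1 - q * s i b' / s j c) * M.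
  rewrite -M2; congr core_coef; apply/funext => k; apply/funext => l; rewrite /upd.
  case: (eqVneq k i) => [->|]//=; case: (eqVneq l b) => [->|lb] /=; first by rewrite (negPf bb).
  by case: eqP => [->|].
rewrite [upd i b (upd i b' s)]updC e1 e2 e3 M1.
have bb' : b' != b by rewrite eq_sym.
rewrite !(core_split (b := b) (b' := b') _ b'i bb) !(core_split (b := b') (b' := b) _ bi bb').
rewrite !rest_upd_col//.
rewrite !upd_eq !(upd_col _ _ _ bb) !(upd_col _ _ _ bb').
move: x0 y0 yx qyx xy qxy r0.
move: (rest _ b b' s) (rest _ b' b s) (s i b) (s i b') (s j c).
move=> N N' x y r x0 y0 yx qyx xy qxy r0; field.
by rewrite x0 y0 r0 q0 !subr_eq0 yx xy ![_ == q * _]eq_sym qyx qxy.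
Qed.

End Serre.
End Core.

(* Integer arrays (d_{kl}), not necessarily those of a fixed point: the vector vec
   attached to such an array is 0, and operators are sums over all columns. *)
Definition pattern := nat -> nat -> int.

Definition add_at (p : pattern) (i j : nat) (e : int) : pattern :=
  fun k l => if (k == i) && (l == j) then p k l + e else p k l.

Definition degp (p : pattern) (k : nat) : int := \sum_(1 <= l < k.+1) p k l.

Lemma add_atC p i j e i' j' e' :
  add_at (add_at p i j e) i' j' e' = add_at (add_at p i' j' e') i j e.
Proof.
apply/funext => k; apply/funext => l; rewrite /add_at.
by do 2!case: ifP => //; rewrite addrAC.
Qed.

Lemma add_atK p i j e : add_at (add_at p i j e) i j (- e) = p.
Proof.
by apply/funext => k; apply/funext => l; rewrite /add_at; case: (_ && _); rewrite ?addrK.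
Qed.

Lemma add_at_row p i j e k l : k != i -> add_at p i j e k l = p k l.
Proof. by move=> /negPf ki; rewrite /add_at ki. Qed.

Lemma add_at_col p i j e k l : l != j -> add_at p i j e k l = p k l.
Proof. by move=> /negPf lj; rewrite /add_at lj andbF. Qed.

Lemma add_at_eq p i j e : add_at p i j e i j = p i j + e.
Proof. by rewrite /add_at !eqxx. Qed.

Lemma degp_add_at p i j e k : (0 < j <= i)%N ->
  degp (add_at p i j e) k = degp p k + e * (k == i)%:Z.
Proof.
move=> ji; rewrite /degp; case: eqVneq => [->|ki]; last first.
  by rewrite mulr0 addr0; apply: eq_bigr => l _; rewrite add_at_row.
rewrite (bigD1_seq j) ?mem_index_iota ?iota_uniq//=.
rewrite [in RHS](bigD1_seq j) ?mem_index_iota ?iota_uniq//= add_at_eq mulr1.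
rewrite addrAC; congr (_ + _ + _); apply: eq_bigr => l lj.
by rewrite add_at_col.
Qed.

Lemma div_mul_eq1 (K : fieldType) (a b A B E : K) :
  b != 0 -> B != 0 -> E != 0 -> a * A = E * (b * B) -> a / b * (A * B^-1 * E^-1) = 1.
Proof.
move=> b0 B0 E0 e; transitivity (a * A / (E * (b * B))); first by field; rewrite b0 B0 E0.
by rewrite e divff// !mulf_neq0.
Qed.

(** * Integer arrays and the basis vectors attached to them *)

Section Vectors.
Variables (R : realType) (n : nat).
Hypothesis hn : (2 <= n)%N.
Local Notation F := (scalars R n).
Local Notation M := (Kmod R n).
Local Notation t := (tF R n).
Local Notation v := (vF R n).
Implicit Types (x y : fixpt n) (p : pattern).

Definition pat x : pattern := fun k l => (entry x k l)%:Z.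

Definition valid p : Prop := exists x, pat x = p.

Lemma pat_inj : injective pat.
Proof.
move=> x y xy; apply: entry_inj => k l.
by have := congr1 (fun p => p k l) xy; rewrite /pat => -[].
Qed.

Definition fixpt_of p : option (fixpt n) :=
  if pselect (valid p) is left h then Some (projT1 (cid h)) else None.

Lemma fixpt_of_pat x : fixpt_of (pat x) = Some x.
Proof.
rewrite /fixpt_of; case: pselect => [h|[]]; last by exists x.
by congr Some; apply: pat_inj; case: (cid h).
Qed.

Lemma fixpt_of_invalid p : ~ valid p -> fixpt_of p = None.
Proof. by rewrite /fixpt_of; case: pselect. Qed.

Definition vec p : M := if fixpt_of p is Some x then cls R x else 0.

Lemma vec_pat x : vec (pat x) = cls R x.
Proof. by rewrite /vec fixpt_of_pat. Qed.

Lemma vec_invalid p : ~ valid p -> vec p = 0.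
Proof. by move=> np; rewrite /vec fixpt_of_invalid. Qed.

(** Columns j for which [p j] is not the array of a fixed point may carry any coefficient, because
    their vector is 0; so the sum over a set of fixed points becomes a sum over all columns. *)
Lemma fsum_vec (A : set (fixpt n)) (s : seq nat) (p : nat -> pattern)
    (c : fixpt n -> F) (c' : nat -> F) :
  uniq s -> {in s &, injective p} ->
  (forall x, A x <-> exists2 j, j \in s & pat x = p j) ->
  (forall x j, j \in s -> pat x = p j -> c x = c' j) ->
  \sum_(x \in A) c x *: cls R x = \sum_(j <- s) c' j *: vec (p j).
Proof.
move=> us pinj AP cc'.
pose ok j := isSome (fixpt_of (p j)).
have okP j : ok j -> exists x, fixpt_of (p j) = Some x /\ pat x = p j.
  rewrite /ok /fixpt_of; case: pselect => // h _; case: (cid h) => x px.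
  by exists x.
pose r := pmap (fun j => fixpt_of (p j)) [seq j <- s | ok j].
have rP x : (x \in r) <-> A x.
  rewrite mem_pmap; split.
    move/mapP => [j]; rewrite mem_filter => /andP[/okP[y [-> py]] js] [->].
    by apply/AP; exists j.
  move/AP => [j js pj]; apply/mapP; exists j; last by rewrite -pj fixpt_of_pat.
  by rewrite mem_filter js andbT /ok -pj fixpt_of_pat.
have ur : uniq r.
  apply: (map_uniq (f := Some));
    rewrite -(_ : [seq fixpt_of (p j) | j <- [seq j <- s | ok j]] = map Some r).
    rewrite map_inj_in_uniq ?filter_uniq// => j j'.
    rewrite !mem_filter => /andP[/okP[y [-> py]] js] /andP[/okP[y' [-> py']] js'] [yy].
    by apply: pinj => //; rewrite -py -py' yy.
  rewrite /r; elim: (s) => //= j s' IH; case: ifP => //= okj.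
  by case: (okP _ okj) => y [-> _] /=; rewrite IH.
have -> : A = [set` r]%classic.
  by apply/funext => x; apply/propext; rewrite /= rP.
rewrite -fsbig_seq// /r big_pmap big_filter.
rewrite big_mkcond big_seq [RHS]big_seq; apply: eq_bigr => j js.
case: ifP => [/okP[x [xj px]]|].
  by rewrite /vec xj /= (cc' x j js px).
by rewrite /ok /vec; case: fixpt_of => //; rewrite scaler0.
Qed.

Lemma raises_pat i j x y : (0 < i < n)%N -> (0 < j <= i)%N ->
  raises i j x y <-> pat y = add_at (pat x) i j 1.
Proof.
move=> iN ji; split=> [[_ _ yx]|yx]; last split=> // k l.
  apply/funext => k; apply/funext => l; rewrite /pat /add_at yx.
  by case: ifP; rewrite ?addn0// PoszD.
have := congr1 (fun p => p k l) yx; rewrite /pat /add_at.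
by case: ifP; lia.
Qed.

Lemma raises_pat' i j x y : (0 < i < n)%N -> (0 < j <= i)%N ->
  raises i j x y <-> pat x = add_at (pat y) i j (- 1).
Proof.
move=> iN ji; rewrite raises_pat//; split=> [->|->]; first by rewrite add_atK.
by rewrite -[X in add_at _ _ _ X]opprK add_atK.
Qed.

Lemma add_at_inj p i e j j' : e != 0 -> add_at p i j e = add_at p i j' e -> j = j'.
Proof.
move=> e0 /(congr1 (fun p => p i j)); rewrite add_at_eq /add_at eqxx /=.
by case: eqP => // _ /eqP; rewrite -subr_eq0 addrAC subrr add0r (negPf e0).
Qed.

Lemma valid_of (p : pattern) :
  (forall k l, 0 <= p k l) ->
  (forall k l, ~~ ((0 < l <= k)%N && (k < n)%N) -> p k l = 0) ->
  (forall k l, (0 < l <= k)%N -> (k.+1 < n)%N -> p k.+1 l <= p k l) -> valid p.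
Proof.
move=> p0 pout pmono.
pose d := [ffun kl : 'I_n * 'I_n => absz (p kl.1 kl.2)].
have pm (l k m : nat) : (0 < l <= k)%N -> (k + m < n)%N -> p (k + m)%N l <= p k l.
  elim: m => [|m IH] lk kn; first by rewrite addn0.
  rewrite addnS; apply: le_trans (pmono _ _ _ _) (IH _ _) => //; first by lia.
    by rewrite -addnS.
  by lia.
have wf : fixpt_wf d.
  apply/andP; split.
    apply/forallP => i; apply/forallP => j; apply/implyP => ji; rewrite ffunE /=.
    by rewrite pout// negb_and ji.
  apply/forallP => i; apply/forallP => k; apply/forallP => j; apply/implyP => /andP[jk ki].
  rewrite !ffunE /=; have := pm j k (i - k)%N jk; rewrite subnKC// ltn_ord => /(_ isT).
  by have := p0 i j; have := p0 k j; lia.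
exists (exist _ d wf); apply/funext => k; apply/funext => l; rewrite /pat.
case: (ltnP k n) => kn; last by rewrite entry_ge_n// pout// negb_and -leqNgt kn orbT.
case: (ltnP l n) => ln.
  by rewrite (entryE _ (Ordinal kn) (Ordinal ln)) /= ffunE /=; have := p0 k l; lia.
by rewrite entry_out ?pout//; lia.
Qed.

Lemma raise_valid i j x : (0 < i < n)%N -> (0 < j <= i)%N ->
  ((j < i)%N -> (entry x i j < entry x i.-1 j)%N) ->
  valid (add_at (pat x) i j 1).
Proof.
move=> iN ji lt; apply: valid_of => [k l|k l out|k l lk kn]; rewrite /add_at /pat.
- by case: ifP.
- case: ifP => [/andP[/eqP ki /eqP lj]|_]; first by move: out; rewrite ki lj; lia.
  case: (ltnP k n) => kn; last by rewrite entry_ge_n.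
  by rewrite entry_out//; move: out; rewrite kn andbT.
- have := entry_mono x lk; case: ifP => [/andP[/eqP ki /eqP lj]|_].
    have ki' : (k == i) = false by lia.
    by move: lt; rewrite ki' -ki -lj /=; lia.
  by case: ifP; lia.
Qed.

Lemma lower_valid i j x : (0 < i < n)%N -> (0 < j <= i)%N ->
  (entry x i.+1 j < entry x i j)%N -> valid (add_at (pat x) i j (- 1)).
Proof.
move=> iN ji lt; apply: valid_of => [k l|k l out|k l lk kn]; rewrite /add_at /pat.
- by case: ifP => [/andP[/eqP -> /eqP ->]|]; lia.
- case: ifP => [/andP[/eqP ki /eqP lj]|_]; first by move: out; rewrite ki lj; lia.
  case: (ltnP k n) => kn; last by rewrite entry_ge_n.
  by rewrite entry_out//; move: out; rewrite kn andbT.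
- have := entry_mono x lk; case: ifP => [/andP[/eqP ki /eqP lj]|_].
    have ki' : (k == i) = false by lia.
    by rewrite ki' /=; lia.
  case: ifP => [/andP[/eqP ki /eqP lj]|_]; last by lia.
  by move: lt; rewrite ki lj; lia.
Qed.

Definition pspectral p k l : F := t l ^+ 2 * v ^ (- (2 * p k l)).

Local Notation sp := pspectral.

Lemma sp_neq0 p k l : (0 < l)%N -> sp p k l != 0.
Proof. by move=> l0; rewrite mulf_neq0 ?expf_neq0 ?expfz_neq0 ?tF_neq0 ?vF_neq0. Qed.

Lemma sp_generic p p' k k' l l' e : (0 < l <= n)%N -> (0 < l' <= n)%N ->
  sp p k l = v ^ e * sp p' k' l' -> l = l' /\ 2 * p' k' l' = 2 * p k l + e.
Proof.
move=> ln ln' e1; have l0 : (0 < l')%N by case/andP: ln'.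
have := @generic_weight R n hn l l' (- (2 * p k l) + 2 * p' k' l' - e) ln ln'.
case=> [|-> e0]; last by split=> //; lia.
have v0 := vF_neq0 R n; have t0 := tF_neq0 R hn l0.
have vE : v ^ (- (2 * p k l) + 2 * p' k' l' - e) =
    v ^ (- (2 * p k l)) * (v ^ (- (2 * p' k' l')))^-1 * (v ^ e)^-1.
  by rewrite expfzDr// expfzDr// !invr_expz opprK.
rewrite vE.
have e2 : t l ^+ 2 * v ^ (- (2 * p k l)) = v ^ e * (t l' ^+ 2 * v ^ (- (2 * p' k' l'))) by exact:
  e1.
exact: (div_mul_eq1 (expf_neq0 2 t0) (expfz_neq0 (- (2 * p' k' l')) v0) (expfz_neq0 e v0) e2).
Qed.

End Vectors.

(* up = true: operators raising some d_{ij} by 1; up = false: lowering it. *)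
Definition sgn (up : bool) : int := if up then 1 else -1.

Definition nbr (up : bool) (i : nat) : nat := if up then i.-1 else i.+1.

(* v^(deg_form L i) is the power of v in the i-th operator of a family; below,
   here, above are the coefficients of d_(i-1), d_i, d_(i+1). *)
Record degree_form := DegreeForm
  { below : nat -> int; here : nat -> int; above : nat -> int; const : nat -> int }.

Definition deg_form (L : degree_form) (i : nat) (p : pattern) : int :=
  below L i * degp p i.-1 + here L i * degp p i + above L i * degp p i.+1 + const L i.

Definition deg_incr (L : degree_form) (i k : nat) : int :=
  below L i * (i.-1 == k)%:Z + here L i * (i == k)%:Z + above L i * (i.+1 == k)%:Z.

Lemma deg_form_add_at L i p k l e : (0 < l <= k)%N ->
  deg_form L i (add_at p k l e) = deg_form L i p + e * deg_incr L i k.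
Proof. by move=> lk; rewrite /deg_form /deg_incr !degp_add_at//; ring. Qed.

(** * Families of raising or lowering operators *)

Section Family.
Variables (R : realType) (n : nat).
Hypothesis hn : (2 <= n)%N.
Local Notation F := (scalars R n).
Local Notation M := (Kmod R n).
Local Notation v := (vF R n).
Local Notation q := (vF R n ^+ 2).
Local Notation sp := (@pspectral R n).
Local Notation vec := (@vec R n).
Local Notation valid := (@valid n).
Implicit Types (x y : fixpt n) (p : pattern) (up : bool) (C : nat -> F).

Lemma qF_neq0 : q != 0.
Proof. by rewrite expf_neq0 ?vF_neq0. Qed.

Lemma qF_neq1 : q != 1.
Proof.
apply/eqP => e; have n1 : (0 < 1 <= n)%N by lia.
have := @generic_weight R n hn 1 1 2 n1 n1.
by rewrite divff ?expf_neq0 ?tF_neq0// mul1r -exprnP => /(_ e)[].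
Qed.

Definition ospectral up p : nat -> nat -> F :=
  fun k l => if up then (sp p k l)^-1 else sp p k l.

Lemma sp_add_at p i j e k l : sp (add_at p i j e) k l =
  if (k == i) && (l == j) then v ^ (- (2 * e)) * sp p k l else sp p k l.
Proof.
rewrite /pspectral /add_at; case: ifP => // _.
rewrite mulrCA -expfzDr ?vF_neq0//; congr (_ * _ ^ _); lia.
Qed.

Local Notation sig := ospectral.

Lemma sig_add_at up p i j : sig up (add_at p i j (sgn up)) = upd q i j (sig up p).
Proof.
apply/funext => k; apply/funext => l; rewrite /ospectral /upd sp_add_at.
by case: up; case: ifP => //= _; rewrite ?invfM ?invr_expz exprnP.
Qed.

Lemma sig_generic up p i : (i <= n)%N -> generic_row q i (sig up p).
Proof.
move=> iln b bi; have bn : (0 < b <= n)%N by lia.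
have b0 : (0 < b)%N by lia.
split=> [|l li lb]; first by rewrite /ospectral; case: up; rewrite ?invr_eq0 sp_neq0.
have ln : (0 < l <= n)%N by lia.
have l0 : (0 < l)%N by lia.
have gen a b' c (e : int) : (0 < a <= n)%N -> (0 < c <= n)%N -> a != c ->
    sp p b' a != v ^ e * sp p b' c.
  by move=> an cn /eqP ac; apply/eqP => /(sp_generic hn an cn)[].
rewrite /ospectral; case: up; split; apply/eqP.
- by move/invr_inj => e; have := gen l i b 0 ln bn lb; rewrite expr0z mul1r e eqxx.
- move=> e; have := gen l i b 2 ln bn lb; apply/negP; rewrite negbK; apply/eqP.
  by rewrite -[sp p i b]invrK -e invfM invrK exprnP mulrA divff ?mul1r// expfz_neq0 ?vF_neq0.
- by move=> e; have := gen l i b 0 ln bn lb; rewrite expr0z mul1r e eqxx.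
- move=> e; rewrite eq_sym in lb; have := gen b i l 2 bn ln lb; rewrite -e exprnP eqxx.
  by [].
Qed.

Definition family_coef up C (L : degree_form) i b p : F :=
  C i * v ^ deg_form L i p * sp p i b ^+ up * core_coef q (nbr up i) i b (sig up p).

Lemma core_coef_eq0 (nb i b l : nat) (s : nat -> nat -> F) : (0 < l <= nb)%N ->
  s i b != 0 -> s nb l = s i b -> core_coef q nb i b s = 0.
Proof.
move=> lnb s0 e; rewrite /core_coef (bigD1_seq l) ?mem_index_iota ?iota_uniq//=.
by rewrite e divff// subrr !mul0r.
Qed.

(** If the shifted array is not that of a fixed point, the entry of column b in the neighbouring row
    equals the one in row i, and the factor l = b of the numerator is 1 - 1. *)
Lemma family_coef_valid up C L i b p : (0 < i < n)%N -> (0 < b <= i)%N -> valid p ->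
  family_coef up C L i b p != 0 -> valid (add_at p i b (sgn up)).
Proof.
move=> iN bi [x <-] cf0; have b0 : (0 < b)%N by lia.
have eq_sp k : entry x k b = entry x i b -> sp (pat x) k b = sp (pat x) i b.
  by rewrite /pspectral /pat => ->.
have [lt|ge] := boolP (if up then (b < i)%N ==> (entry x i b < entry x i.-1 b)%N
                       else (entry x i.+1 b < entry x i b)%N).
  case: up lt {cf0} => lt; last exact: lower_valid.
  by apply: raise_valid => // bi'; rewrite bi' in lt.
case/negP: cf0; rewrite /family_coef mulf_eq0; apply/orP; right; apply/eqP.
case: up ge => /= [|ge]; first rewrite negb_imply => /andP[bi' ge].
  apply: (@core_coef_eq0 _ _ _ b); first by rewrite /=; lia.
    by rewrite /ospectral invr_eq0 sp_neq0.
  rewrite /ospectral eq_sp//; have := @entry_mono n x i.-1 b; rewrite prednK; last by lia.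
  by lia.
apply: (@core_coef_eq0 _ _ _ b); first by rewrite /=; lia.
  by rewrite /ospectral sp_neq0.
by rewrite /ospectral /= eq_sp//; have := @entry_mono n x i b; lia.
Qed.

Definition linop (T : M -> M) : Prop := forall a u w, T (a *: u + w) = a *: T u + T w.

Definition family_op up C L (T : nat -> M -> M) : Prop :=
  forall i, (0 < i < n)%N -> linop (T i) /\
    forall x, T i (cls R x) = \sum_(1 <= b < i.+1)
      family_coef up C L i b (pat x) *: vec (add_at (pat x) i b (sgn up)).

Lemma linop0 T : linop T -> T 0 = 0.
Proof. by move=> lT; have := lT (-1) 0 0; rewrite scaler0 addr0 scaleN1r addNr. Qed.

Lemma linopZ T a u : linop T -> T (a *: u) = a *: T u.
Proof. by move=> lT; rewrite -[_ *: u]addr0 lT linop0// addr0. Qed.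

Lemma linopD T u w : linop T -> T (u + w) = T u + T w.
Proof. by move=> lT; have := lT 1 u w; rewrite !scale1r. Qed.

Lemma linop_sum T I (r : seq I) (P : pred I) (f : I -> M) : linop T ->
  T (\sum_(k <- r | P k) f k) = \sum_(k <- r | P k) T (f k).
Proof.
by move=> lT; apply: big_morph => [u w|]; [exact: linopD | exact: linop0].
Qed.

(** The operators kill [vec p] for p invalid, but the formula for their action would continue to
    shift p. The two agree as long as invalid arrays only occur with coefficient 0, an invariant
    kept under composition. *)
Definition live_coef (c : F) p : Prop := c != 0 -> valid p.

Lemma live_coef_mul up C L c i b p : (0 < i < n)%N -> (0 < b <= i)%N ->
  live_coef c p -> live_coef (c * family_coef up C L i b p) (add_at p i b (sgn up)).
Proof.
move=> iN bi cp; rewrite /live_coef mulf_eq0 => /norP[c0].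
by apply: family_coef_valid => //; apply: cp.
Qed.

Lemma family_op_vec up C L T c i p : family_op up C L T -> (0 < i < n)%N ->
  live_coef c p -> c *: T i (vec p) =
  \sum_(1 <= b < i.+1) (c * family_coef up C L i b p) *: vec (add_at p i b (sgn up)).
Proof.
move=> fT iN cp; have [lT Tx] := fT i iN.
have [c0|c0] := eqVneq c 0.
  by rewrite c0 scale0r big1// => b _; rewrite mul0r scale0r.
have [x <-] := cp c0; rewrite vec_pat Tx scaler_sumr.
by apply: eq_bigr => b _; rewrite scalerA.
Qed.

Lemma family_op_sum up C L T (r : seq nat) (c : nat -> F) (p : nat -> pattern) i :
  family_op up C L T -> (0 < i < n)%N ->
  (forall a, a \in r -> live_coef (c a) (p a)) ->
  T i (\sum_(a <- r) c a *: vec (p a)) =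
  \sum_(a <- r) \sum_(1 <= b < i.+1)
     (c a * family_coef up C L i b (p a)) *: vec (add_at (p a) i b (sgn up)).
Proof.
move=> fT iN cp; have [lT _] := fT i iN; rewrite linop_sum//.
by apply: eq_big_seq => a ar; rewrite linopZ// (family_op_vec fT)//; apply: cp.
Qed.

Lemma live_pat x : live_coef 1 (pat x).
Proof. by move=> _; exists x. Qed.

Section TwoOps.
Variables (up up' : bool) (C C' : nat -> F) (L L' : degree_form) (T T' : nat -> M -> M).
Hypotheses (fT : family_op up C L T) (fT' : family_op up' C' L' T').

Lemma family_op2 i j x : (0 < i < n)%N -> (0 < j < n)%N ->
  T' j (T i (cls R x)) = \sum_(1 <= b < i.+1) \sum_(1 <= c < j.+1)
    (family_coef up C L i b (pat x) *
     family_coef up' C' L' j c (add_at (pat x) i b (sgn up))) *: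
    vec (add_at (add_at (pat x) i b (sgn up)) j c (sgn up')).
Proof.
move=> iN jN; have [_ ->] := fT iN; apply: (family_op_sum fT') => // b.
rewrite mem_index_iota => bi; rewrite -[family_coef _ _ _ _ _ _]mul1r.
by apply: live_coef_mul => //; apply: live_pat.
Qed.

End TwoOps.

Lemma family_op3 up up' up'' C C' C'' L L' L'' T T' T'' i j k x :
  family_op up C L T -> family_op up' C' L' T' -> family_op up'' C'' L'' T'' ->
  (0 < i < n)%N -> (0 < j < n)%N -> (0 < k < n)%N ->
  T'' k (T' j (T i (cls R x))) =
  \sum_(1 <= b < i.+1) \sum_(1 <= c < j.+1) \sum_(1 <= d < k.+1)
    (family_coef up C L i b (pat x) *
     family_coef up' C' L' j c (add_at (pat x) i b (sgn up)) *
     family_coef up'' C'' L'' k d (add_at (add_at (pat x) i b (sgn up)) j c (sgn up'))) *: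
    vec (add_at (add_at (add_at (pat x) i b (sgn up)) j c (sgn up')) k d (sgn up'')).
Proof.
move=> fT fT' fT'' iN jN kN; rewrite (family_op2 fT fT')//.
have [lT _] := fT'' k kN; rewrite linop_sum//; apply: eq_big_seq => b.
rewrite mem_index_iota => bi; apply: (family_op_sum fT'') => // c.
rewrite mem_index_iota => ci; apply: live_coef_mul => //.
by rewrite -[family_coef _ _ _ _ _ _]mul1r; apply: live_coef_mul => //; apply: live_pat.
Qed.

Lemma linop_ext (S T : M -> M) : linop S -> linop T ->
  (forall x, S (cls R x) = T (cls R x)) -> forall m, S m = T m.
Proof.
move=> lS lT ST m; rewrite -(freeg_sumE m) !linop_sum//; apply: eq_bigr => z _.
have -> : << coeff z m *g z >> = coeff z m *: cls R z.
  apply/eqP/freeg_eqP => y; rewrite coeffZ /cls !coeffU mul1r. by [].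
by rewrite !linopZ// ST.
Qed.

Lemma linop_linext (f : fixpt n -> M) : linop (linext f).
Proof.
have linB u w : linext f (u - w) = linext f u - linext f w by apply: lift_is_additive.
have lin0 : linext f 0 = 0 by rewrite -{1}(subrr 0) linB subrr.
have linD u w : linext f (u + w) = linext f u + linext f w.
  by rewrite -{1}[w]opprK linB -[- w]sub0r linB lin0 sub0r opprK.
have lin_sum (r : seq (fixpt n)) (h : fixpt n -> M) :
    linext f (\sum_(z <- r) h z) = \sum_(z <- r) linext f (h z).
  by apply: big_morph; [exact: linD | exact: lin0].
have linS a u : linext f (a *: u) = a *: linext f u.
  rewrite -[u in RHS]freeg_sumE -[a *: u]/(fgscale a u) /fgscale !lin_sum scaler_sumr.
  by apply: eq_bigr => z _; rewrite /linext !liftU scalerA.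
by move=> a u w; rewrite -linS linD.
Qed.

Lemma linext_cls (f : fixpt n -> M) x : linext f (cls R x) = f x.
Proof. by rewrite /linext /cls liftU scale1r. Qed.

End Family.

Section CoreSplit.
Variables (K : fieldType) (q : K).

Lemma core_coef_ext nb i b (s s' : nat -> nat -> K) :
  s nb =1 s' nb -> s i =1 s' i -> core_coef q nb i b s = core_coef q nb i b s'.
Proof.
move=> snb si; rewrite /core_coef (eq_bigr (fun l => 1 - s' nb l / s' i b)) => [|l _]; last first.
  by rewrite snb si.
by rewrite [X in _ / (_ * X)](eq_bigr (fun l => 1 - s' i l / s' i b)) => [//|l _]; rewrite !si.
Qed.

(** Mr is fixed before s', so it is the same factor before and after another operator changes the
    entry in column l of the neighbouring row. *)
Lemma core_coef_nbr_split l nb i b (s : nat -> nat -> K) : (0 < l <= nb)%N -> nb != i ->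
  exists Mr, forall s', s' i =1 s i -> (forall l', l' != l -> s' nb l' = s nb l') ->
    core_coef q nb i b s' = (1 - s' nb l / s i b) * Mr.
Proof.
move=> lnb nbi.
exists (\prod_(1 <= l' < nb.+1 | l' != l) (1 - s nb l' / s i b) /
  ((1 - q) * \prod_(1 <= l' < i.+1 | l' != b) (1 - s i l' / s i b))) => s' si sl.
rewrite /core_coef (bigD1_seq l) ?mem_index_iota ?iota_uniq//= si -mulrA.
congr (_ * (_ / (_ * _))); apply: eq_bigr => l' l'l; rewrite ?si ?sl//.
Qed.

Lemma core_coef_self_split l nb i b (s : nat -> nat -> K) : (0 < l <= i)%N -> nb != i -> l != b ->
  exists Mr, forall s', s' nb =1 s nb -> (forall l', l' != l -> s' i l' = s i l') ->
    core_coef q nb i b s' = Mr / (1 - s' i l / s i b).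
Proof.
move=> li nbi lb.
exists (\prod_(1 <= l' < nb.+1) (1 - s nb l' / s i b) /
  ((1 - q) * \prod_(1 <= l' < i.+1 | (l' != b) && (l' != l)) (1 - s i l' / s i b))) => s' snb sl.
have sb : s' i b = s i b by rewrite sl// eq_sym.
have -> : core_coef q nb i b s' = \prod_(1 <= l' < nb.+1) (1 - s nb l' / s i b) /
    ((1 - q) * \prod_(1 <= l' < i.+1 | l' != b) (1 - s' i l' / s i b)).
  by rewrite /core_coef sb; congr (_ / _); apply: eq_bigr => l' _; rewrite snb.
have -> : \prod_(1 <= l' < i.+1 | l' != b) (1 - s' i l' / s i b) = (1 - s' i l / s i b) *
    \prod_(1 <= l' < i.+1 | (l' != b) && (l' != l)) (1 - s i l' / s i b).
  rewrite (@bigD1_seq_cond _ _ _ _ l) ?mem_index_iota ?iota_uniq//; congr (_ * _).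
  by apply: eq_bigr => l' /andP[_ l'l]; rewrite sl.
by rewrite -[RHS]mulrA -invfM [in RHS]mulrC mulrCA [in LHS]mulrC [_ * (1 - _ / _)]mulrC.
Qed.

End CoreSplit.

Lemma antisym_sum (K : fieldType) (V : lmodType K) (s : seq nat) (X : nat -> nat -> K)
    (G : nat -> nat -> V) : (2 : K) != 0 ->
  (forall b b', G b b' = G b' b) ->
  (forall b b', b \in s -> b' \in s -> X b b' + X b' b = 0) ->
  \sum_(b <- s) \sum_(b' <- s) X b b' *: G b b' = 0.
Proof.
move=> two0 Gs XN; set S := (X in X = 0).
have SS : S + S = 0.
  rewrite {2}/S exchange_big -big_split big_seq big1// => b bs.
  rewrite -big_split big_seq big1//= => b' b's.
  by rewrite (Gs b' b) -scalerDl XN// scale0r.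
apply/eqP; have : (2 : K) *: S = 0 by rewrite scaler_nat mulr2n.
by move/eqP; rewrite scaler_eq0 (negPf two0).
Qed.

Section Monomials.
Variables (K : fieldType) (v : K).
Hypothesis v0 : v != 0.
Implicit Types (ci cj a A B D w : K) (e li lj mii mij mji : int).

Lemma mul_factor_far ci w a1 A e : ci * (v ^ e * w) * a1 * A = w * (ci * v ^ e * a1 * A).
Proof. by ring. Qed.

Lemma serre0_weight ci cj a1 a2 a3 A B D e li lj mii mij :
  cj * v ^ lj * a1 * A * (ci * v ^ (li + e * mij) * a2 * B) *
    (ci * v ^ (li + e * mij + e * mii) * a3 * D) =
  cj * ci ^+ 2 * v ^ (lj + 2 * li + e * mii) * (a1 * a2 * a3) * v ^ (e * mij * 2) * (A * B * D).
Proof.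
have -> : e * mij * 2 = e * mij + e * mij by ring.
have -> : 2 * li = li + li by ring.
by rewrite !expfzDr//; ring.
Qed.

Lemma serre1_weight ci cj a1 a2 a3 A B D e li lj mii mij mji :
  ci * v ^ li * a2 * A * (cj * v ^ (lj + e * mji) * a1 * B) *
    (ci * v ^ (li + e * mii + e * mij) * a3 * D) =
  cj * ci ^+ 2 * v ^ (lj + 2 * li + e * mii) * (a1 * a2 * a3) *
    v ^ (e * mij + e * mji) * (A * B * D).
Proof.
have -> : 2 * li = li + li by ring.
by rewrite !expfzDr//; ring.
Qed.

Lemma serre2_weight ci cj a1 a2 a3 A B D e li lj mii mji :
  ci * v ^ li * a2 * A * (ci * v ^ (li + e * mii) * a3 * B) *
    (cj * v ^ (lj + e * mji + e * mji) * a1 * D) =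
  cj * ci ^+ 2 * v ^ (lj + 2 * li + e * mii) * (a1 * a2 * a3) * v ^ (e * mji * 2) * (A * B * D).
Proof.
have -> : e * mji * 2 = e * mji + e * mji by ring.
have -> : 2 * li = li + li by ring.
by rewrite !expfzDr//; ring.
Qed.

(** The powers of v in the three orders of application form a geometric progression W, W y, W y^2,
    so the twist g and the ratio y only matter through their product. *)
Lemma serre_combine (h W y g z S0 S1 S2 S0' S1' S2' : K) :
  (S0 - g * y * z * S1 + (g * y) ^+ 2 * S2) +
  (S0' - g * y * z * S1' + (g * y) ^+ 2 * S2') = 0 ->
  (h * W * S0 - g * z * (h * (W * y) * S1) + g ^+ 2 * (h * (W * y ^+ 2) * S2)) +
  (h * W * S0' - g * z * (h * (W * y) * S1') + g ^+ 2 * (h * (W * y ^+ 2) * S2')) = 0.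
Proof.
move=> SS; transitivity (h * W * ((S0 - g * y * z * S1 + (g * y) ^+ 2 * S2) +
  (S0' - g * y * z * S1' + (g * y) ^+ 2 * S2'))); first by ring.
by rewrite SS mulr0.
Qed.

Lemma scale_comb3 (V : lmodType K) (a b c g g' : K) (u : V) :
  a *: u - g *: (b *: u) + g' *: (c *: u) = (a - g * b + g' * c) *: u.
Proof. by rewrite scalerDl scalerBl !scalerA. Qed.

End Monomials.

Lemma deg_incr_far L i j : (i.+1 < j)%N || (j.+1 < i)%N -> deg_incr L i j = 0.
Proof.
move=> far; rewrite /deg_incr.
have -> : (i.-1 == j) = false by lia.
have -> : (i == j) = false by lia.
by have -> : (i.+1 == j) = false by [lia]; rewrite !mulr0 !addr0.
Qed.

(** * Quadratic and Serre relations within one family *)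

Section Master.
Variables (R : realType) (n : nat).
Hypothesis hn : (2 <= n)%N.
Local Notation F := (scalars R n).
Local Notation M := (Kmod R n).
Local Notation t := (tF R n).
Local Notation v := (vF R n).
Local Notation q := (vF R n ^+ 2).
Local Notation sp := (@pspectral R n).
Local Notation vec := (@vec R n).
Local Notation sig := (@ospectral R n).
Local Notation valid := (@valid n).
Local Notation fcoef := (@family_coef R n).
Implicit Types (x y : fixpt n) (p : pattern) (up : bool) (C : nat -> F) (L : degree_form).

Lemma two_neq0 : (2 : F) != 0.
Proof. exact: (natF_neq0 R n 1). Qed.

Lemma sig_row up p j c e k : k != j -> sig up (add_at p j c e) k =1 sig up p k.
Proof. by move=> /negPf kj l; rewrite /ospectral sp_add_at// kj. Qed.

Lemma family_coef_far up C L i b p j c e : j != i -> j != nbr up i -> (0 < c <= j)%N ->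
  fcoef up C L i b (add_at p j c e) = v ^ (e * deg_incr L i j) * fcoef up C L i b p.
Proof.
move=> ji jn cj; rewrite /family_coef deg_form_add_at// expfzDr ?vF_neq0//.
rewrite sp_add_at//; have /negPf -> : i != j by rewrite eq_sym.
rewrite (@core_coef_ext _ _ _ _ _ _ (sig up p)) => [|l|l]; first exact: mul_factor_far.
  by rewrite sig_row// eq_sym.
by rewrite sig_row// eq_sym.
Qed.

Lemma linop_comp (S T : M -> M) : linop S -> linop T -> linop (fun m => S (T m)).
Proof. by move=> lS lT a u w; rewrite lT lS. Qed.

Lemma linopD2 (S T : M -> M) : linop S -> linop T -> linop (fun m => S m + T m).
Proof. by move=> lS lT a u w; rewrite lT lS scalerDr addrACA. Qed.

Lemma linopZ2 (S : M -> M) (c : F) : linop S -> linop (fun m => c *: S m).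
Proof. by move=> lS a u w; rewrite lS scalerDr !scalerA mulrC. Qed.

Lemma linop_zero : linop (fun _ : M => 0 : M).
Proof. by move=> a u w; rewrite scaler0 addr0. Qed.

Lemma linopB2 (S T : M -> M) : linop S -> linop T -> linop (fun m => S m - T m).
Proof.
move=> lS lT a u w; rewrite lT lS opprD scalerBr addrACA //.
Qed.

Lemma family_comm up C L T i j : family_op up C L T ->
  (0 < i < n)%N -> (0 < j < n)%N -> (i.+1 < j)%N || (j.+1 < i)%N ->
  forall m, T i (T j m) - T j (T i m) = 0.
Proof.
move=> fT iN jN far m; apply/eqP; rewrite subr_eq0; apply/eqP; move: m.
have [lTi _] := fT i iN; have [lTj _] := fT j jN.
apply: linop_ext; [exact: linop_comp | exact: linop_comp | move=> x].
rewrite !(family_op2 hn fT fT)// exchange_big; apply: eq_big_seq => b; rewrite mem_index_iota => bi.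
apply: eq_big_seq => c; rewrite mem_index_iota => cj; rewrite add_atC; congr (_ *: _).
have i1 : (i != j) && (i != nbr up j) by rewrite /nbr; case: (up); lia.
have j1 : (j != i) && (j != nbr up i) by rewrite /nbr; case: (up); lia.
case/andP: i1 => i1 i2; case/andP: j1 => j1 j2.
have d1 := deg_incr_far L far; rewrite orbC in far; have d2 := deg_incr_far L far.
by rewrite !family_coef_far// d1 d2 mulr0 expr0z !mul1r mulrC.
Qed.

(** The condition on g makes the product of twist and ratio equal to v or v^-1; multiplied by v +
    v^-1 it becomes 1 + q or 1 + q^-1, as in [serre_row_right] and [serre_row_left] respectively. *)
Lemma family_serre up C L T i j (g : F) : family_op up C L T ->
  (0 < i < n)%N -> (0 < j < n)%N -> (i == j.+1) || (j == i.+1) ->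
  g * v ^ (sgn up * (deg_incr L j i - deg_incr L i j)) =
    (if nbr up i == j then v else v^-1) ->
  forall m, T i (T i (T j m)) - (g * (v + v^-1)) *: T i (T j (T i m))
            + g ^+ 2 *: T j (T i (T i m)) = 0.
Proof.
move=> fT iN jN adj gE.
have [lTi _] := fT i iN; have [lTj _] := fT j jN.
apply: linop_ext; [|exact: linop_zero|move=> x].
  exact: (linopD2 (linopB2 (linop_comp lTi (linop_comp lTi lTj))
    (linopZ2 _ (linop_comp lTi (linop_comp lTj lTi))))
    (linopZ2 _ (linop_comp lTj (linop_comp lTi lTi)))).
rewrite !(family_op3 hn x fT fT fT)//; set p := pat x.
set e := sgn up.
(* The column c of row j is moved outermost in all three terms; what remains is a double sum over
   the columns b, b' of row i whose vector is symmetric in them. *)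
rewrite [X in _ - _ *: X]exchange_big /=.
under [X in _ + _ *: X]eq_bigr => b _ do rewrite exchange_big.
rewrite [X in _ + _ *: X]exchange_big /=.
rewrite !scaler_sumr -sumrB -big_split big_seq big1//= => c; rewrite mem_index_iota => cj.
rewrite !scaler_sumr -sumrB -big_split /=.
pose G b b' := vec (add_at (add_at (add_at p j c e) i b e) i b' e).
pose X b b' := fcoef up C L j c p * fcoef up C L i b (add_at p j c e) *
    fcoef up C L i b' (add_at (add_at p j c e) i b e)
  - g * (v + v^-1) * (fcoef up C L i b p * fcoef up C L j c (add_at p i b e) *
      fcoef up C L i b' (add_at (add_at p i b e) j c e))
  + g ^+ 2 * (fcoef up C L i b p * fcoef up C L i b' (add_at p i b e) *
      fcoef up C L j c (add_at (add_at p i b e) i b' e)).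
transitivity (\sum_(1 <= b < i.+1) \sum_(1 <= b' < i.+1) X b b' *: G b b').
  apply: eq_bigr => b _; rewrite !scaler_sumr -sumrB -big_split /=; apply: eq_bigr => b' _.
  have e1 : add_at (add_at (add_at p i b e) j c e) i b' e =
      add_at (add_at (add_at p j c e) i b e) i b' e by rewrite (add_atC p j c).
  have e2 : add_at (add_at (add_at p i b e) i b' e) j c e =
      add_at (add_at (add_at p j c e) i b e) i b' e by rewrite -e1 (add_atC _ j c).
  rewrite e1 e2; exact: scale_comb3.
apply: antisym_sum => [||b b']; first exact: two_neq0.
  by move=> b b'; rewrite /G (add_atC _ i b).
rewrite !mem_index_iota => bi b'i.
have ij : i != j by lia.
have ji : j != i by lia.
have v0 := vF_neq0 R n.
pose s := sig up p.
pose H b b' := C j * C i ^+ 2 * v ^ (deg_form L j p + 2 * deg_form L i p + e * deg_incr L i i) *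
   (sp p j c * sp p i b * sp (add_at p i b e) i b') ^+ up.
have spj k b1 : sp (add_at k i b1 e) j c = sp k j c.
  by rewrite sp_add_at// (negPf ji).
have spi k b1 : sp (add_at k j c e) i b1 = sp k i b1.
  by rewrite sp_add_at// (negPf ij).
have Hs : H b b' = H b' b.
  rewrite /H; congr (_ * _ ^+ _); rewrite !sp_add_at// eqxx /=.
  by case: (eqVneq b b') => [->//|bb]; rewrite [LHS]mulrAC.
have X0 a a' : (0 < a < i.+1)%N -> (0 < a' < i.+1)%N ->
   fcoef up C L j c p * fcoef up C L i a (add_at p j c e) *
    fcoef up C L i a' (add_at (add_at p j c e) i a e) =
   H a a' * v ^ (e * deg_incr L i j * 2) * serre0 q i j (nbr up i) (nbr up j) s c a a'.
  move=> ai a'i; rewrite /family_coef /serre0 /H !deg_form_add_at// !sig_add_at// -/s !spi.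
  have -> : sp (add_at (add_at p j c e) i a e) i a' = sp (add_at p i a e) i a'.
    by rewrite add_atC spi.
  rewrite !exprMn; exact: serre0_weight.
have X1 a a' : (0 < a < i.+1)%N -> (0 < a' < i.+1)%N ->
   fcoef up C L i a p * fcoef up C L j c (add_at p i a e) *
      fcoef up C L i a' (add_at (add_at p i a e) j c e) =
   H a a' * v ^ (e * deg_incr L i j + e * deg_incr L j i) * serre1 q i j (nbr up i) (nbr up j) s
     c a a'.
  move=> ai a'i; rewrite /family_coef /serre1 /H !deg_form_add_at// !sig_add_at// -/s !spi !spj.
  rewrite !exprMn; exact: serre1_weight.
have X2 a a' : (0 < a < i.+1)%N -> (0 < a' < i.+1)%N ->
   fcoef up C L i a p * fcoef up C L i a' (add_at p i a e) *
      fcoef up C L j c (add_at (add_at p i a e) i a' e) =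
   H a a' * v ^ (e * deg_incr L j i * 2) * serre2 q i j (nbr up i) (nbr up j) s c a a'.
  move=> ai a'i; rewrite /family_coef /serre2 /H !deg_form_add_at// !sig_add_at// -/s !spj.
  rewrite !exprMn; exact: serre2_weight.
rewrite /X (X0 b b' bi b'i) (X0 b' b b'i bi) (X1 b b' bi b'i) (X1 b' b b'i bi).
rewrite (X2 b b' bi b'i) (X2 b' b b'i bi) -Hs.
pose y := v ^ (e * (deg_incr L j i - deg_incr L i j)).
have y1 : v ^ (e * deg_incr L i j + e * deg_incr L j i) = v ^ (e * deg_incr L i j * 2) * y.
  by rewrite /y -expfzDr//; congr (_ ^ _); ring.
have y2 : v ^ (e * deg_incr L j i * 2) = v ^ (e * deg_incr L i j * 2) * y ^+ 2.
  by rewrite /y exprnP exprz_exp -expfzDr//; congr (_ ^ _); ring.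
rewrite y1 y2; set W := v ^ (e * deg_incr L i j * 2).
have {}gE : g * y = (if nbr up i == j then v else v^-1) by [].
have gs := @sig_generic R n hn up p.
have gi : generic_row q i s by apply: gs; lia.
have gj : generic_row q j s by apply: gs; lia.
set S0 := serre0 _ _ _ _ _ _ _; set S1 := serre1 _ _ _ _ _ _ _; set S2 := serre2 _ _ _ _ _ _ _.
apply: serre_combine.
have ni : nbr up i != i by rewrite /nbr; case: (up); lia.
have nj : nbr up j != j by rewrite /nbr; case: (up); lia.
rewrite gE; case: eqP => nij.
  have -> : v * (v + v^-1) = 1 + q by rewrite mulrDr divff// addrC expr2.
  have nji : nbr up j != i by move: nij; rewrite /nbr; case: (up); lia.
  exact: (serre_row_right (qF_neq0 R n) ij ni gi cj nij nji bi b'i).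
have -> : v^-1 * (v + v^-1) = 1 + q^-1 by rewrite mulrDr mulVf// -invfM -expr2.
have nji : nbr up j = i by move: nij adj; rewrite /nbr; case: (up); lia.
move/eqP: nij => nij; rewrite exprVn.
exact: (serre_row_left (qF_neq0 R n) ij ni gi gj cj nji nij bi b'i).
Qed.

End Master.

(** * Commutators of raising and lowering operators *)

Section CommuteMonomials.
Variables (K : fieldType) (v : K).
Hypothesis v0 : v != 0.

Lemma shift_ratio (a s s' : K) : (a * s)^-1 / s'^-1 = a^-1 * s' / s.
Proof. by rewrite invrK invfM; ring. Qed.

Lemma commute_far (A B : K) (m m' : int) :
  A * (v ^ (-1 * m) * B) = v ^ (- m - m') * (B * (v ^ (1 * m') * A)).
Proof.
have -> : -1 * m = (- m - m') + m' by ring.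
by rewrite mul1r expfzDr//; ring.
Qed.

Lemma commute_near (ci cj s a b f f' g : K) (li lj m m' : int) :
  cj * v ^ lj * 1 * ((1 - a) * f) * (ci * v ^ (li + -1 * m) * s * ((1 - b) * f')) =
  v ^ (- m - m') * (ci * v ^ li * s * ((1 - a) * f') *
    (cj * v ^ (lj + 1 * m') * 1 * ((1 - b) * f))).
Proof.
have -> : li + -1 * m = li + m' + (- m - m') by ring.
by rewrite mul1r !expfzDr//; ring.
Qed.

Lemma off_diagonal (ci cj s f f' a b : K) (li lj m m' : int) : m + m' = 0 ->
  cj * v ^ lj * 1 * (f / a) * (ci * v ^ (li + -1 * m) * s * (f' / b)) =
  ci * v ^ li * s * (f' / a) * (cj * v ^ (lj + 1 * m') * 1 * (f / b)).
Proof.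
move=> mm; have -> : -1 * m = m' by rewrite mulN1r; apply/eqP;
  rewrite eq_sym -subr_eq0 opprK addrC mm.
by rewrite mul1r !expfzDr//; ring.
Qed.

Lemma diagonal_terms (ci cj s s' f f' g g' : K) (li lj m m' : int) : m + m' = 0 ->
  cj * v ^ lj * 1 * f * (ci * v ^ (li + -1 * m) * s * f') -
  ci * v ^ li * s' * g' * (cj * v ^ (lj + 1 * m') * 1 * g) =
  ci * cj * v ^ (li + lj - m) * (f * (s * f') - (s' * g') * g).
Proof.
move=> mm; have -> : m' = - m by apply/eqP; rewrite -subr_eq0 opprK addrC mm.
by rewrite mulN1r mul1r !expfzDr//; ring.
Qed.

(* a, b, c stand for v^(d_i), v^(d_(i-1)), v^(d_(i+1)) and t, t' for t_i, t_(i+1). *)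
Lemma cartan_identity (t t' a b c : K) : t != 0 -> t' != 0 -> a != 0 -> b != 0 -> c != 0 ->
  v ^+ 2 != 1 ->
  - (t'^-1 * t^-1 * (c / b)) *
    ((v ^+ 2 * (t' ^+ 2 * (a ^+ 2 / c ^+ 2)) - t ^+ 2 * (b ^+ 2 / a ^+ 2)) / (1 - v ^+ 2)) =
  (v - v^-1)^-1 * (t' / t * (a ^+ 2 / b / c * v) - (t' / t * (a ^+ 2 / b / c * v))^-1).
Proof.
move=> t0 t'0 a0 b0 c0 v1; field.
have v1' : 1 - v ^+ 2 != 0 by rewrite subr_eq0 eq_sym.
have v1'' : v ^+ 2 - 1 != 0 by rewrite subr_eq0.
have v1''' : v * v - 1 != 0 by rewrite -expr2 subr_eq0.
have v1'''' : 1 - v * v != 0 by rewrite -expr2 subr_eq0 eq_sym.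
by rewrite ?t0 ?t'0 ?a0 ?b0 ?c0 ?v0 ?v1' ?v1'' ?v1''' ?v1''''.
Qed.

End CommuteMonomials.

Section Commutator.
Variables (R : realType) (n : nat).
Hypothesis hn : (2 <= n)%N.
Local Notation F := (scalars R n).
Local Notation M := (Kmod R n).
Local Notation t := (tF R n).
Local Notation v := (vF R n).
Local Notation q := (vF R n ^+ 2).
Local Notation sp := (@pspectral R n).
Local Notation vec := (@vec R n).
Local Notation sig := (@ospectral R n).
Local Notation fcoef := (@family_coef R n).
Implicit Types (x y : fixpt n) (p : pattern).

Variables (C C' : nat -> F) (L L' : degree_form) (T S : nat -> M -> M).
Hypotheses (fT : family_op true C L T) (fS : family_op false C' L' S).

Lemma sp_lower p i b l : sp (add_at p i b (-1)) i l = if l == b then q * sp p i l else sp p i l.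
Proof. by rewrite sp_add_at// eqxx /=; case: eqP => // _; rewrite mulrN1 opprK exprnP. Qed.

Lemma sp_raise p i b l : sp (add_at p i b 1) i l = if l == b then q^-1 * sp p i l else sp p i l.
Proof. by rewrite sp_add_at// eqxx /=; case: eqP => // _; rewrite mulr1 invr_expz exprnP. Qed.

(** Raising in row i sees row i-1 and lowering in row j sees row j+1, so they interact only for i =
    j+1. Then both coefficients contain 1 - s_{ic} / s_{jb}, and after the other operator has acted
    both contain 1 - s_{ic} / (q s_{jb}): the products agree up to a power of v. *)
Lemma family_commute_coef i j b c p : (0 < i < n)%N -> (0 < j < n)%N -> i != j ->
  (0 < b <= j)%N -> (0 < c <= i)%N ->
  fcoef false C' L' j b p * fcoef true C L i c (add_at p j b (-1)) =
  v ^ (- deg_incr L i j - deg_incr L' j i) *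
    (fcoef true C L i c p * fcoef false C' L' j b (add_at p i c 1)).
Proof.
move=> iN jN ij bj ci; have ji : j != i by rewrite eq_sym.
have v0 := vF_neq0 R n.
have [near|far] := eqVneq j i.-1; last first.
  rewrite family_coef_far// [fcoef false C' L' j b (add_at _ _ _ _)]family_coef_far//; last first.
    by rewrite /=; move: far; lia.
  exact: commute_far.
have iE : i = j.+1 by lia.
have bi : (0 < b <= i.-1)%N by rewrite -near.
have nbi : i.-1 != i by lia.
have [Mt Mt1] := @core_coef_nbr_split F q b i.-1 i c (sig true p) bi nbi.
have cj : (0 < c <= j.+1)%N by rewrite -iE.
have nbj : j.+1 != j by lia.
have [Ms Ms1] := @core_coef_nbr_split F q c j.+1 j b (sig false p) cj nbj.
have b0 : (0 < b)%N by lia.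
have c0 : (0 < c)%N by lia.
rewrite /family_coef !deg_form_add_at// expr0.
rewrite (sp_add_at R hn p j) (negPf ij) /=.
rewrite (Mt1 (sig true p))// (Ms1 (sig false p))//.
rewrite (Mt1 (sig true (add_at p j b (-1)))); first last.
- by move=> l' l'b; rewrite /ospectral sp_add_at// (negPf l'b) andbF.
- exact: sig_row.
rewrite (Ms1 (sig false (add_at p i c 1))); first last.
- by move=> l' l'b; rewrite /ospectral sp_add_at// (negPf l'b) andbF.
- exact: sig_row.
have e1 : sig true p i.-1 b / sig true p i c = sig false p j.+1 c / sig false p j b.
  by rewrite /ospectral -near -iE invrK mulrC.
have e2 : sig true (add_at p j b (-1)) i.-1 b / sig true p i c =
    sig false (add_at p i c 1) j.+1 c / sig false p j b.
  rewrite /ospectral -near -iE sp_lower sp_raise !eqxx; exact: shift_ratio.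
rewrite e1 e2; exact: commute_near.
Qed.

Lemma family_commute i j : (0 < i < n)%N -> (0 < j < n)%N -> i != j ->
  forall m, T i (S j m) - v ^ (- deg_incr L i j - deg_incr L' j i) *: S j (T i m) = 0.
Proof.
move=> iN jN ij m; apply/eqP; rewrite subr_eq0; apply/eqP; move: m.
have [lT _] := fT iN; have [lS _] := fS jN.
apply: linop_ext => [||x].
- exact: (linop_comp lT lS).
- exact: (linopZ2 _ (linop_comp lS lT)).
rewrite (family_op2 hn fS fT)// (family_op2 hn fT fS)// exchange_big scaler_sumr.
apply: eq_big_seq => c; rewrite mem_index_iota => ci; rewrite scaler_sumr.
apply: eq_big_seq => b; rewrite mem_index_iota => bj.
by rewrite scalerA add_atC family_commute_coef.
Qed.

(** The same coincidence inside row i, with the common factor now in the denominators; the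
    hypothesis on [deg_incr] cancels the powers of v. *)
Lemma off_diagonal_coef i b c p : (0 < i < n)%N -> deg_incr L i i + deg_incr L' i i = 0 ->
  (0 < b <= i)%N -> (0 < c <= i)%N -> b != c ->
  fcoef false C' L' i b p * fcoef true C L i c (add_at p i b (-1)) =
  fcoef true C L i c p * fcoef false C' L' i b (add_at p i c 1).
Proof.
move=> iN LL bi ci bc; have v0 := vF_neq0 R n; have cb : c != b by rewrite eq_sym.
have nbi : i.-1 != i by lia.
have nbi' : i.+1 != i by lia.
have [Mt Mt1] := @core_coef_self_split F q b i.-1 i c (sig true p) bi nbi bc.
have [Ms Ms1] := @core_coef_self_split F q c i.+1 i b (sig false p) ci nbi' cb.
rewrite /family_coef !deg_form_add_at// expr0 sp_lower (negPf cb).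
rewrite (Mt1 (sig true p))// (Ms1 (sig false p))//.
rewrite (Mt1 (sig true (add_at p i b (-1)))); first last.
- by move=> l' l'b; rewrite /ospectral sp_lower (negPf l'b).
- exact: sig_row.
rewrite (Ms1 (sig false (add_at p i c 1))); first last.
- by move=> l' l'b; rewrite /ospectral sp_raise (negPf l'b).
- exact: sig_row.
have e1 : sig true p i b / sig true p i c = sig false p i c / sig false p i b.
  by rewrite /ospectral invrK mulrC.
have e2 : sig true (add_at p i b (-1)) i b / sig true p i c =
    sig false (add_at p i c 1) i c / sig false p i b.
  rewrite /ospectral sp_lower sp_raise !eqxx; exact: shift_ratio.
rewrite e1 e2; exact: off_diagonal.
Qed.

End Commutator.

Section CommutatorMonomials.
Variable (K : fieldType).

Lemma core_coefs_mul (A A' B B' s q : K) :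
  A / ((1 - q) * B) * (s * (A' / ((1 - q) * B'))) = A * A' * s / ((1 - q) ^+ 2 * (B * B')).
Proof. by rewrite expr2 !invfM; ring. Qed.

Lemma core_coefs_mul' (A A' B B' s q : K) :
  s * (A' / ((1 - q) * B')) * (A / ((1 - q) * B)) = A * A' * s / ((1 - q) ^+ 2 * (B * B')).
Proof. by rewrite expr2 !invfM; ring. Qed.

Lemma inv_ratio (a b : K) : a^-1 / b^-1 = b / a.
Proof. by rewrite invrK mulrC. Qed.

Lemma ratio_shift (q a b : K) : a / (q^-1 * b) = q * a / b.
Proof. by rewrite invfM invrK; ring. Qed.

Lemma prod_ratio (P t v : K) (m m' : int) : P != 0 -> v != 0 ->
  (P * t) ^+ 2 * v ^ (- (2 * m')) / (P ^+ 2 * v ^ (- (2 * m))) =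
  t ^+ 2 * ((v ^ m) ^+ 2 / (v ^ m') ^+ 2).
Proof.
move=> P0 v0; have e k : v ^ (- (2 * k)) = ((v ^ k) ^+ 2)^-1.
  by rewrite [(_ ^ k) ^+ 2]exprnP exprz_exp invr_expz mulrC.
rewrite !e; field.
by rewrite ?P0 ?(expfz_neq0 _ v0).
Qed.

Lemma cartan_exponent (v : K) (a b c : int) : v != 0 ->
  v ^ (2 * a - b - c + 1) = (v ^ a) ^+ 2 / v ^ b / v ^ c * v.
Proof.
move=> v0; rewrite [(_ ^ a) ^+ 2]exprnP exprz_exp !invr_expz -[v in RHS]expr1z.
by rewrite -!expfzDr//; congr (_ ^ _); ring.
Qed.

End CommutatorMonomials.

Section CartanCommutator.
Variables (R : realType) (n : nat).
Hypothesis hn : (2 <= n)%N.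
Local Notation F := (scalars R n).
Local Notation M := (Kmod R n).
Local Notation t := (tF R n).
Local Notation v := (vF R n).
Local Notation q := (vF R n ^+ 2).
Local Notation sp := (@pspectral R n).
Local Notation vec := (@vec R n).
Local Notation sig := (@ospectral R n).
Local Notation fcoef := (@family_coef R n).
Implicit Types (x y : fixpt n) (p : pattern).

Lemma degp_pat x k : degp (pat x) k = (degree x k)%:Z.
Proof. by rewrite /degp /degree /pat -natz natr_sum; apply: eq_bigr => l _; rewrite natz. Qed.

Lemma linop_diagop c : linop (@diagop R n c).
Proof. exact: linop_linext. Qed.

Lemma diagop_cls c x : diagop c (cls R x) = c (degree x) *: cls R x.
Proof. exact: linext_cls. Qed.

Lemma prod_sp p k : \prod_(1 <= l < k.+1) sp p k l =
  (\prod_(1 <= l < k.+1) t l) ^+ 2 * v ^ (- (2 * degp p k)).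
Proof.
rewrite /pspectral big_split prodrXl; congr (_ * _).
rewrite /degp mulr_sumr -sumrN.
elim/big_rec2: _ => [|l a b _ ->]; first by rewrite expr0z.
by rewrite expfzDr ?vF_neq0.
Qed.

(** The sum of the diagonal terms involves only such ratios of row products, hence only degrees;
    this is why the commutator is a scalar on each M_d. *)
Lemma prod_sp_ratio p k :
  \prod_(1 <= l < k.+2) sp p k.+1 l / \prod_(1 <= l < k.+1) sp p k l =
  t k.+1 ^+ 2 * ((v ^ degp p k) ^+ 2 / (v ^ degp p k.+1) ^+ 2).
Proof.
rewrite !prod_sp big_nat_recr//=; apply: prod_ratio; last exact: vF_neq0.
rewrite prodf_seq_neq0; apply/allP => l; rewrite mem_index_iota => /andP[l0 _].
exact: tF_neq0.
Qed.

Variables (C C' : nat -> F) (L L' : degree_form) (T S : nat -> M -> M).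
Hypotheses (fT : family_op true C L T) (fS : family_op false C' L' S).

Section Row.
Variable i : nat.
Hypothesis iN : (0 < i < n)%N.
Hypothesis LL : deg_incr L i i + deg_incr L' i i = 0.
(** The product of the two prefactors, where the lowering operator acts first; this monomial is the
    one that turns the interpolation sum into (K - K^-1) / (v - v^-1). *)
Hypothesis scalar : forall p,
  C i * C' i * v ^ (deg_form L i p + deg_form L' i p - deg_incr L i i) =
  - ((t i.+1)^-1 * (t i)^-1 * (v ^ degp p i.+1 / v ^ degp p i.-1)).

Local Notation I := (index_iota 1 i.+1).
Local Notation J := (index_iota 1 i.+2).
Local Notation J' := (index_iota 1 i).

Lemma diagonal_coef b p : (0 < b <= i)%N ->
  fcoef false C' L' i b p * fcoef true C L i b (add_at p i b (-1)) -
  fcoef true C L i b p * fcoef false C' L' i b (add_at p i b 1) =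
  C i * C' i * v ^ (deg_form L i p + deg_form L' i p - deg_incr L i i) *
  (lower_raise q I J J' (sp p i) (sp p i.+1) (sp p i.-1) b -
   raise_lower q I J J' (sp p i) (sp p i.+1) (sp p i.-1) b).
Proof.
move=> bi; have v0 := vF_neq0 R n.
have i1 : (i.+1 == i) = false by lia.
have i2 : (i.-1 == i) = false by lia.
rewrite /family_coef !deg_form_add_at// expr0 !expr1 sp_lower// eqxx.
rewrite (diagonal_terms v0 _ _ _ _ _ _ _ _ _ _ LL); congr (_ * (_ - _)).
  rewrite /core_coef core_coefs_mul /lower_raise prednK; last by lia.
  rewrite /ospectral sp_lower// eqxx.
  congr (_ * _ * _ / (_ * (_ * _))); apply: eq_bigr => l.
    by rewrite inv_ratio sp_add_at// i2.
  by move=> lb; rewrite inv_ratio sp_lower// (negPf lb).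
rewrite /core_coef core_coefs_mul' /raise_lower prednK; last by lia.
rewrite /ospectral sp_raise// eqxx.
congr (_ * _ * _ / (_ * (_ * _))); apply: eq_bigr => l.
- by rewrite ratio_shift sp_add_at// i1.
- by rewrite inv_ratio.
- by move=> lb; rewrite ratio_shift sp_raise// (negPf lb).
- by rewrite inv_ratio.
Qed.

Lemma residue_sum_sp p :
  \sum_(1 <= b < i.+1)
    (lower_raise q I J J' (sp p i) (sp p i.+1) (sp p i.-1) b -
     raise_lower q I J J' (sp p i) (sp p i.+1) (sp p i.-1) b) =
  (q * (t i.+1 ^+ 2 * ((v ^ degp p i) ^+ 2 / (v ^ degp p i.+1) ^+ 2)) -
   t i ^+ 2 * ((v ^ degp p i.-1) ^+ 2 / (v ^ degp p i) ^+ 2)) / (1 - q).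
Proof.
have i0 : (0 < i)%N by case/andP: iN.
have uI : uniq I by exact: iota_uniq.
have sJ : size J = (size I).+1 by rewrite !size_iota !subSS !subn0.
have sJ' : size I = (size J').+1 by rewrite !size_iota subSS subn0 subn1 prednK.
have s0 l : l \in I -> sp p i l != 0.
  by rewrite mem_index_iota => /andP[l0 _]; apply: sp_neq0.
have r0 l : l \in J' -> sp p i.-1 l != 0.
  by rewrite mem_index_iota => /andP[l0 _]; apply: sp_neq0.
have gen b l : b \in I -> l \in I -> b != l ->
    sp p i b != sp p i l /\ q * sp p i b != sp p i l.
  rewrite !mem_index_iota => bi li /eqP bl.
  have bn : (0 < b <= n)%N by lia.
  have ln : (0 < l <= n)%N by lia.
  split; apply/eqP => e.
    by have := @sp_generic R n hn p p i i b l 0 bn ln; rewrite expr0z mul1r => /(_ e)[].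
  by have := @sp_generic R n hn p p i i l b 2 ln bn (esym e) => -[/esym].
rewrite (residue_sum (sp p i.+1) uI (qF_neq0 R n) (qF_neq1 R hn) sJ sJ' s0 r0 gen).
have := prod_sp_ratio p i.-1; rewrite (prednK i0) => ->.
by rewrite prod_sp_ratio.
Qed.

Lemma family_commutator m :
  T i (S i m) - S i (T i m) = (v - v^-1)^-1 *: (K_op i m - Kinv_op i m).
Proof.
have [lT _] := fT iN; have [lS _] := fS iN.
move: m; apply: linop_ext => [||x].
- exact: (linopB2 (linop_comp lT lS) (linop_comp lS lT)).
- exact: (linopZ2 _ (linopB2 (linop_diagop _) (linop_diagop _))).
rewrite /K_op /Kinv_op !diagop_cls -scalerBl scalerA.
rewrite (family_op2 hn fS fT)// (family_op2 hn fT fS)// [X in _ - X]exchange_big -sumrB.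
transitivity ((\sum_(1 <= b < i.+1)
    (C i * C' i * v ^ (deg_form L i (pat x) + deg_form L' i (pat x) - deg_incr L i i) *
     (lower_raise q I J J' (sp (pat x) i) (sp (pat x) i.+1) (sp (pat x) i.-1) b -
      raise_lower q I J J' (sp (pat x) i) (sp (pat x) i.+1) (sp (pat x) i.-1) b)))
   *: cls R x).
  rewrite scaler_suml; apply: eq_big_seq => b; rewrite mem_index_iota => bi.
  (* Only c = b returns to the array of x; for the other c the two orders cancel. *)
  rewrite -sumrB (bigD1_seq b) ?mem_index_iota ?iota_uniq//= big_seq_cond big1 => [|c].
    rewrite addr0 add_atK -{2}[1]opprK add_atK vec_pat -scalerBl.
    by rewrite diagonal_coef.
  rewrite mem_index_iota => /andP[ci cb].
  by rewrite add_atC (off_diagonal_coef hn C C' _ iN LL)// 1?eq_sym// subrr.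
rewrite -mulr_sumr residue_sum_sp scalar /K_scalar !degp_pat.
have tn0 := @tF_neq0 R n hn; have v0 := vF_neq0 R n.
congr (_ *: _); rewrite cartan_exponent//.
have i0 : (0 < i)%N by case/andP: iN.
exact: (cartan_identity v0 (tn0 _ i0) (tn0 _ (ltn0Sn i)) (expfz_neq0 (degree x i) v0)
  (expfz_neq0 (degree x i.-1) v0) (expfz_neq0 (degree x i.+1) v0) (qF_neq1 R hn)).
Qed.

End Row.
End CartanCommutator.

(** * The operators of the theorem *)

Section Instances.
Variables (R : realType) (n : nat).
Hypothesis hn : (2 <= n)%N.
Local Notation F := (scalars R n).
Local Notation M := (Kmod R n).
Local Notation t := (tF R n).
Local Notation v := (vF R n).
Local Notation q := (vF R n ^+ 2).
Local Notation sp := (@pspectral R n).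
Local Notation vec := (@vec R n).
Local Notation sig := (@ospectral R n).
Implicit Types (x y : fixpt n) (p : pattern).

Lemma raises_bound i j x y : (0 < i < n)%N -> raises i j x y -> (0 < j <= i)%N.
Proof. by move=> iN []; lia. Qed.

Lemma pq_cls i y : (0 < i < n)%N -> pq i (cls R y) =
  \sum_(1 <= b < i.+1) core_coef q i.+1 i b (sig false (pat y)) *: vec (add_at (pat y) i b (-1)).
Proof.
move=> iN; rewrite /pq linext_cls.
apply: fsum_vec => [|j j' _ _|x|x j]; first exact: iota_uniq.
- exact: add_at_inj.
- rewrite /= corrP//; split=> [[j r]|[j]].
    have ji := raises_bound iN r.
    by exists j; [rewrite mem_index_iota | apply/(raises_pat' hn _ _ iN ji)].
  by rewrite mem_index_iota => ji /(raises_pat' hn _ _ iN ji) r; exists j.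
rewrite mem_index_iota => ji xE; have /(raises_pat' hn _ _ iN ji) r := xE.
have i1 : (i.+1 == i) = false by lia.
have spx k l : spectral R x k l = sp (add_at (pat y) i j (-1)) k l by rewrite -xE.
rewrite (S_E_div_S_Q_y R hn r) /core_coef; congr (_ / _).
  by apply: eq_bigr => l _; rewrite spx sp_add_at// i1.
(* The array of x has one less at (i, j), so the factor l = j is the 1 - q that [core_coef] sets
   apart. *)
rewrite (bigD1_seq j) ?mem_index_iota ?iota_uniq//= spx sp_lower// eqxx.
rewrite mulfK ?sp_neq0//; last by case/andP: ji.
by congr (_ * _); apply: eq_bigr => l lj; rewrite spx sp_lower// (negPf lj).
Qed.

Lemma shift_ratio1 (K : fieldType) (a s : K) : s != 0 -> s / (a^-1 * s) = a.
Proof. by move=> s0; rewrite invfM invrK mulrCA divff// mulr1. Qed.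

Lemma qLp_cls i x : (0 < i < n)%N -> qLp i (cls R x) =
  \sum_(1 <= b < i.+1) (sp (pat x) i b * core_coef q i.-1 i b (sig true (pat x))) *:
    vec (add_at (pat x) i b 1).
Proof.
move=> iN; rewrite /qLp linext_cls.
apply: fsum_vec => [|j j' _ _|y|y j]; first exact: iota_uniq.
- exact: add_at_inj.
- rewrite /= corrP//; split=> [[j r]|[j]].
    have ji := raises_bound iN r.
    by exists j; [rewrite mem_index_iota | apply/(raises_pat hn _ _ iN ji)].
  by rewrite mem_index_iota => ji /(raises_pat hn _ _ iN ji) r; exists j.
rewrite mem_index_iota => ji yE; have /(raises_pat hn _ _ iN ji) r := yE.
have i0 : (0 < i)%N by case/andP: iN.
have j0 : (0 < j)%N by case/andP: ji.
have spy k l : spectral R y k l = sp (add_at (pat x) i j 1) k l by rewrite -yE.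
rewrite (line_charE R hn r) (S_E_div_S_Q_x R hn r) /core_coef (prednK i0).
congr (_ * (_ / _)).
  by apply: eq_bigr => l _; rewrite /ospectral inv_ratio.
rewrite (bigD1_seq j) ?mem_index_iota ?iota_uniq//= spy sp_raise// eqxx.
have -> : spectral R x i j / (q^-1 * sp (pat x) i j) = q.
  exact: (shift_ratio1 _ (sp_neq0 R hn (pat x) i j0)).
congr (_ * _); apply: eq_bigr => l lj.
by rewrite spy sp_raise// (negPf lj) /ospectral inv_ratio.
Qed.

Lemma coef_shape (K : fieldType) (C w s c : K) : C * w * (s * c) = C * w * s * c.
Proof. by ring. Qed.

Lemma family_down C L (c : nat -> (nat -> nat) -> F) :
  (forall i x, c i (degree x) = C i * v ^ deg_form L i (pat x)) ->
  family_op false C L (fun i m => pq i (diagop (c i) m)).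
Proof.
move=> cE i iN; split; first exact: (linop_comp (linop_linext _) (linop_diagop _)).
have lpq : linop (@pq R n i) by exact: linop_linext.
move=> x; rewrite diagop_cls (linopZ _ _ lpq) pq_cls// scaler_sumr.
apply: eq_bigr => b _; rewrite scalerA cE -[core_coef _ _ _ _ _]mul1r coef_shape.
by rewrite /family_coef expr0.
Qed.

Lemma family_up C L (c : nat -> (nat -> nat) -> F) :
  (forall i x, c i (degree x) = C i * v ^ deg_form L i (pat x)) ->
  family_op true C L (fun i m => qLp i (diagop (c i) m)).
Proof.
move=> cE i iN; split; first exact: (linop_comp (linop_linext _) (linop_diagop _)).
have lqLp : linop (@qLp R n i) by exact: linop_linext.
move=> x; rewrite diagop_cls (linopZ _ _ lqLp) qLp_cls// scaler_sumr.
by apply: eq_bigr => b _; rewrite scalerA cE coef_shape /family_coef expr1.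
Qed.

End Instances.

Lemma deg_incr_below L j : deg_incr L j.+1 j = below L j.+1.
Proof.
rewrite /deg_incr /= eqxx (_ : (j.+1 == j) = false) 1?(_ : (j.+2 == j) = false); [|by lia|by lia].
by rewrite mulr1 !mulr0 !addr0.
Qed.

Lemma deg_incr_above L j : deg_incr L j j.+1 = above L j.
Proof.
rewrite /deg_incr eqxx (_ : (j.-1 == j.+1) = false) 1?(_ : (j == j.+1) = false); [|by lia|by lia].
by rewrite mulr1 !mulr0 !add0r.
Qed.

Lemma deg_incr_here L i : (0 < i)%N -> deg_incr L i i = here L i.
Proof.
move=> i0; rewrite /deg_incr eqxx (_ : (i.-1 == i) = false) 1?(_ : (i.+1 == i) = false);
  [|by lia|by lia].
by rewrite mulr1 !mulr0 addr0 add0r.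
Qed.

(** * The operators L_i and K_i *)

Section CartanMonomials.
Variables (K : fieldType) (h : K).
Hypothesis h0 : h != 0.

(** With i = j+1 and n - i = m+1, one has 2 i(n-i) - (i-1)(n-i+1) - (i+1)(n-i-1) = 2. Since h^2 = v,
    this is where the summand 1 in the exponent of K_i comes from. *)
Lemma cartan_fundamental (P t t' : K) (j m a b c : nat) : P != 0 -> t != 0 -> t' != 0 ->
  t' / t * (h ^+ 2) ^ (2 * b%:Z - a%:Z - c%:Z + 1) =
  (P^-1 * h ^+ (2 * a + j * m.+2))^-1 * ((P * t)^-1 * h ^+ (2 * b + j.+1 * m.+1)) *
  ((P * t)^-1 * h ^+ (2 * b + j.+1 * m.+1)) *
  ((P * t * t')^-1 * h ^+ (2 * c + j.+2 * m))^-1.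
Proof.
move=> P0 t0 t'0.
have -> : (h ^+ 2) ^ (2 * b%:Z - a%:Z - c%:Z + 1) =
    (h ^+ (2 * a + j * m.+2))^-1 * h ^+ (2 * b + j.+1 * m.+1) *
    h ^+ (2 * b + j.+1 * m.+1) * (h ^+ (2 * c + j.+2 * m))^-1.
  rewrite !exprnP exprz_exp !invr_expz -!expfzDr//; congr (_ ^ _).
  by rewrite !PoszD !PoszM !intS; ring.
have e k : h ^+ k != 0 by rewrite expf_neq0.
by field; rewrite ?P0 ?t0 ?t'0 ?e.
Qed.

Lemma sqr_exprz (m : int) : (h ^+ 2) ^ m = h ^ (2 * m).
Proof. by rewrite exprnP exprz_exp. Qed.

Lemma fundamental_shift (P : K) (d m : int) (k : nat) (e : int) :
  P * h ^ (2 * (d + e * m) + k%:Z) = (h ^+ 2) ^ (e * m) * (P * h ^ (2 * d + k%:Z)).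
Proof.
rewrite sqr_exprz mulrCA -expfzDr//; congr (_ * _ ^ _); ring.
Qed.

Lemma conj_scalar (a c w : K) : a != 0 -> a^-1 * (c * (w * a)) = w * c.
Proof. by move=> a0; field. Qed.

Lemma mulr_rot (a b c d : K) : a * b * c * d = d * c * b * a.
Proof. by ring. Qed.

End CartanMonomials.

Section Cartan.
Variables (R : realType) (n : nat).
Hypothesis hn : (2 <= n)%N.
Local Notation F := (scalars R n).
Local Notation M := (Kmod R n).
Local Notation t := (tF R n).
Local Notation v := (vF R n).
Local Notation h := (vhalf R n).
Local Notation vec := (@vec R n).
Implicit Types (x y : fixpt n) (p : pattern).

Definition L_pat k p : F := (\prod_(1 <= l < k.+1) t l)^-1 * h ^ (2 * degp p k + (k * (n - k))%:Z).

Lemma prod_tF_neq0 k : \prod_(1 <= l < k.+1) t l != 0.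
Proof.
rewrite prodf_seq_neq0; apply/allP => l; rewrite mem_index_iota => /andP[l0 _].
exact: tF_neq0.
Qed.

Lemma L_pat_neq0 k p : L_pat k p != 0.
Proof. by rewrite mulf_neq0 ?invr_eq0 ?prod_tF_neq0// expfz_neq0// vhalf_neq0. Qed.

(** At k = 0 and k = n the product of the t_l is 1 and both the degree and k(n-k) vanish, so the
    general formula includes the convention L_0 = L_n = 1. *)
Lemma L_scalarE k x : (k <= n)%N -> L_scalar R n k (degree x) =
  (\prod_(1 <= l < k.+1) t l)^-1 * h ^+ (2 * degree x k + k * (n - k)).
Proof.
move=> kn; rewrite /L_scalar; case: ifP => // kN.
have [->|->] : k = 0%N \/ k = n by lia.
  by rewrite /degree !big_geq// invr1 mul1r.
rewrite prod_tF// subnn muln0 invr1 mul1r /degree big1// => l _.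
exact: entry_ge_n.
Qed.

Lemma L_scalar_pat k x : (k <= n)%N -> L_scalar R n k (degree x) = L_pat k (pat x).
Proof. by move=> kn; rewrite L_scalarE// /L_pat degp_pat exprnP PoszD PoszM. Qed.

Lemma diagop_vec c (c' : pattern -> F) p : (forall x, c (degree x) = c' (pat x)) ->
  diagop c (vec p) = c' p *: vec p.
Proof.
move=> cE; have [[x <-]|np] := pselect (valid n p); first by rewrite vec_pat diagop_cls cE.
by rewrite vec_invalid// scaler0 linop0//; apply: linop_diagop.
Qed.

Lemma L_conj (up : bool) C L T i j : family_op up C L T -> (0 < i < n)%N -> (0 < j < n)%N ->
  forall m : M, L_op i (T j (Linv_op i m)) = v ^ (sgn up * (i == j)%:Z) *: T j m.
Proof.
move=> fT iN jN; have [lT Tx] := fT j jN; have iln : (i <= n)%N by lia.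
have lL : linop (@L_op R n i) by exact: linop_diagop.
have lL' : linop (@Linv_op R n i) by exact: linop_diagop.
apply: linop_ext => [||x].
- exact: (linop_comp lL (linop_comp lT lL')).
- exact: (linopZ2 _ lT).
have -> : Linv_op i (cls R x) = (L_pat i (pat x))^-1 *: cls R x.
  by rewrite /Linv_op diagop_cls L_scalar_pat.
rewrite (linopZ _ _ lT) (linopZ _ _ lL) Tx (linop_sum _ _ _ lL) !scaler_sumr.
apply: eq_big_seq => b; rewrite mem_index_iota => bj.
rewrite (linopZ _ _ lL) /L_op (diagop_vec (c' := L_pat i)) => [|y]; last exact: L_scalar_pat.
have -> : L_pat i (add_at (pat x) j b (sgn up)) =
    v ^ (sgn up * (i == j)%:Z) * L_pat i (pat x).
  by rewrite /L_pat degp_add_at// (fundamental_shift (vhalf_neq0 R n)).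
rewrite [X in _ *: X]scalerA [RHS]scalerA scalerA; congr (_ *: _).
exact: conj_scalar (L_pat_neq0 _ _).
Qed.

Lemma K_fundamental i : (0 < i < n)%N ->
  forall m : M, K_op i m = Linv_op i.-1 (L_op i (L_op i (Linv_op i.+1 m))).
Proof.
move=> iN; have lin c := @linop_diagop R n c.
apply: linop_ext => [||x].
- exact: lin.
- exact: (linop_comp (lin _) (linop_comp (lin _) (linop_comp (lin _) (lin _)))).
rewrite /K_op /Linv_op /L_op diagop_cls.
rewrite diagop_cls (linopZ _ _ (lin _)) diagop_cls scalerA (linopZ _ _ (lin _)) diagop_cls scalerA.
rewrite (linopZ _ _ (lin _)) diagop_cls scalerA; congr (_ *: _).
case: i iN => // j jN; rewrite /K_scalar /= !L_scalarE; [|by lia|by lia|by lia].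
have [m nE] : exists m, n = (j.+2 + m)%N by exists (n - j.+2)%N; lia.
have e1 : (n - j)%N = m.+2 by lia.
have e2 : (n - j.+1)%N = m.+1 by lia.
have e3 : (n - j.+2)%N = m by lia.
have p1 : \prod_(1 <= l < j.+2) t l = \prod_(1 <= l < j.+1) t l * t j.+1.
  by rewrite big_nat_recr.
have p2 : \prod_(1 <= l < j.+3) t l = \prod_(1 <= l < j.+1) t l * t j.+1 * t j.+2.
  by rewrite big_nat_recr// p1.
rewrite e1 e2 e3 p2 p1.
rewrite (cartan_fundamental (vhalf_neq0 R n) j m (degree x j) (degree x j.+1) (degree x j.+2)
  (prod_tF_neq0 j) (tF_neq0 R hn (ltn0Sn j)) (tF_neq0 R hn (ltn0Sn j.+1))).
exact: mulr_rot.
Qed.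

Lemma L_opC i j (m : M) : L_op i (L_op j m) = L_op j (L_op i m).
Proof.
have lin c := @linop_diagop R n c; move: m; apply: linop_ext => [||x].
- exact: (linop_comp (lin _) (lin _)).
- exact: (linop_comp (lin _) (lin _)).
rewrite /L_op !diagop_cls !(linopZ _ _ (lin _)) !diagop_cls !scalerA.
by congr (_ *: _); exact: mulrC.
Qed.

End Cartan.

(** [form_E] and [form_F] add up to [form_e] plus the constant -2i. In the commutator this constant
    is compensated by the increment -2i of [form_E] when d_i grows, so both pairs yield the same
    Cartan element. *)
Definition form_F : degree_form :=
  DegreeForm (fun i => - i%:Z) (fun i => 2 * i%:Z) (fun i => - i%:Z) (fun i => - i%:Z).
Definition form_E : degree_form :=
  DegreeForm (fun i => i%:Z - 1) (fun i => - (2 * i%:Z)) (fun i => i%:Z + 1) (fun i => - i%:Z).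
Definition form_e : degree_form :=
  DegreeForm (fun=> -1) (fun=> 0) (fun=> 1) (fun=> 0).
Definition form_f : degree_form :=
  DegreeForm (fun=> 0) (fun=> 0) (fun=> 0) (fun=> 0).

Section PrefactorMonomials.
Variables (K : fieldType) (v : K).
Hypothesis v0 : v != 0.

Lemma prefactor_EF (s t : K) (i : nat) (m m' : int) : s != 0 -> t != 0 -> m = m' -> (0 < i)%N ->
  - (s ^- i.+1 * t ^+ i.-1) * (s ^+ i * t ^- i) * v ^ m = - (s^-1 * t^-1 * v ^ m').
Proof.
move=> s0 t0 -> i0; case: i i0 => // i _; rewrite /= !exprS.
have e (x : K) : x != 0 -> x ^+ i != 0 by move=> x0; rewrite expf_neq0.
by field; rewrite ?s0 ?t0 ?e.
Qed.

Lemma prefactor_ef (s t : K) (m m' : int) : m = m' ->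
  - (s^-1 * t^-1) * 1 * v ^ m = - (s^-1 * t^-1 * v ^ m').
Proof. by move=> ->; rewrite mulr1 mulNr. Qed.

Lemma ratio_exprz (d d' : int) : v ^ (d - d') = v ^ d / v ^ d'.
Proof. by rewrite expfzDr// -invr_expz. Qed.

End PrefactorMonomials.

Section Families.
Variables (R : realType) (n : nat).
Hypothesis hn : (2 <= n)%N.
Local Notation F := (scalars R n).
Local Notation t := (tF R n).
Local Notation v := (vF R n).

Definition coef_F (i : nat) : F := t i.+1 ^+ i * t i ^- i.
Definition coef_E (i : nat) : F := - (t i.+1 ^- i.+1 * t i ^+ i.-1).
Definition coef_e (i : nat) : F := - ((t i.+1)^-1 * (t i)^-1).

Lemma family_F : family_op false coef_F form_F (@F_op R n).
Proof.
apply: (family_down hn) => i x; rewrite /deg_form /= !degp_pat.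
by congr (_ * _ ^ _); ring.
Qed.

Lemma family_E : family_op true coef_E form_E (@E_op R n).
Proof.
apply: (family_up hn) => i x; rewrite /deg_form /= !degp_pat mulNr.
by congr (- (_ * _ ^ _)); ring.
Qed.

Lemma family_e : family_op true coef_e form_e (@e_op R n).
Proof.
apply: (family_up hn) => i x; rewrite /deg_form /= !degp_pat mulNr.
by congr (- (_ * _ ^ _)); ring.
Qed.

Lemma family_f : family_op false (fun=> 1) form_f (@f_op R n).
Proof.
have := @family_down R n hn (fun=> 1) form_f (fun _ _ => 1).
move=> /(_ _) fF i iN; have [|lT Tx] := fF _ i iN.
  by move=> k x; rewrite /deg_form /= !mul0r !addr0 expr0z mulr1.
have id1 x : diagop (fun=> 1) (cls R x) = cls R x by rewrite diagop_cls scale1r.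
split; first exact: linop_linext.
by move=> x; rewrite -Tx id1.
Qed.

End Families.

Lemma cmat_below j : cmat j.+1 j = 1.
Proof. by rewrite /cmat eqxx (_ : (j == j.+2) = false)//; lia. Qed.

Lemma cmat_above j : cmat j j.+1 = -1.
Proof. by rewrite /cmat eqxx. Qed.

Lemma cmat_far i j : i.+1 != j -> j.+1 != i -> cmat i j = 0.
Proof. by rewrite /cmat ![_.+1 == _]eq_sym => /negPf -> /negPf ->. Qed.

Lemma nonadjacent i j : i != j -> i != j.+1 -> j != i.+1 -> (i.+1 < j)%N || (j.+1 < i)%N.
Proof. by lia. Qed.

Lemma deg_incr_EF i j : i != j -> - deg_incr form_E i j - deg_incr form_F j i = 0.
Proof.
move=> ij; have [->|ij'] := eqVneq i j.+1.
  by rewrite deg_incr_below deg_incr_above /=; lia.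
have [->|ji'] := eqVneq j i.+1; first by rewrite deg_incr_below deg_incr_above /=; lia.
have far := nonadjacent ij ij' ji'.
by rewrite !deg_incr_far// 1?orbC.
Qed.

Lemma deg_incr_ef i j : (0 < i)%N -> - deg_incr form_e i j - deg_incr form_f j i = cmat i j.
Proof.
move=> i0; have -> : deg_incr form_f j i = 0 by rewrite /deg_incr /= !mul0r !addr0.
rewrite subr0; have [->|ij'] := eqVneq i j.+1; first by rewrite deg_incr_below cmat_below.
have [->|ji'] := eqVneq j i.+1; first by rewrite deg_incr_above cmat_above.
rewrite cmat_far 1?eq_sym//.
have [<-|ij] := eqVneq i j; last by rewrite deg_incr_far// nonadjacent.
by rewrite deg_incr_here.
Qed.

Section SerreExponents.
Variables (K : fieldType) (v : K).

Lemma nbr_near (up : bool) (i j : nat) : (0 < i)%N -> (i == j.+1) || (j == i.+1) ->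
  (nbr up i == j) = if up then i == j.+1 else j == i.+1.
Proof. by rewrite /nbr; case: up; lia. Qed.

(** Of the two forms only the coefficients by which each sees the other's degree enter: the one
    above at the smaller index and the one below at the larger. *)
Lemma serre_exponent up L (a : int) i j : (0 < i)%N -> (i == j.+1) || (j == i.+1) ->
  (i = j.+1 -> a + sgn up * (above L j - below L i) = sgn up) ->
  (j = i.+1 -> a + sgn up * (below L j - above L i) = - sgn up) ->
  v ^ (a + sgn up * (deg_incr L j i - deg_incr L i j)) = if nbr up i == j then v else v^-1.
Proof.
move=> i0 ij dec inc; rewrite nbr_near//; have [e|e] := eqVneq i j.+1.
  have ne : (j == i.+1) = false by lia.
  rewrite ne {1 2}e deg_incr_above deg_incr_below -e dec//.
  by case: up {dec inc}; rewrite /= /sgn ?opprK ?expr1z ?exprN1.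
move: ij; rewrite (negPf e) => /= /eqP ji.
rewrite {1 2}ji deg_incr_above deg_incr_below -ji inc// ji eqxx.
by case: up {dec inc}; rewrite /= /sgn ?opprK ?expr1z ?exprN1.
Qed.

End SerreExponents.

Section SerreRelations.
Variables (R : realType) (n : nat).
Hypothesis hn : (2 <= n)%N.
Local Notation F := (scalars R n).
Local Notation M := (Kmod R n).
Local Notation v := (vF R n).

Lemma serre_unscaled up C L (T : nat -> M -> M) i j : family_op up C L T ->
  (0 < i < n)%N -> (0 < j < n)%N -> (i == j.+1) || (j == i.+1) ->
  v ^ (sgn up * (deg_incr L j i - deg_incr L i j)) = (if nbr up i == j then v else v^-1) ->
  forall m, T i (T i (T j m)) - (v + v^-1) *: T i (T j (T i m)) + T j (T i (T i m)) = 0.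
Proof.
move=> fT iN jN ij e m; have := @family_serre R n hn up C L T i j 1 fT iN jN ij.
by rewrite expr1n !mul1r => /(_ e m); rewrite scale1r.
Qed.

Lemma serre_twisted up C L (T : nat -> M -> M) i j (a : int) : family_op up C L T ->
  (0 < i < n)%N -> (0 < j < n)%N -> (i == j.+1) || (j == i.+1) ->
  v ^ (a + sgn up * (deg_incr L j i - deg_incr L i j)) = (if nbr up i == j then v else v^-1) ->
  forall m, T i (T i (T j m)) - (v ^ a * (v + v^-1)) *: T i (T j (T i m))
            + v ^ (2 * a) *: T j (T i (T i m)) = 0.
Proof.
move=> fT iN jN ij e m; have := @family_serre R n hn up C L T i j (v ^ a) fT iN jN ij.
rewrite -expfzDr ?vF_neq0// => /(_ e m).
have -> : v ^ (2 * a) = (v ^ a) ^+ 2 by rewrite exprnP exprz_exp mulrC.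
exact.
Qed.

(** The exponent a, which is 0, is kept so that the twisted relation with v^(c_ii) has the same form
    as the untwisted one. *)
Lemma commutator_diag (C C' : nat -> F) (L L' : degree_form) (T S : nat -> M -> M) (a : int) i :
  family_op true C L T -> family_op false C' L' S -> (0 < i < n)%N ->
  deg_incr L i i + deg_incr L' i i = 0 ->
  (forall p, C i * C' i * v ^ (deg_form L i p + deg_form L' i p - deg_incr L i i) =
    - ((tF R n i.+1)^-1 * (tF R n i)^-1 * v ^ (degp p i.+1 - degp p i.-1))) ->
  a = 0 -> forall m, T i (S i m) - v ^ a *: S i (T i m) =
    (v - v^-1)^-1 *: (K_op i m - Kinv_op i m).
Proof.
move=> fT fS iN LL sc -> m; rewrite expr0z scale1r; apply: (family_commutator hn fT fS iN LL) => p.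
by rewrite sc ratio_exprz ?vF_neq0.
Qed.

End SerreRelations.

Theorem theorem2p12 (R : realType) (n : nat) (hn : (2 <= n)%N) :
  let v := vF R n in
  let K := @K_op R n in let K' := @Kinv_op R n in
  let L := @L_op R n in let L' := @Linv_op R n in
  let E := @E_op R n in let F := @F_op R n in
  let e := @e_op R n in let f := @f_op R n in
  forall i j : nat, (0 < i < n)%N -> (0 < j < n)%N ->
  (* (1) *)
  ((forall m, L i (L j m) = L j (L i m)) /\
   (forall m, K i m = L' i.-1 (L i (L i (L' i.+1 m))))) /\
  (* (2) *)
  ((forall m, L i (E j (L' i m)) = v ^+ (i == j) *: E j m) /\
   (forall m, L i (F j (L' i m)) = v ^- (i == j) *: F j m)) /\
  (* (3) *)
  (forall m, E i (F j m) - F j (E i m) =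
     (i == j)%:R *: ((v - v^-1)^-1 *: (K i m - K' i m))) /\
  (* (4) *)
  ((i.+1 < j)%N || (j.+1 < i)%N ->
     (forall m, E i (E j m) - E j (E i m) = 0) /\
     (forall m, F i (F j m) - F j (F i m) = 0)) /\
  (* (5) *)
  ((i == j.+1) || (j == i.+1) ->
     (forall m, E i (E i (E j m)) - (v + v^-1) *: E i (E j (E i m))
                + E j (E i (E i m)) = 0) /\
     (forall m, F i (F i (F j m)) - (v + v^-1) *: F i (F j (F i m))
                + F j (F i (F i m)) = 0)) /\
  (* (2') *)
  ((forall m, L i (e j (L' i m)) = v ^+ (i == j) *: e j m) /\
   (forall m, L i (f j (L' i m)) = v ^- (i == j) *: f j m)) /\
  (* (3') *)
  (forall m, e i (f j m) - v ^ cmat i j *: f j (e i m) =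
     (i == j)%:R *: ((v - v^-1)^-1 *: (K i m - K' i m))) /\
  (* (4') *)
  ((i.+1 < j)%N || (j.+1 < i)%N ->
     (forall m, e i (e j m) - e j (e i m) = 0) /\
     (forall m, f i (f j m) - f j (f i m) = 0)) /\
  (* (5') *)
  ((i == j.+1) || (j == i.+1) ->
     (forall m, e i (e i (e j m))
                - (v ^ cmat j i * (v + v^-1)) *: e i (e j (e i m))
                + v ^ (2 * cmat j i) *: e j (e i (e i m)) = 0) /\
     (forall m, f i (f i (f j m))
                - (v ^ cmat j i * (v + v^-1)) *: f i (f j (f i m))
                + v ^ (2 * cmat j i) *: f j (f i (f i m)) = 0)).
Proof.
move=> v K K' L L' E F e f i j iN jN.
have fE := family_E R hn; have fF := family_F R hn.
have fe := family_e R hn; have ff := family_f R hn.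
have v0 := vF_neq0 R n; have i0 : (0 < i)%N by case/andP: iN.
have t0 := tF_neq0 R hn i0; have t0' := tF_neq0 R hn (ltn0Sn i).
have raiseE (b : bool) : vF R n ^ (sgn true * b%:Z) = vF R n ^+ b by rewrite mul1r exprnP.
have lowerE (b : bool) : vF R n ^ (sgn false * b%:Z) = vF R n ^- b.
  by rewrite mulN1r -invr_expz exprnP.
split; [|split; [|split; [|split; [|split; [|split; [|split; [|split]]]]]]].
- by split; [exact: L_opC | exact: K_fundamental].
- by split=> m; [rewrite -raiseE; exact: (L_conj hn fE) | rewrite -lowerE; exact: (L_conj hn fF)].
- move=> m; have [<-|ij] := eqVneq i j; last first.
    rewrite scale0r; have := family_commute hn fE fF iN jN ij m.
    by rewrite deg_incr_EF// expr0z scale1r.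
  rewrite scale1r -[F i (E i m)]scale1r -[X in X *: F i _](expr0z v).
  apply: (commutator_diag hn fE fF iN) => // [|p].
    by rewrite !deg_incr_here//= addNr.
  apply: prefactor_EF => //.
  by rewrite deg_incr_here// /deg_form /=; ring.
- by move=> far; split; [exact: (family_comm hn fE) | exact: (family_comm hn fF)].
- move=> ij; split; [apply: (serre_unscaled hn fE) | apply: (serre_unscaled hn fF)] => //.
    by rewrite -[X in _ ^ X]add0r; apply: serre_exponent => // -> /=; lia.
  by rewrite -[X in _ ^ X]add0r; apply: serre_exponent => // -> /=; lia.
- by split=> m; [rewrite -raiseE; exact: (L_conj hn fe) | rewrite -lowerE; exact: (L_conj hn ff)].
- move=> m; have [<-|ij] := eqVneq i j; last first.
    by rewrite scale0r -deg_incr_ef//; exact: (family_commute hn fe ff).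
  rewrite scale1r; apply: (commutator_diag hn fe ff iN) => [|p|].
  - by rewrite !deg_incr_here//= addr0.
  - apply: prefactor_ef.
    by rewrite deg_incr_here// /deg_form /=; ring.
  - by rewrite cmat_far// neq_ltn ltnSn orbT.
- by move=> far; split; [exact: (family_comm hn fe) | exact: (family_comm hn ff)].
- move=> ij; split; [apply: (serre_twisted hn fe) | apply: (serre_twisted hn ff)] => //.
    by apply: serre_exponent => // -> /=; rewrite ?cmat_above ?cmat_below.
  by apply: serre_exponent => // -> /=; rewrite ?cmat_above ?cmat_below.
Qed.
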